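(* Let $d\in\{2,3,\dots\}$, $\nu,\eta\in(0,+\infty)$, $\mu:=\min(\nu,\eta)$. Let $\mathbf{v}_0\in\mathbf{E}^\infty$, and denote by $\mathbf{v}\in C^\infty([0,+\infty),\mathbf{H}^\infty)$ the global, decaying MHD solution with initial datum $\mathbf{v}_0$. For each $p\in\mathbb{R}$, let $J_p$ denote any nonnegative real number such that $$\int_0^{+\infty}\|\mathbf{v}(t)\|_p\,dt\le J_p .$$ In addition, choose any real $n\in(d/2+1,+\infty)$ and define $$\rho_n:=\frac{\mu}{\hat G_n}\,e^{-\hat G_nJ_n-\hat K_nJ_{n+1}} .$$ Then $$\mathbf{u}_0\in\mathbf{H}^\infty,\ \ \|\mathbf{u}_0-\mathbf{v}_0\|_n<\rho_n\ \Longrightarrow\ \mathbf{u}_0\in\mathbf{E}^\infty .$$ If $\mathbf{u}_0\in\mathbf{H}^\infty$, $\|\mathbf{u}_0-\mathbf{v}_0\|_n<\rho_n$ and $\mathbf{u}$ is the global, decaying MHD solution with datum $\mathbf{u}_0$, then, setting $\delta_q:=\|\mathbf{u}_0-\mathbf{v}_0\|_q$ for real $q \ge n$, for all $t\in[0,+\infty)$ we have $$\|\mathbf{u}(t)-\mathbf{v}(t)\|_n\le\frac{e^{\hat G_nJ_n+\hat K_nJ_{n+1}}}{1-\delta_n/\rho_n}\,\delta_n\,e^{-\mu t},$$ $$\|\mathbf{u}(t)-\mathbf{v}(t)\|_p\le \exp\!\Big(\hat G_pJ_p+\hat K_pJ_{p+1}+\frac{\hat G_{pn}\,\delta_n/\rho_n}{\hat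 G_n(1-\delta_n/\rho_n)}\Big)\,\delta_p\,e^{-\mu t}\qquad\text{for every real }p\in(n,+\infty).$$ Under the stronger assumptions $\mathbf{u}_0\in\mathbf{H}^\infty$ and $\delta_n=\|\mathbf{u}_0-\mathbf{v}_0\|_n\le\rho_n/2$, these bounds imply the following simpler bounds: for all $t\in[0,+\infty)$, $$\|\mathbf{u}(t)-\mathbf{v}(t)\|_n\le 2\,e^{\hat G_nJ_n+\hat K_nJ_{n+1}}\,\delta_n\,e^{-\mu t},$$ $$\|\mathbf{u}(t)-\mathbf{v}(t)\|_p\le \exp\!\Big(\hat G_pJ_p+\hat K_pJ_{p+1}+\frac{\hat G_{pn}}{\hat G_n}\Big)\,\delta_p\,e^{-\mu t}\qquad\text{for every real }p\in(n,+\infty).$$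
   Context: Function spaces. Let $\mathbb{T}^d:=(\mathbb{R}/2\pi\mathbb{Z})^d$. Let $\mathbb{D}'$ be the space of $\mathbb{R}^d$-valued distributions on $\mathbb{T}^d$; each $v\in\mathbb{D}'$ has a Fourier expansion $v=\sum_{k\in\mathbb{Z}^d}v_ke_k$, $e_k(x):=(2\pi)^{-d/2}e^{ik\cdot x}$, $v_k=\overline{v_{-k}}\in\mathbb{C}^d$, where $a\cdot b:=\sum_{r=1}^d a_rb_r$ for $a,b\in\mathbb{C}^d$. For $p\in\mathbb{R}$, $$H^p:=\{v\in\mathbb{D}' : k\cdot v_k=0\ \forall k\in\mathbb{Z}^d,\ v_0=0,\ \sum_{k\ne0}|k|^{2p}|v_k|^2<+\infty\}$$ (divergence-free, mean-zero fields), with inner product $\langle v|w\rangle_p:=\sum_{k\neq0}|k|^{2p}\,\overline{v_k}\cdot w_k$ and norm $\|v\|_p:=\sqrt{\langle v|v\rangle_p}$. Set $H^\infty:=\bigcap_{p\in\mathbb{R}}H^p$, which equals the space of $C^\infty$ divergence-free, mean-zero vector fields $\mathbb{T}^d\to\mathbb{R}^d$; it is a Fréchet space with the norms $\|\cdot\|_p$, $p\in\mathbb{R}$. Pairs. For $p\in\mathbb{R}$, $\mathbf{H}^p:=H^p\times H^p$ with $\langle\mathbf{v}|\mathbf{w}\rangle_p:=\langle v|w\rangle_p+\langle c|g\rangle_p$ and $\|\mathbf{v}\|_p:=\sqrt{\|v\|_p^2+\|c\|_p^2}$ for $\mathbf{v}=(v,c)$, $\mathbf{w}=(w,g)$. $\mathbf{H}^\infty:=\bigcap_{p\in\mathbb{R}}\mathbf{H}^p=H^\infty\times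 H^\infty$, a Fréchet space with the norms $\|\cdot\|_p$, $p\in\mathbb{R}$. Operators. The Leray projection $\mathfrak{L}$ acts on $\mathbb{D}'$ by $(\mathfrak{L}v)_k=\mathfrak{L}_kv_k$, where $\mathfrak{L}_k$ is the orthogonal projection of $\mathbb{C}^d$ onto $\{a\in\mathbb{C}^d:k\cdot a=0\}$. Put $\mathscr{P}(v,w):=-\mathfrak{L}((v\cdot\nabla)w)$, where $(v\cdot\nabla)w=\sum_{s=1}^d v_s\partial_sw$. For pairs $\mathbf{v}=(v,c)$, $\mathbf{w}=(w,g)$ put $$\mathbf{A}\mathbf{v}:=(\nu\Delta v,\eta\Delta c),\qquad \mathbf{P}(\mathbf{v},\mathbf{w}):=(\mathscr{P}(v,w)-\mathscr{P}(c,g),\ \mathscr{P}(v,g)-\mathscr{P}(c,w)).$$ Constants. $\hat K_{pn},\hat G_{pn}\in(0,+\infty)$ are fixed constants (known to exist, depending on $d$) such that $$\|\mathbf{P}(\mathbf{v},\mathbf{w})\|_p\le\tfrac12\hat K_{pn}(\|\mathbf{v}\|_p\|\mathbf{w}\|_{n+1}+\|\mathbf{v}\|_n\|\mathbf{w}\|_{p+1})\quad\text{for real } p\ge n>d/2,\ \mathbf{v}\in\mathbf{H}^p,\ \mathbf{w}\in\mathbf{H}^{p+1},$$ $$|\langle\mathbf{P}(\mathbf{v},\mathbf{w})|\mathbf{w}\rangle_p|\le\tfrac12\hat G_{pn}(\|\mathbf{v}\|_p\|\mathbf{w}\|_n+\|\mathbf{v}\|_n\|\mathbf{w}\|_p)\|\mathbf{w}\|_p\quad\text{for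 real } p\ge n>d/2+1,\ \mathbf{v}\in\mathbf{H}^p,\ \mathbf{w}\in\mathbf{H}^{p+1}.$$ Write $\hat K_q:=\hat K_{qq}$, $\hat G_q:=\hat G_{qq}$. MHD solutions. A solution of the MHD equations is a map $\mathbf{u}=(u,b)\in C^\infty([0,T),\mathbf{H}^\infty)$, $T\in(0,+\infty]$, with $\frac{d\mathbf{u}}{dt}=\mathbf{A}\mathbf{u}+\mathbf{P}(\mathbf{u},\mathbf{u})$ on $[0,T)$; it is a solution of the MHD Cauchy problem with initial datum $\mathbf{u}_0\in\mathbf{H}^\infty$ if moreover $\mathbf{u}(0)=\mathbf{u}_0$. For each $\mathbf{u}_0\in\mathbf{H}^\infty$ the Cauchy problem is known to have a unique maximal (not extendable) solution. A solution is global if $T=+\infty$. Decaying solutions. A global solution $\mathbf{v}$ is called a global, decaying MHD solution if it has the following properties, which are known to be equivalent to each other: (a) $\|\mathbf{v}(t_0)\|_n<\mu/\hat G_n$ for some real $n>d/2+1$ and some $t_0\ge0$; (b) for some real $n>d/2+1$, $\|\mathbf{v}(t)\|_n\to0$ as $t\to+\infty$; (c) for all $p\in\mathbb{R}$, $\|\mathbf{v}(t)\|_p\to0$ as $t\to+\infty$; (d) for some real $n>d/2+1$ and some $\gamma>0$, $\int_0^{+\infty}\|\mathbf{v}(t)\|_n^\gamma dt<+\infty$; (e) for all $p\in\mathbb{R}$ and $\gamma>0$, $\int_0^{+\infty}\|\mathbf{v}(t)\|_p^\gamma dt<+\infty$; (f) for some real $n>d/2+1$ there is $C_n\in[0,+\infty)$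 with $\|\mathbf{v}(t)\|_n\le C_ne^{-\mu t}$ for all $t\ge0$; (g) for each $p\in\mathbb{R}$ there is $C_p\in[0,+\infty)$ with $\|\mathbf{v}(t)\|_p\le C_pe^{-\mu t}$ for all $t\ge0$. $\mathbf{E}^\infty\subset\mathbf{H}^\infty$ (depending on $\nu,\eta$) is the set of all initial data $\mathbf{v}_0\in\mathbf{H}^\infty$ whose maximal MHD solution is global and decaying. *)

(* Defs.v *)
From HB Require Import structures.
From mathcomp Require Import all_boot all_order all_algebra.
From mathcomp Require Import complex.
From mathcomp Require Import all_classical all_reals all_analysis.

Set Implicit Arguments.
Unset Strict Implicit.
Unset Printing Implicit Defensive.

Import Order.TTheory GRing.Theory Num.Theory.
Import numFieldNormedType.Exports.

Import ComplexField.Normc.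

Local Open Scope classical_set_scope.
Local Open Scope complex_scope.
Local Open Scope ring_scope.

(* Sum of an absolutely summable family over D, as (sum of positive parts)
   minus (sum of negative parts). *)
Definition rsum (R : realType) (I : choiceType) (D : set I) (f : I -> R) : R :=
  let F := fun i => (f i)%:E in fine (esum D F^\+ - esum D F^\-)%E.

Definition csum (R : realType) (I : choiceType) (D : set I) (f : I -> R[i]) :
    R[i] :=
  rsum D (fun i => complex.Re (f i)) +i* rsum D (fun i => complex.Im (f i)).

(* A distribution v on T^d = (R/2piZ)^d is represented by the family of its
   Fourier coefficients v_k, k in Z^d, with respect to
   e_k(x) = (2pi)^(-d/2) exp(i k.x).  Families arising in this way are exactly
   those of at most polynomial growth. *)

Notation lattice d := 'rV[int]_d.
Notation scoef R d := (lattice d -> R[i]).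
Notation vcoef R d := (lattice d -> 'rV[R[i]]_d).

Section TorusFields.
Variables (R : realType) (d : nat).
Implicit Types (k h : lattice d) (a b : 'rV[R[i]]_d) (p : R).

Definition fourier_basis k (x : 'rV[R]_d) : R[i] :=
  let theta := \sum_(r < d) (k 0 r)%:~R * x 0 r in
  ((2 * pi) `^ (- (d%:R / 2)))%:C * (cos theta +i* sin theta).

(* Bilinear: no conjugation. *)
Definition dotc a b : R[i] := \sum_(r < d) a 0 r * b 0 r.
Definition conjv a : 'rV[R[i]]_d := map_mx conjc a.
Definition sqnormv a : R := \sum_(r < d) normc (a 0 r) ^+ 2.

Definition latc k : 'rV[R[i]]_d := map_mx intr k.
Definition latnorm k : R := Num.sqrt (\sum_(r < d) (k 0 r)%:~R ^+ 2).

Definition torus_distribution (v : vcoef R d) : Prop :=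
  (forall k, v k = conjv (v (- k))) /\
  exists (C : R) (N : nat), forall k r,
    normc (v k 0 r) <= C * (1 + latnorm k) ^+ N.

Definition Hsp p (v : vcoef R d) : Prop :=
  [/\ torus_distribution v,
      forall k, dotc (latc k) (v k) = 0,
      v 0 = 0 &
      (\esum_(k in [set~ 0%R]) (latnorm k `^ (2 * p) * sqnormv (v k))%:E
         < +oo)%E].

(* The complex sum is real for R^d-valued fields, the terms at k and - k being
   conjugate; Re only changes the type. *)
Definition inner p (v w : vcoef R d) : R :=
  complex.Re (csum [set~ 0]
    (fun k => (latnorm k `^ (2 * p))%:C * dotc (conjv (v k)) (w k))).

Definition Hnorm p (v : vcoef R d) : R := Num.sqrt (inner p v v).

Definition Hinf (v : vcoef R d) : Prop := forall p, Hsp p v.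

Definition deriv_dir (s : 'I_d) (v : vcoef R d) : vcoef R d :=
  fun k => ('i%C * latc k 0 s) *: v k.

Definition laplacian (v : vcoef R d) : vcoef R d :=
  \sum_(s < d) deriv_dir s (deriv_dir s v).

(* [kermx (latc k)^T] has row space {a | k.a = 0}. *)
Definition leray_mx k : 'M[R[i]]_d := proj_ortho (kermx (latc k)^T).

Definition leray (v : vcoef R d) : vcoef R d := fun k => v k *m leray_mx k.

(* Fourier coefficients of a pointwise product: expand both factors and use
   [fourier_basisM] below. *)
Definition fmul (f g : scoef R d) : scoef R d :=
  fun k => ((2 * pi) `^ (- (d%:R / 2)))%:C * csum setT (fun h => f h * g (k - h)).

Definition advect (v w : vcoef R d) : vcoef R d :=
  fun k => \row_(r < d) \sum_(s < d)
    fmul (fun h => v h 0 s) (fun h => deriv_dir s w h 0 r) k.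

Definition Pop (v w : vcoef R d) : vcoef R d := - leray (advect v w).

End TorusFields.

Lemma fourier_basisM (R : realType) (d : nat) (h k : lattice d) (x : 'rV[R]_d) :
  fourier_basis h x * fourier_basis k x =
  ((2 * pi) `^ (- (d%:R / 2)))%:C * fourier_basis (h + k) x.
Proof.
rewrite /fourier_basis.
have -> : \sum_(r < d) ((h + k) 0 r)%:~R * x 0 r =
    \sum_(r < d) (h 0 r)%:~R * x 0 r + \sum_(r < d) (k 0 r)%:~R * x 0 r.
  by rewrite -big_split; apply: eq_bigr => r _; rewrite mxE intrD mulrDl.
set a := \sum_(r < d) (h 0 r)%:~R * x 0 r.
set b := \sum_(r < d) (k 0 r)%:~R * x 0 r.
rewrite mulrACA -mulrA; congr (_ * (_ * _)).
by rewrite cosD sinD; apply/eqP; rewrite eq_complex /= [cos a * sin b + _]addrC !eqxx.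
Qed.

Notation pair_field R d := (vcoef R d * vcoef R d)%type.

Section Pairs.
Variables (R : realType) (d : nat).
Implicit Types (v w : pair_field R d) (p q n : R).

Definition Hsp2 p v : Prop := Hsp p v.1 /\ Hsp p v.2.
Definition Hinf2 v : Prop := forall p, Hsp2 p v.

Definition inner2 p v w : R := inner p v.1 w.1 + inner p v.2 w.2.
Definition Hnorm2 p v : R := Num.sqrt (Hnorm p v.1 ^+ 2 + Hnorm p v.2 ^+ 2).

Definition Aop (nu eta : R) v : pair_field R d :=
  (nu%:C *: laplacian v.1, eta%:C *: laplacian v.2).

Definition Pop2 v w : pair_field R d :=
  (Pop v.1 w.1 - Pop v.2 w.2, Pop v.1 w.2 - Pop v.2 w.1).

Definition P_constants (K : R -> R -> R) : Prop :=
  forall p n, d%:R / 2 < n -> n <= p -> 0 < K p n /\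
  forall v w, Hsp2 p v -> Hsp2 (p + 1) w ->
    Hnorm2 p (Pop2 v w) <=
      2^-1 * K p n * (Hnorm2 p v * Hnorm2 (n + 1) w +
                      Hnorm2 n v * Hnorm2 (p + 1) w).

Definition energy_constants (G : R -> R -> R) : Prop :=
  forall p n, d%:R / 2 + 1 < n -> n <= p -> 0 < G p n /\
  forall v w, Hsp2 p v -> Hsp2 (p + 1) w ->
    `|inner2 p (Pop2 v w) w| <=
      2^-1 * G p n * (Hnorm2 p v * Hnorm2 n w + Hnorm2 n v * Hnorm2 p w)
        * Hnorm2 p w.

(* A map on [0, T), with T in (0, +oo], is a total function on R of which only
   the values on [0, T) matter. *)

Definition timedom (T : \bar R) : set R := [set t | 0 <= t /\ (t%:E < T)%E].

(* f and f' map [0, T) to H^infty and f' is the derivative of f for the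
   Frechet topology of the norms [Hnorm2 p], p real; it is one-sided at 0. *)
Definition is_tderiv (T : \bar R) (f f' : R -> pair_field R d) : Prop :=
  forall t, timedom T t ->
    [/\ Hinf2 (f t), Hinf2 (f' t) &
        forall p, Hnorm2 p (((s - t)^-1)%:C *: (f s - f t) - f' t)
          @[s --> within (timedom T) t^'] --> (0 : R)].

Definition smooth_map (T : \bar R) (u : R -> pair_field R d) : Prop :=
  exists g : nat -> R -> pair_field R d,
    g 0%N = u /\ forall j, is_tderiv T (g j) (g j.+1).

Definition MHD_solution (nu eta : R) (T : \bar R) (u : R -> pair_field R d) :
    Prop :=
  [/\ (0 < T)%E,
      smooth_map T u &
      is_tderiv T u (fun t => Aop nu eta (u t) + Pop2 (u t) (u t))].

Definition maximal_MHD_solution (nu eta : R) (T : \bar R)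
    (u : R -> pair_field R d) : Prop :=
  MHD_solution nu eta T u /\
  ~ (exists (T' : \bar R) (u' : R -> pair_field R d),
       [/\ (T < T')%E, MHD_solution nu eta T' u' &
           forall t, timedom T t -> u' t = u t]).

Definition int0oo (f : R -> R) : \bar R :=
  (\int[lebesgue_measure]_(t in [set` `[0%R, +oo[]) (f t)%:E)%E.

(* Equivalent properties of a global solution (a theorem, not used here); all of
   them are required. *)
Record decaying (nu eta : R) (G : R -> R -> R) (v : R -> pair_field R d) :
    Prop := Decaying {
  decaying_a : exists n t0 : R, [/\ d%:R / 2 + 1 < n, 0 <= t0 &
    Hnorm2 n (v t0) < Num.min nu eta / G n n];
  decaying_b : exists2 n : R, d%:R / 2 + 1 < n &
    Hnorm2 n (v t) @[t --> +oo] --> (0 : R);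
  decaying_c : forall p : R, Hnorm2 p (v t) @[t --> +oo] --> (0 : R);
  decaying_d : exists n gamma : R, [/\ d%:R / 2 + 1 < n, 0 < gamma &
    (int0oo (fun t => (Hnorm2 n (v t) `^ gamma)%R) < +oo)%E];
  decaying_e : forall p gamma : R, 0 < gamma ->
    (int0oo (fun t => (Hnorm2 p (v t) `^ gamma)%R) < +oo)%E;
  decaying_f : exists2 n : R, d%:R / 2 + 1 < n &
    exists2 C : R, 0 <= C & forall t, 0 <= t ->
      Hnorm2 n (v t) <= C * expR (- Num.min nu eta * t);
  decaying_g : forall p : R, exists2 C : R, 0 <= C & forall t, 0 <= t ->
      Hnorm2 p (v t) <= C * expR (- Num.min nu eta * t)
}.

Definition global_decaying_solution (nu eta : R) (G : R -> R -> R)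
    (v : R -> pair_field R d) : Prop :=
  MHD_solution nu eta +oo%E v /\ decaying nu eta G v.

Definition Einf (nu eta : R) (G : R -> R -> R) (v0 : pair_field R d) : Prop :=
  Hinf2 v0 /\
  exists (T : \bar R) (v : R -> pair_field R d),
    [/\ maximal_MHD_solution nu eta T v, v 0 = v0, T = +oo%E &
        decaying nu eta G v].

End Pairs.

(* Main.v *)
(* The difference w = u - v of two solutions satisfies
   w' = A w + P(v,w) + P(w,v) + P(w,w), so the energy inequality gives
   |w|_p' <= (- mu + G_p |v|_p + K_p |v|_(p+1) + G_pn |w|_n) |w|_p for p >= n.
   For p = n this is a Bernoulli inequality, which keeps |w|_n bounded by a
   multiple of exp (- mu t) when |w(0)|_n < rho_n; for p > n it is linear.

   Existence of u needs no local theory: the Galerkin truncations of the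
   equation for w satisfy the same energy inequality, hence bounds in every
   norm that do not depend on the truncation.  Bounded sequences of H^infinity
   converge in every norm along a non-principal ultrafilter on nat, so the
   truncations have a limit, and the second order Taylor estimates pass to it.
   The truncated equations, whose quadratic term is cut off, are solved by the
   ultralimit of Euler polygons.  Smoothness in time is automatic because the
   derivative of a polynomial expression in u is again such an expression. *)

Require Import Defs.
From HB Require Import structures.
From mathcomp Require Import all_boot all_order all_algebra.
From mathcomp Require Import complex spectral.
From mathcomp Require Import ring lra.
From mathcomp Require Import all_classical all_reals all_analysis measurable_realfun.

Set Implicit Arguments.
Unset Strict Implicit.
Unset Printing Implicit Defensive.

Import Order.TTheory GRing.Theory Num.Theory.
Import numFieldNormedType.Exports.

Local Open Scope classical_set_scope.
Local Open Scope ring_scope.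

(** * Gronwall inequalities on the half-line *)

(** The flow argument lives on an abstract scale [mhd_space] whose vectors have all norms at once;
    losing derivatives in [Alin] and [Pbil] then costs nothing, and the Fourier side only has to
    supply an instance. The delicate point of that instance is closure of H^infinity under P: norms
    are defined through [fine], so a divergent energy reads as 0 and a bound on the norm of P(v,w)
    does not by itself give summability. The estimate is therefore applied to trigonometric
    polynomials, and summability is obtained in the limit. The radius [rho] is where the Bernoulli
    inequality ceases to be controlled: with c = delta_n exp (G_n J_n + K_n J_(n+1)) one has G_n c /
    mu = delta_n / rho, and G_n times the integral of |w|_n is at most - ln (1 - delta_n / rho). The
    cutoff makes the truncated equations globally Lipschitz, so that Euler polygons cannot blow up.
    It multiplies the quadratic term by a factor in [0,1], which the energy estimate tolerates, and
    its radius exceeds the a priori bound, so it is never active along the solution. *)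

Section HalfLine.
Variable R : realType.
Implicit Types f g y : R -> R.

Lemma ler0_derive_segment f f' (s t : R) : s <= t ->
  (forall x : R, s <= x <= t -> {for x, continuous f}) ->
  (forall x : R, s < x < t -> is_derive x 1 f (f' x)) ->
  (forall x : R, s < x < t -> f' x <= 0) ->
  f t <= f s.
Proof.
rewrite le_eqVlt => /predU1P[->//|st] cf df f'le0.
have [c sct E] : exists2 c, c \in `]s, t[ & f t - f s = f' c * (t - s).
  apply: MVT => //.
  by apply: continuous_in_subspaceT => x; rewrite inE /= in_itv /=; exact: cf.
move: sct; rewrite in_itv /= => sct; rewrite -subr_le0 E.
by rewrite pmulr_lle0 ?subr_gt0 //; exact: f'le0.
Qed.

Lemma ler0_derive_halfline f f' :
  (forall t : R, 0 <= t -> {for t, continuous f}) ->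
  (forall t : R, 0 < t -> is_derive t 1 f (f' t)) ->
  (forall t : R, 0 < t -> f' t <= 0) ->
  forall s t : R, 0 <= s -> s <= t -> f t <= f s.
Proof.
move=> cf df f'le0 s t s0 st; apply: (@ler0_derive_segment f f') => // x /andP[sx _].
- by apply: cf; exact: le_trans sx.
- by apply: df; exact: le_lt_trans sx.
- by apply: f'le0; exact: le_lt_trans sx.
Qed.

Lemma is_derive_eps f (t l : R) :
  (forall e : R, 0 < e -> exists2 dl, 0 < dl &
    forall s, `|s - t| < dl -> `|f s - f t - (s - t) * l| <= e * `|s - t|) ->
  is_derive t 1 f l.
Proof.
move=> H.
have cv : h^-1 *: (f (h *: 1 + t) - f t) @[h --> 0^'] --> l.
  apply/cvgrPdist_le => /= e e0; have [dl dl0 Hdl] := H _ e0.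
  near=> h.
  have h0 : h != 0 by near: h; exact: nbhs_dnbhs_neq.
  have hdl : `|h| < dl.
    near: h; apply: dnbhs0_lt; exact: dl0.
  have := Hdl (h *: 1 + t); rewrite addrK /GRing.scale /= mulr1 => /(_ hdl).
  rewrite -[X in _ <= X -> _]mulrC -ler_pdivrMl ?normr_gt0 //.
  rewrite -normfV -normrM; congr (_ <= _).
  rewrite mulrBr mulKf // -normrN opprB //.
by apply: DeriveDef; [apply: cvgP cv|apply/cvg_lim].
Unshelve. all: by end_near. Qed.

(** Integration starts at -1, which makes 0 an interior point and the derivative there two-sided.
    The last clause is how the hypotheses on the [J p] enter: a primitive of the norm stays below
    its integral over the half-line. *)
Lemma antiderivative_halfline g : continuous g ->
  exists Gm : R -> R, [/\ Gm 0 = 0,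
    forall t : R, 0 <= t -> is_derive t 1 Gm (g t) &
    (forall t : R, 0 <= t -> 0 <= g t) ->
      forall t : R, 0 <= t -> ((Gm t)%:E <= int0oo g)%E].
Proof.
move=> cg.
pose mu := @lebesgue_measure R.
have ig (a b : R) : mu.-integrable `[a, b] (EFin \o g).
  by apply: continuous_compact_integrable; [exact: segment_compact|
    exact: continuous_subspaceT].
pose F (x : R) : R := (\int[mu]_(t in [set` `[(-1)%R, x]]) g t)%R.
exists (fun x => F x - F 0); split; first by rewrite subrr.
  move=> t t0.
  have t1 : -1 < t by apply: lt_le_trans t0; rewrite ltrN10.
  have tt : t < t + 1 by rewrite ltrDl.
  have [dF eF] := @continuous_FTC1_closed R g (-1) t (t + 1) tt (ig _ _) t1 (cg t).
  have dF' : is_derive t 1 F (g t).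
    exact: DeriveDef (etrans (esym (derive1E _ _)) eF).
  have H := @is_deriveB R R R F (cst (F 0)) t 1 (g t) 0 dF' _.
  by rewrite -[g t]subr0; apply: H; exact: is_derive_cst.
move=> g0 t t0.
have m1 : -1 <= 0 :> R by rewrite lerN10.
have -> : F t - F 0 = (\int[mu]_(x in [set` `]0%R, t]]) g x)%R.
  apply: (@Rintegral_itvB R g (BLeft (-1)) (BRight t) 0) => //.
rewrite /Rintegral fineK; last first.
  apply: integrable_fin_num => //; apply: (integrableS _ _ _ (ig 0 t)) => //.
  exact: subset_itv_oc_cc.
apply: ge0_subset_integral => //.
- apply/measurable_EFinP.
  by apply: measurable_funS (continuous_measurable_fun cg).
- move=> x xi; have : (x : R) \in `[0, +oo[ := xi.
  by rewrite in_itv /= andbT lee_fin => /g0.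
- by apply: subset_itv; rewrite bnd_simp.
Qed.

(** The product of [y] with exp (- Gm) is nonincreasing. [y] has to be differentiable at positive
    times only, since it will be a function composed with [hl], which has a corner at 0. *)
Lemma gronwall_linear y y' g Gm :
  (forall t : R, 0 <= t -> {for t, continuous y}) ->
  (forall t : R, 0 < t -> is_derive t 1 y (y' t)) ->
  (forall t : R, 0 <= t -> is_derive t 1 Gm (g t)) -> Gm 0 = 0 ->
  (forall t : R, 0 < t -> y' t <= g t * y t) ->
  forall t : R, 0 <= t -> y t <= y 0 * expR (Gm t).
Proof.
move=> cy dy dG G0 le t t0.
pose e s := expR (- Gm s).
have de (s : R) : 0 <= s -> is_derive s 1 e (- g s * e s).
  move=> s0; have h := dG _ s0.
  have hN := @is_deriveN _ _ _ _ _ _ _ h.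
  by have := @is_derive1_comp _ expR (- Gm) s _ _ (is_derive_expR _) hN; rewrite mulrC.
have ce (s : R) : 0 <= s -> {for s, continuous e}.
  by move=> /de [h _]; apply: differentiable_continuous; exact/derivable1_diffP.
have := @ler0_derive_halfline (fun s => y s * e s)
  (fun s => (y' s - g s * y s) * e s) _ _ _ 0 t (lexx _) t0.
rewrite /e G0 oppr0 expR0 mulr1 expRN => H.
rewrite -ler_pdivrMr ?expR_gt0 //; apply: H.
- by move=> s s0; apply: continuousM; [exact: cy|exact: ce].
- move=> s s0; have h := @is_deriveM _ _ y e s 1 _ _ (dy _ s0) (de _ (ltW s0)).
  apply: is_derive_eq h _; rewrite /GRing.scale /= -/(e s); ring.
- by move=> s s0; rewrite pmulr_lle0 ?expR_gt0 // subr_le0 le.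
Qed.

Lemma is_derive_continuous f (t : R) (l : R) : is_derive t 1 f l -> {for t, continuous f}.
Proof. by move=> [h _]; apply: differentiable_continuous; exact/derivable1_diffP. Qed.

(* Nonlinear Gronwall: exp (- k B) decreases at rate at most k c exp (- mu t). *)
Lemma gronwall_bernoulli (B b : R -> R) (k c mu : R) : 0 < k -> 0 < mu -> 0 <= c ->
  (forall t : R, 0 <= t -> is_derive t 1 B (b t)) -> B 0 = 0 ->
  (forall t : R, 0 <= t -> b t <= c * expR (- mu * t) * expR (k * B t)) ->
  k * c / mu < 1 ->
  forall t : R, 0 <= t -> expR (k * B t) <= (1 - k * c / mu)^-1.
Proof.
move=> k0 mu0 c0 dB B0 le lt1 t t0.
pose e s := expR (- (k * B s)).
pose h s := k * c / mu * expR (- mu * s).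
have de (s : R) : 0 <= s -> is_derive s 1 e (- (k * b s) * e s).
  move=> s0; have h0 := dB _ s0.
  have hN := @is_deriveN _ _ _ _ _ _ _ (@is_deriveZ _ _ _ _ k _ _ _ h0).
  by have := @is_derive1_comp _ expR _ s _ _ (is_derive_expR _) hN; rewrite mulrC.
have dh (s : R) : is_derive s 1 h (- (k * c * expR (- mu * s))).
  have hl : is_derive s 1 (fun x : R => - mu * x) (- mu).
    have H := @is_deriveZ _ _ _ (@id R) (- mu) s 1 1 (is_derive_id _ _).
    by apply: is_derive_eq H _; rewrite /GRing.scale /= mulr1.
  have := @is_deriveZ _ _ _ _ (k * c / mu) s _ _
    (@is_derive1_comp _ expR _ s _ _ (is_derive_expR _) hl).
  move=> H; apply: is_derive_eq H _; rewrite /GRing.scale /=; field; exact: lt0r_neq0.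
have := @ler0_derive_halfline (fun s => h s - e s)
  (fun s => - (k * c * expR (- mu * s)) - (- (k * b s) * e s)) _ _ _ 0 t (lexx _) t0.
rewrite [h 0]/h [e 0]/e B0 !mulr0 oppr0 !expR0 mulr1 => H.
have {}H : h t - e t <= k * c / mu - 1.
  apply: H.
  - move=> s s0; apply: continuousB; first exact: is_derive_continuous (dh s).
    exact: is_derive_continuous (de _ s0).
  - move=> s s0; exact: (@is_deriveB _ _ _ h e s 1 _ _ (dh s) (de _ (ltW s0))).
  - move=> s s0; rewrite [- (k * b s) * _]mulNr opprK addrC subr_le0 -mulrA -mulrA ler_pM2l //.
    rewrite /e expRN ler_pdivrMr ?expR_gt0 //; apply: le; exact: ltW.
have et : 1 - k * c / mu <= e t.
  have : 0 <= h t by rewrite /h !mulr_ge0 ?invr_ge0 ?expR_ge0 // ltW.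
  by move: H; lra.
rewrite -[X in X <= _]invrK -expRN lef_pV2 ?posrE ?expR_gt0 //.
by rewrite subr_gt0.
Qed.

End HalfLine.

(** * Scales of inner product spaces *)

Definition ipnorm (R : realType) (E : Type) (ip : R -> E -> E -> R) p x :=
  Num.sqrt (ip p x x).

(* On the torus [dis] is min(nu, eta), [crit] is d/2 and [prj N] truncates
   Fourier series; [montel] is all the compactness that is needed. *)
Record mhd_space (R : realType) := MHDSpace {
  carrier :> lmodType R;
  ip : R -> carrier -> carrier -> R;
  ip_linl : forall p a x y z, ip p (a *: x + y) z = a * ip p x z + ip p y z;
  ip_sym : forall p x y, ip p x y = ip p y x;
  ip_ge0 : forall p x, 0 <= ip p x x;
  ip_eq0 : forall p x, ip p x x = 0 -> x = 0;
  ip_mono : forall p q x, p <= q -> ip p x x <= ip q x x;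
  Alin : carrier -> carrier;
  Alin_lin : forall a x y, Alin (a *: x + y) = a *: Alin x + Alin y;
  dis : R;
  dis_gt0 : 0 < dis;
  Alin_dis : forall p x, ip p (Alin x) x <= - dis * ip p x x;
  Abd : R;
  Alin_bound : forall p x, ipnorm ip p (Alin x) <= Abd * ipnorm ip (p + 2) x;
  Pbil : carrier -> carrier -> carrier;
  Pbil_linl : forall a x y z, Pbil (a *: x + y) z = a *: Pbil x z + Pbil y z;
  Pbil_linr : forall a x y z, Pbil z (a *: x + y) = a *: Pbil z x + Pbil z y;
  crit : R;
  Kc : R -> R -> R;
  Gc : R -> R -> R;
  Pbil_bound : forall p n, crit < n -> n <= p -> 0 < Kc p n /\
    forall v w, ipnorm ip p (Pbil v w) <= 2^-1 * Kc p n *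
      (ipnorm ip p v * ipnorm ip (n + 1) w + ipnorm ip n v * ipnorm ip (p + 1) w);
  Pbil_energy : forall p n, crit + 1 < n -> n <= p -> 0 < Gc p n /\
    forall v w, `|ip p (Pbil v w) w| <= 2^-1 * Gc p n *
      (ipnorm ip p v * ipnorm ip n w + ipnorm ip n v * ipnorm ip p w)
        * ipnorm ip p w;
  prj : nat -> carrier -> carrier;
  prj_lin : forall N a x y, prj N (a *: x + y) = a *: prj N x + prj N y;
  prj_idem : forall N x, prj N (prj N x) = prj N x;
  prj_self : forall p N x y, ip p (prj N x) y = ip p x (prj N y);
  prj_A : forall N x, prj N (Alin x) = Alin (prj N x);
  prj_bernstein : forall p q N, exists C, forall x,
    ipnorm ip q (prj N x) <= C * ipnorm ip p x;
  prj_approx : forall p N x,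
    ipnorm ip p (x - prj N x) <= N.+1%:R^-1 * ipnorm ip (p + 1) x;
  montel : forall U : set_system nat, UltraFilter U -> forall x : nat -> carrier,
    (forall p, exists C, forall m, ipnorm ip p (x m) <= C) ->
    exists y, forall p, ipnorm ip p (x m - y) @[m --> U] --> (0 : R)
}.

Notation nm := (@ipnorm _ _ (@ip _ _)).

Section Basics.
Variables (R : realType) (E : mhd_space R).
Implicit Types (x y z : E) (p q a : R).

Lemma ipDl p x y z : ip p (x + y) z = ip p x z + ip p y z.
Proof. by rewrite -[x in LHS]scale1r ip_linl mul1r. Qed.

Lemma ip0l p z : ip p (0 : E) z = 0.
Proof. by apply: (addrI (ip p (0 : E) z)); rewrite -ipDl !addr0. Qed.

Lemma ipZl p a x z : ip p (a *: x) z = a * ip p x z.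
Proof. by rewrite -[a *: x]addr0 ip_linl ip0l addr0. Qed.

Lemma ipNl p x z : ip p (- x) z = - ip p x z.
Proof. by rewrite -scaleN1r ipZl mulN1r. Qed.

Lemma ipBl p x y z : ip p (x - y) z = ip p x z - ip p y z.
Proof. by rewrite ipDl ipNl. Qed.

Lemma ipDr p x y z : ip p z (x + y) = ip p z x + ip p z y.
Proof. by rewrite ip_sym ipDl !(ip_sym _ z). Qed.

Lemma ipZr p a x z : ip p z (a *: x) = a * ip p z x.
Proof. by rewrite ip_sym ipZl (ip_sym _ z). Qed.

Lemma ipNr p x z : ip p z (- x) = - ip p z x.
Proof. by rewrite ip_sym ipNl (ip_sym _ z). Qed.

Lemma ipBr p x y z : ip p z (x - y) = ip p z x - ip p z y.
Proof. by rewrite ipDr ipNr. Qed.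

Lemma nm_ge0 p x : 0 <= nm p x.
Proof. exact: sqrtr_ge0. Qed.

Lemma sqr_nm p x : nm p x ^+ 2 = ip p x x.
Proof. by rewrite sqr_sqrtr ?ip_ge0. Qed.

Lemma nm_mono p q x : p <= q -> nm p x <= nm q x.
Proof. by move=> pq; apply/ler_wsqrtr/ip_mono. Qed.

Lemma nmZ p a x : nm p (a *: x) = `|a| * nm p x.
Proof.
by rewrite /ipnorm ipZl ipZr mulrA -expr2 sqrtrM ?sqr_ge0 // sqrtr_sqr.
Qed.

Lemma nm0 p : nm p (0 : E) = 0.
Proof. by rewrite /ipnorm ip0l sqrtr0. Qed.

Lemma nmN p x : nm p (- x) = nm p x.
Proof. by rewrite -scaleN1r nmZ normrN1 mul1r. Qed.

Lemma nm_distC p x y : nm p (x - y) = nm p (y - x).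
Proof. by rewrite -nmN opprB. Qed.

Lemma nm_eq0 p x : nm p x = 0 -> x = 0.
Proof. by move=> h; apply: (@ip_eq0 _ _ p); rewrite -sqr_nm h expr0n. Qed.

Lemma cauchy_schwarz p x y : `|ip p x y| <= nm p x * nm p y.
Proof.
have H a : 0 <= a ^+ 2 * ip p x x + 2 * a * ip p x y + ip p y y.
  have := ip_ge0 p (a *: x + y).
  rewrite ipDl !ipDr !ipZl !ipZr (ip_sym _ y x); congr (0 <= _); ring.
rewrite -(@ler_pXn2r _ 2) ?nnegrE ?mulr_ge0 ?nm_ge0 ?normr_ge0 //.
rewrite real_normK ?num_real // exprMn !sqr_nm.
have X0 := ip_ge0 p x; have Y0 := ip_ge0 p y.
move: H X0 Y0; set X := ip p x x; set b := ip p x y; set Y := ip p y y.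
move=> H X0 Y0.
(* If X = 0 the nonnegative polynomial of [H] is affine in a, which forces b = 0; otherwise it is
   evaluated at its minimum - b / X. *)
have [X00|X00] := eqVneq X 0.
  have [->|b0] := eqVneq b 0; first by rewrite expr0n mulr_ge0.
  have := H (- (Y + 1) / (2 * b)); rewrite X00 mulr0 add0r.
  have -> : 2 * (- (Y + 1) / (2 * b)) * b + Y = -1 by field.
  by rewrite ler0N1.
have Xp : 0 < X by rewrite lt_def X00.
have := H (- b / X).
have -> : (- b / X) ^+ 2 * X + 2 * (- b / X) * b + Y = (X * Y - b ^+ 2) / X by field.
by rewrite pmulr_lge0 ?invr_gt0 // subr_ge0.
Qed.

Lemma ler_ip p x y : ip p x y <= nm p x * nm p y.
Proof. exact: le_trans (ler_norm _) (cauchy_schwarz _ _ _). Qed.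

Lemma nmD p x y : nm p (x + y) <= nm p x + nm p y.
Proof.
rewrite -(@ler_pXn2r _ 2) ?nnegrE ?addr_ge0 ?nm_ge0 //.
rewrite sqrrD !sqr_nm ipDl !ipDr (ip_sym _ y x).
have := ler_ip p x y; lra.
Qed.

Lemma nmB p x y : nm p (x - y) <= nm p x + nm p y.
Proof. by rewrite -(nmN p y) nmD. Qed.

Lemma nm_dist p x y : `|nm p x - nm p y| <= nm p (x - y).
Proof.
rewrite ler_norml; apply/andP; split.
  have := nmD p (y - x) x; rewrite subrK nm_distC; lra.
have := nmD p (x - y) y; rewrite subrK; lra.
Qed.

Lemma nm_triangle p z x y : nm p (x - y) <= nm p (x - z) + nm p (z - y).
Proof. by rewrite -[x - y](subrKA z) nmD. Qed.

Lemma AlinD x y : Alin (x + y) = Alin x + Alin y.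
Proof. by rewrite -[x in LHS]scale1r Alin_lin scale1r. Qed.

Lemma Alin0 : Alin (0 : E) = 0.
Proof. by apply: (addrI (Alin (0 : E))); rewrite -AlinD !addr0. Qed.

Lemma AlinZ a x : Alin (a *: x) = a *: Alin x.
Proof. by rewrite -[a *: x]addr0 Alin_lin Alin0 addr0. Qed.

Lemma AlinB x y : Alin (x - y) = Alin x - Alin y.
Proof. by rewrite AlinD -scaleN1r AlinZ scaleN1r. Qed.

Lemma prjD N x y : prj N (x + y) = prj N x + prj N y.
Proof. by rewrite -[x in LHS]scale1r prj_lin scale1r. Qed.

Lemma prj0 N : prj N (0 : E) = 0.
Proof. by apply: (addrI (prj N (0 : E))); rewrite -prjD !addr0. Qed.

Lemma prjZ N a x : prj N (a *: x) = a *: prj N x.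
Proof. by rewrite -[a *: x]addr0 prj_lin prj0 addr0. Qed.

Lemma prjB N x y : prj N (x - y) = prj N x - prj N y.
Proof. by rewrite prjD -scaleN1r prjZ scaleN1r. Qed.

Lemma PbilDl x y z : Pbil (x + y) z = Pbil x z + Pbil y z.
Proof. by rewrite -[x in LHS]scale1r Pbil_linl scale1r. Qed.

Lemma PbilDr x y z : Pbil z (x + y) = Pbil z x + Pbil z y.
Proof. by rewrite -[x in LHS]scale1r Pbil_linr scale1r. Qed.

Lemma Pbil0l z : Pbil (0 : E) z = 0.
Proof. by apply: (addrI (Pbil (0 : E) z)); rewrite -PbilDl !addr0. Qed.

Lemma Pbil0r z : Pbil z (0 : E) = 0.
Proof. by apply: (addrI (Pbil z (0 : E))); rewrite -PbilDr !addr0. Qed.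

Lemma PbilZl a x z : Pbil (a *: x) z = a *: Pbil x z.
Proof. by rewrite -[a *: x]addr0 Pbil_linl Pbil0l addr0. Qed.

Lemma PbilZr a x z : Pbil z (a *: x) = a *: Pbil z x.
Proof. by rewrite -[a *: x]addr0 Pbil_linr Pbil0r addr0. Qed.

Lemma PbilBl x y z : Pbil (x - y) z = Pbil x z - Pbil y z.
Proof. by rewrite PbilDl -scaleN1r PbilZl scaleN1r. Qed.

Lemma PbilBr x y z : Pbil z (x - y) = Pbil z x - Pbil z y.
Proof. by rewrite PbilDr -scaleN1r PbilZr scaleN1r. Qed.

(** For a self-adjoint idempotent |Px|^2 = <x, Px>, and Cauchy-Schwarz allows one factor |Px| to be
    cancelled. *)
Lemma prj_contract p N x : nm p (prj N x) <= nm p x.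
Proof.
have [->|h] := eqVneq (nm p (prj N x)) 0; first exact: nm_ge0.
have h0 : 0 < nm p (prj N x) by rewrite lt_def h nm_ge0.
rewrite -(ler_pM2r h0) -expr2 sqr_nm prj_self prj_idem; exact: ler_ip.
Qed.

Lemma Abd_bound : exists2 C, 0 <= C &
  forall p x, nm p (Alin x) <= C * nm (p + 2) x.
Proof.
exists `|Abd E| => // p x; apply: le_trans (Alin_bound _ _) _.
by rewrite ler_wpM2r ?nm_ge0 // ler_norm.
Qed.

(** The given estimates start above [crit]; for lower p the norm is first raised to an admissible
    index. This makes P continuous for the topology of all norms, at the price of some [q] above
    p. *)
Lemma Pbil_tame p : exists C q, [/\ 0 <= C, p <= q &
  forall x y, nm p (Pbil x y) <= C * nm q x * nm q y].
Proof.
pose n := Num.max p (crit E + 1).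
have cn : crit E < n by rewrite lt_max ltrDl ltr01 orbT.
have pn : p <= n by rewrite le_max lexx.
have [K0 H] := Pbil_bound cn (lexx n).
exists (Kc E n n), (n + 1); split.
- exact: ltW.
- by rewrite (le_trans pn) // lerDl.
- move=> x y; apply: le_trans (nm_mono _ pn) _; apply: le_trans (H x y) _.
  have -> : 2^-1 * Kc E n n * (nm n x * nm (n + 1) y + nm n x * nm (n + 1) y) =
    Kc E n n * nm n x * nm (n + 1) y by field.
  apply: ler_wpM2r; first exact: nm_ge0.
  by apply: ler_wpM2l; [exact: ltW|apply: nm_mono; rewrite lerDl].
Qed.

End Basics.

(** * Differentiation on the half-line *)

Section HalfLineDerivative.
Variables (R : realType) (E : mhd_space R).
Implicit Types (f g : R -> E) (x y z : E).

Lemma ip_inj (x y : E) : (forall z, ip 0 x z = ip 0 y z) -> x = y.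
Proof.
by move=> h; apply/subr0_eq/(@ip_eq0 _ _ 0); rewrite ipBl h subrr.
Qed.

End HalfLineDerivative.

(* Linear identities are checked after pairing with an arbitrary vector. *)
Ltac linear_identity :=
  apply: ip_inj => ?; rewrite ?(ipDl, ipBl, ipNl, ipZl, ip0l); ring.

Section HalfLineDerivative.
Variables (R : realType) (E : mhd_space R).
Implicit Types (f g : R -> E) (x y z : E).

(** Differentiability in every norm at once, one-sided at 0 and blind to negative times. The form
    without quotient needs no exclusion of s = t. *)
Definition hderiv f f' := forall (t p e : R), 0 <= t -> 0 < e ->
  exists2 dl, 0 < dl & forall s, 0 <= s -> `|s - t| < dl ->
    nm p (f s - f t - (s - t) *: f' t) <= e * `|s - t|.

Lemma eq_hderiv f f' g g' : (forall t, 0 <= t -> f t = g t) ->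
  (forall t, 0 <= t -> f' t = g' t) -> hderiv f f' -> hderiv g g'.
Proof.
move=> fg fg' df t p e t0 e0; have [dl dl0 H] := df t p e t0 e0.
by exists dl => // s s0 sdl; rewrite -!fg // -fg' //; exact: H.
Qed.

Lemma hderivD f f' g g' : hderiv f f' -> hderiv g g' ->
  hderiv (fun t => f t + g t) (fun t => f' t + g' t).
Proof.
move=> df dg t p e t0 e0.
have e20 : 0 < e / 2 by rewrite divr_gt0.
have [d1 d10 H1] := df t p _ t0 e20; have [d2 d20 H2] := dg t p _ t0 e20.
exists (Num.min d1 d2); first by rewrite lt_min d10.
move=> s s0; rewrite lt_min => /andP[s1 s2].
have -> : f s + g s - (f t + g t) - (s - t) *: (f' t + g' t) =
  (f s - f t - (s - t) *: f' t) + (g s - g t - (s - t) *: g' t).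
  by linear_identity.
apply: le_trans (nmD _ _ _) _; have := H1 s s0 s1; have := H2 s s0 s2; lra.
Qed.

(** Two derivatives are lost, which is harmless because [hderiv] quantifies over all norms. The
    tolerance is divided by C + 1 because C may vanish. *)
Lemma hderiv_Alin f f' : hderiv f f' ->
  hderiv (fun t => Alin (f t)) (fun t => Alin (f' t)).
Proof.
move=> df t p e t0 e0.
have [C C0 HC] := Abd_bound E.
have e1 : 0 < e / (C + 1) by rewrite divr_gt0 // ltr_wpDl.
have [d d0 H] := df t (p + 2) _ t0 e1.
exists d => // s s0 sd.
rewrite -AlinB -AlinZ -AlinB; apply: le_trans (HC _ _) _.
apply: le_trans (ler_wpM2l C0 (H s s0 sd)) _.
rewrite mulrA ler_wpM2r // mulrA ler_pdivrMr ?ltr_wpDl // mulrC.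
by apply: ler_wpM2l; [exact: ltW|rewrite lerDl].
Qed.

Lemma hderiv_lipschitz_at f f' (t p : R) : hderiv f f' -> 0 <= t ->
  exists2 dl, 0 < dl & forall s, 0 <= s -> `|s - t| < dl ->
    nm p (f s - f t) <= (nm p (f' t) + 1) * `|s - t|.
Proof.
move=> df t0; have [d d0 H] := df t p 1 t0 ltr01; exists d => // s s0 sd.
have -> : f s - f t = (f s - f t - (s - t) *: f' t) + (s - t) *: f' t.
  by rewrite subrK.
apply: le_trans (nmD _ _ _) _; rewrite nmZ.
by have := H s s0 sd; lra.
Qed.

Lemma hderiv_cont_at f f' (t p e : R) : hderiv f f' -> 0 <= t -> 0 < e ->
  exists2 dl, 0 < dl & forall s, 0 <= s -> `|s - t| < dl ->
    nm p (f s - f t) <= e.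
Proof.
move=> df t0 e0; have [d d0 H] := hderiv_lipschitz_at p df t0.
have N0 : 0 < nm p (f' t) + 1 by rewrite ltr_wpDl ?nm_ge0.
exists (Num.min d (e / (nm p (f' t) + 1))); first by rewrite lt_min d0 divr_gt0.
move=> s s0; rewrite lt_min => /andP[sd se]; apply: le_trans (H s s0 sd) _.
by rewrite -ler_pdivlMl // mulrC ltW.
Qed.

Lemma hderiv_Pbil f f' g g' : hderiv f f' -> hderiv g g' ->
  hderiv (fun t => Pbil (f t) (g t))
         (fun t => Pbil (f' t) (g t) + Pbil (f t) (g' t)).
Proof.
move=> df dg t p e t0 e0.
have [C [q [C0 pq HC]]] := Pbil_tame E p.
(* [S] adds up what multiplies C e1 |s - t| in the three remainders; its summand 1 comes from
   bounding nm q (g s) by nm q (g t) + 1, the reason why [e1] is capped at 1. *)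
pose S := nm q (g t) + 1 + nm q (f' t) + nm q (f t).
have S0 : 0 <= S by rewrite /S !addr_ge0 ?nm_ge0.
have CS : 0 < C * S + 1 by rewrite ltr_wpDl // mulr_ge0.
pose e1 := Num.min 1 (e / (C * S + 1)).
have e10 : 0 < e1 by rewrite lt_min ltr01 divr_gt0.
have [d1 d10 H1] := df t q _ t0 e10; have [d2 d20 H2] := dg t q _ t0 e10.
have [d3 d30 H3] := hderiv_cont_at q dg t0 e10.
exists (Num.min d1 (Num.min d2 d3)); first by rewrite !lt_min d10 d20.
move=> s s0; rewrite !lt_min => /and3P[s1 s2 s3].
have -> : Pbil (f s) (g s) - Pbil (f t) (g t) -
    (s - t) *: (Pbil (f' t) (g t) + Pbil (f t) (g' t)) =
  Pbil (f s - f t - (s - t) *: f' t) (g s) + (s - t) *: Pbil (f' t) (g s - g t)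
  + Pbil (f t) (g s - g t - (s - t) *: g' t).
  rewrite !(PbilBl, PbilBr, PbilZl, PbilZr); linear_identity.
apply: le_trans (nmD _ _ _) _; apply: le_trans (lerD (nmD _ _ _) (lexx _)) _.
rewrite nmZ.
have gs : nm q (g s) <= nm q (g t) + 1.
  have := nmD q (g s - g t) (g t); rewrite subrK.
  have := H3 s s0 s3; have : e1 <= 1 by rewrite ge_min lexx.
  lra.
have a1 : nm p (Pbil (f s - f t - (s - t) *: f' t) (g s)) <=
    C * (e1 * `|s - t|) * (nm q (g t) + 1).
  apply: le_trans (HC _ _) _; rewrite -!mulrA ler_wpM2l //.
  by rewrite mulrA; apply: ler_pM; rewrite ?nm_ge0 //; exact: H1.
have a2 : nm p (Pbil (f' t) (g s - g t)) <= C * nm q (f' t) * e1.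
  apply: le_trans (HC _ _) _; rewrite ler_wpM2l ?mulr_ge0 ?nm_ge0 //.
  exact: H3.
have a3 : nm p (Pbil (f t) (g s - g t - (s - t) *: g' t)) <=
    C * nm q (f t) * (e1 * `|s - t|).
  apply: le_trans (HC _ _) _; rewrite ler_wpM2l ?mulr_ge0 ?nm_ge0 //.
  exact: H2.
have a2' := ler_wpM2l (normr_ge0 (s - t)) a2.
apply: (@le_trans _ _ (e1 * (C * S) * `|s - t|)).
  apply: le_trans (lerD (lerD a1 a2') a3) _.
  by rewrite le_eqVlt; apply/orP; left; apply/eqP; rewrite /S; ring.
rewrite ler_wpM2r //.
have : e1 <= e / (C * S + 1) by rewrite ge_min lexx orbT.
rewrite ler_pdivlMr // => h.
by apply: le_trans h; apply: ler_wpM2l; [exact: ltW|rewrite lerDl].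
Qed.

(** Clamps time to the half-line, so that functions meaningful on [0, +oo) only become total and
    continuous and fit integrals and derivatives over the reals. *)
Definition hl (t : R) : R := Num.max 0 t.

Lemma hl_ge0 t : 0 <= hl t. Proof. by rewrite le_max lexx. Qed.

Lemma hlE t : 0 <= t -> hl t = t. Proof. by move=> t0; apply/max_idPr. Qed.

Lemma hl_dist s t : `|hl s - hl t| <= `|s - t|.
Proof. 
rewrite /hl !maxEle; do 2 case: ifPn; rewrite -?ltNge => s0 t0; rewrite ?subrr ?normr0 //.
- rewrite subr0 ger0_norm // real_ler_normr ?num_real //; apply/orP; left; lra.
- rewrite sub0r normrN ger0_norm // real_ler_normr ?num_real //.
  by apply/orP; right; lra. Qed.

Lemma continuous_nm f f' p : hderiv f f' -> continuous (fun t => nm p (f (hl t))).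
Proof.
move=> df t; apply/cvgrPdist_le => e e0.
have [d d0 H] := hderiv_cont_at p df (hl_ge0 t) e0.
near=> s; rewrite distrC; apply: le_trans (nm_dist _ _ _) _.
apply: H; first exact: hl_ge0.
apply: le_lt_trans (hl_dist _ _) _; rewrite distrC.
by near: s; apply: cvgr_dist_lt; [exact: cvg_id|].
Unshelve. all: by end_near. Qed.

Lemma continuous_sqnm f f' p : hderiv f f' ->
  continuous (fun t => ip p (f (hl t)) (f (hl t))).
Proof.
move=> df; rewrite (_ : (fun t => _) = (fun t => nm p (f (hl t)) * nm p (f (hl t)))).
  have h := @continuous_nm f f' p df.
  by move=> t; exact: (continuousM (h t) (h t)).
by apply/funext => t; rewrite -expr2 sqr_nm.
Qed.

Lemma is_derive_ip f f' p z (t : R) : hderiv f f' -> 0 < t ->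
  is_derive t 1 (fun s => ip p (f (hl s)) z) (ip p (f' t) z).
Proof.
move=> df t0; apply: is_derive_eps => e e0.
have N0 : 0 < nm p z + 1 by rewrite ltr_wpDl ?nm_ge0.
have [d d0 H] := df t p (e / (nm p z + 1)) (ltW t0) (divr_gt0 e0 N0).
exists (Num.min d t); first by rewrite lt_min d0.
move=> s; rewrite lt_min => /andP[sd st].
have s0 : 0 <= s by move: st; rewrite ltr_distl; lra.
rewrite !hlE ?(ltW t0) // -ipBl -ipZl -ipBl.
apply: le_trans (cauchy_schwarz _ _ _) _.
apply: le_trans (ler_wpM2r (nm_ge0 _ _) (H s s0 sd)) _.
rewrite mulrAC; apply: ler_wpM2r => //; rewrite mulrAC ler_pdivrMr //.
by apply: ler_wpM2l; [exact: ltW|rewrite lerDl].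
Qed.

Lemma continuous_ip f f' p z (t : R) : hderiv f f' ->
  {for t, continuous (fun s => ip p (f (hl s)) z)}.
Proof.
move=> df; apply/cvgrPdist_le => e e0.
have N0 : 0 < nm p z + 1 by rewrite ltr_wpDl ?nm_ge0.
have [d d0 H] := hderiv_cont_at p df (hl_ge0 t) (divr_gt0 e0 N0).
near=> s; rewrite distrC -ipBl.
apply: le_trans (cauchy_schwarz _ _ _) _.
have h : nm p (f (hl s) - f (hl t)) <= e / (nm p z + 1).
  apply: H; first exact: hl_ge0.
  apply: le_lt_trans (hl_dist _ _) _; rewrite distrC.
  by near: s; apply: cvgr_dist_lt; [exact: cvg_id|].
apply: le_trans (ler_wpM2r (nm_ge0 _ _) h) _.
rewrite mulrAC ler_pdivrMr //.
by apply: ler_wpM2l; [exact: ltW|rewrite lerDl].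
Unshelve. all: by end_near. Qed.

(** With r the first order remainder and D the increment, |f s|^2 - |f t|^2 - 2 (s - t) <f' t, f t>
    = 2 <r, f t> + |D|^2. Both terms are o(|s - t|), the second because f is Lipschitz at t. *)
Lemma is_derive_sqnm f f' p (t : R) : hderiv f f' -> 0 < t ->
  is_derive t 1 (fun s => ip p (f (hl s)) (f (hl s))) (2 * ip p (f' t) (f t)).
Proof.
move=> df t0; apply: is_derive_eps => e e0.
pose m := nm p (f' t) + 1.
have m0 : 0 < m by rewrite ltr_wpDl ?nm_ge0.
pose k := 2 * nm p (f t) + 1.
have k0 : 0 < k by rewrite ltr_wpDl ?mulr_ge0 ?nm_ge0.
have e1 : 0 < e / 2 / k by rewrite !divr_gt0.
have [d1 d10 H1] := df t p _ (ltW t0) e1.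
have [d2 d20 H2] := hderiv_lipschitz_at p df (ltW t0).
(* For the quadratic term: m^2 |s - t|^2 <= (e / 2) |s - t| once |s - t| < d3. *)
pose d3 := e / 2 / m ^+ 2.
have d30 : 0 < d3 by rewrite !divr_gt0 ?exprn_gt0.
exists (Num.min (Num.min d1 t) (Num.min d2 d3)); first by rewrite !lt_min d10 t0 d20.
move=> s; rewrite !lt_min => /andP[/andP[s1 st] /andP[s2 s3]].
have s0 : 0 <= s by move: st; rewrite ltr_distl; lra.
rewrite !hlE ?(ltW t0) //.
have {}H1 := H1 s s0 s1; have {}H2 := H2 s s0 s2.
set r := f s - f t - (s - t) *: f' t in H1 *.
set D := f s - f t in H2.
have -> : ip p (f s) (f s) - ip p (f t) (f t) - (s - t) * (2 * ip p (f' t) (f t))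
   = 2 * ip p r (f t) + ip p D D.
  rewrite /r /D !(ipBl, ipBr, ipZl, ipZr) (ip_sym _ (f t) (f s)); ring.
apply: le_trans (ler_normD _ _) _.
rewrite normrM normr_nat [`|ip p D D|]ger0_norm ?ip_ge0 //.
have h1 : 2 * `|ip p r (f t)| <= e / 2 * `|s - t|.
  apply: (@le_trans _ _ (e / 2 / k * `|s - t| * k)); last first.
    by rewrite mulrAC divfK // gt_eqF.
  have := cauchy_schwarz p r (f t).
  have := ler_wpM2r (nm_ge0 p (f t)) H1.
  have : 0 <= e / 2 / k * `|s - t| by rewrite mulr_ge0 // ltW.
  rewrite /k; set X := e / 2 / _ * _; set Y := `|ip _ _ _|; set Z := nm p (f t) => *.
  nra.
have h2 : ip p D D <= e / 2 * `|s - t|.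
  rewrite -sqr_nm; apply: (@le_trans _ _ ((m * `|s - t|) ^+ 2)).
    by rewrite ler_pXn2r ?nnegrE ?nm_ge0 // mulr_ge0 // ltW.
  rewrite exprMn [X in _ * X]expr2 mulrA ler_wpM2r //.
  by rewrite -ler_pdivlMl ?exprn_gt0 // mulrC ltW.
lra.
Qed.

(** Reduction to a scalar function: the error vector [z] is paired with itself, and <f r, z> - l r
    is nonincreasing by Cauchy-Schwarz. The free vector [c] allows comparison with a frozen
    derivative. *)
Lemma mean_value f f' p (s t : R) (c : E) M : hderiv f f' -> 0 <= s -> s <= t ->
  (forall r, s <= r -> r <= t -> nm p (f' r - c) <= M) ->
  nm p (f t - f s - (t - s) *: c) <= M * (t - s).
Proof.
move=> df s0 st HM.
set z := f t - f s - (t - s) *: c.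
have [->|z0] := eqVneq (nm p z) 0.
  rewrite mulr_ge0 ?subr_ge0 //; apply: le_trans (HM s (lexx _) st); exact: nm_ge0.
have zp : 0 < nm p z by rewrite lt_def z0 nm_ge0.
pose l := ip p c z + M * nm p z.
have dl (x : R) : is_derive x 1 (fun r : R => l * r) l.
  have H := @is_deriveZ _ _ _ (@id R) l x 1 1 (is_derive_id _ _).
  by apply: is_derive_eq H _; rewrite /GRing.scale /= mulr1.
have := @ler0_derive_segment R (fun r => ip p (f (hl r)) z - l * r)
  (fun r => ip p (f' r) z - l) s t st.
have -> : ip p (f (hl t)) z - l * t = ip p (f t) z - l * t.
  by rewrite hlE // (le_trans s0).
have -> : ip p (f (hl s)) z - l * s = ip p (f s) z - l * s by rewrite hlE.
move=> H.
have {}H : ip p (f t) z - l * t <= ip p (f s) z - l * s.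
  apply: H => x /andP[sx xt].
  - apply: continuousB; first exact: continuous_ip df.
    exact: is_derive_continuous (dl x).
  - have x0 : 0 < x by apply: le_lt_trans sx.
    exact: (@is_deriveB _ _ _ _ _ x 1 _ _ (is_derive_ip p z df x0) (dl x)).
  - rewrite subr_le0 /l -lerBlDl -ipBl.
    apply: le_trans (ler_ip _ _ _) _; apply: ler_wpM2r; first exact: nm_ge0.
    by apply: HM; exact: ltW.
rewrite -(ler_pM2r zp) -expr2 sqr_nm.
rewrite {1}/z !(ipBl, ipZl); move: H; rewrite /l; lra.
Qed.

End HalfLineDerivative.

(** * A priori estimates *)

Section Apriori.
Variables (R : realType) (E : mhd_space R).
Local Notation mu := (dis E).
Local Notation G := (Gc E).
Local Notation K := (Kc E).
Variable n : R.
Hypothesis hn : crit E + 1 < n.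

Let pcrit p : n <= p -> crit E + 1 < p.
Proof. exact: lt_le_trans. Qed.

Let pcrit0 p : n <= p -> crit E < p.
Proof. by move=> /pcrit; apply: lt_trans; rewrite ltrDl. Qed.

Lemma Gc_gt0 p : n <= p -> 0 < G p n.
Proof. by move=> np; have [] := Pbil_energy hn np. Qed.

Lemma Gcc_gt0 p : n <= p -> 0 < G p p.
Proof. by move=> np; have [] := Pbil_energy (pcrit np) (lexx p). Qed.

Lemma Kcc_gt0 p : n <= p -> 0 < K p p.
Proof. by move=> np; have [] := Pbil_bound (pcrit0 np) (lexx p). Qed.

(* The cutoff factor [c] is [1] for a solution of the full equations. *)
Lemma energy_perturbation p (v w : E) c : n <= p -> 0 <= c <= 1 ->
  ip p (Pbil v w + Pbil w v + c *: Pbil w w) w <=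
  (G p p * nm p v + K p p * nm (p + 1) v + G p n * nm n w) * ip p w w.
Proof.
move=> np /andP[c0 c1].
have [_ H1] := Pbil_energy (pcrit np) (lexx p).
have [_ H2] := Pbil_bound (pcrit0 np) (lexx p).
have [Gp H3] := Pbil_energy hn np.
rewrite !ipDl ipZl -!sqr_nm !mulrDl.
have h1 : ip p (Pbil v w) w <= G p p * nm p v * nm p w ^+ 2.
  apply: le_trans (ler_norm _) _; apply: le_trans (H1 v w) _.
  by rewrite le_eqVlt; apply/orP; left; apply/eqP; field.
have h2 : ip p (Pbil w v) w <= K p p * nm (p + 1) v * nm p w ^+ 2.
  apply: le_trans (ler_ip _ _ _) _.
  apply: le_trans (ler_wpM2r (nm_ge0 _ _) (H2 w v)) _.
  by rewrite le_eqVlt; apply/orP; left; apply/eqP; field.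
have h3 : c * ip p (Pbil w w) w <= G p n * nm n w * nm p w ^+ 2.
  apply: (@le_trans _ _ `|ip p (Pbil w w) w|).
    apply: (@le_trans _ _ (c * `|ip p (Pbil w w) w|)).
      by rewrite ler_wpM2l // ler_norm.
    by rewrite ler_piMl.
  apply: le_trans (H3 w w) _.
  by rewrite le_eqVlt; apply/orP; left; apply/eqP; field.
lra.
Qed.

Variables (v v' w w' : R -> E) (J : R -> R).
Hypothesis dv : hderiv v v'.
Hypothesis dw : hderiv w w'.
Hypothesis hJ : forall p,
  (int0oo (fun t => nm p (v (hl t))) <= (J p)%:E)%E.
(** All that is used of the equation for w, so that Galerkin truncations and differences of
    solutions share the same estimates. *)
Hypothesis energy : forall p t, n <= p -> 0 <= t ->
  ip p (w' t) (w t) <= (- mu + (G p p * nm p (v t) + K p p * nm (p + 1) (v t)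
    + G p n * nm n (w t))) * ip p (w t) (w t).

Let A p := G p p * J p + K p p * J (p + 1).
Let rho := mu / G n n * expR (- G n n * J n - K n n * J (n + 1)).

(** Gronwall applied to the squared norm, with the integral [B] of |w|_n left as an unknown. At p =
    n the bound closes into an inequality for [B] itself; for p > n it is explicit once [B] is
    bounded. *)
Lemma apriori_linear : exists B : R -> R, [/\ B 0 = 0,
  forall t : R, 0 <= t -> is_derive t 1 B (nm n (w (hl t))) &
  forall p t, n <= p -> 0 <= t ->
    nm p (w t) <= nm p (w 0) * expR (A p) * expR (- mu * t) * expR (G p n * B t)].
Proof.
have [B [B0 dB _]] := antiderivative_halfline (@continuous_nm _ _ _ _ n dw).
exists B; split => // p t np t0.
have [V [V0 dV HV]] := antiderivative_halfline (@continuous_nm _ _ _ _ p dv).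
have [W [W0 dW HW]] := antiderivative_halfline (@continuous_nm _ _ _ _ (p + 1) dv).
have Vt : V t <= J p.
  rewrite -lee_fin; apply: le_trans (hJ p).
  by apply: HV => // s _; exact: nm_ge0.
have Wt : W t <= J (p + 1).
  rewrite -lee_fin; apply: le_trans (hJ _).
  by apply: HW => // s _; exact: nm_ge0.
(* The factor 2 is there because this exponent drives the squared norm; [V] and [W] are primitives
   of |v|_p and |v|_(p+1). *)
pose Gm (s : R) := 2 * (- mu * s + (G p p * V s + K p p * W s + G p n * B s)).
pose g (s : R) := 2 * (- mu + (G p p * nm p (v (hl s)) + K p p * nm (p + 1) (v (hl s))
   + G p n * nm n (w (hl s)))).
have dGm (s : R) : 0 <= s -> is_derive s 1 Gm (g s).
  move=> s0.
  have h1 := @is_deriveZ _ _ _ (@id R) (- mu) s 1 _ (is_derive_id _ _).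
  have h2 := @is_deriveZ _ _ _ V (G p p) s 1 _ (dV s s0).
  have h3 := @is_deriveZ _ _ _ W (K p p) s 1 _ (dW s s0).
  have h4 := @is_deriveZ _ _ _ B (G p n) s 1 _ (dB s s0).
  have h5 := @is_deriveD _ _ _ _ _ _ _ _ _ h1
    (@is_deriveD _ _ _ _ _ _ _ _ _ (@is_deriveD _ _ _ _ _ _ _ _ _ h2 h3) h4).
  have h6 := @is_deriveZ _ _ _ _ 2 s 1 _ h5.
  by apply: is_derive_eq h6 _; rewrite /GRing.scale /= mulr1.
have H := @gronwall_linear R _ _ g Gm
  (fun s _ => @continuous_sqnm _ _ _ _ p dw s)
  (fun s s0 => is_derive_sqnm p dw s0) dGm.
have {}H : ip p (w t) (w t) <= ip p (w 0) (w 0) * expR (Gm t).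
  have := H _ _ t t0; rewrite !hlE //; apply.
    by rewrite /Gm V0 W0 B0 !mulr0 !addr0 mulr0.
  move=> s s0; rewrite /g hlE ?(ltW s0) // -mulrA ler_pM2l //.
  by apply: energy => //; exact: ltW.
have E0 s : 0 <= expR s :> R by exact: expR_ge0.
rewrite -(@ler_pXn2r _ 2) ?nnegrE ?nm_ge0 ?mulr_ge0 ?nm_ge0 //.
rewrite sqr_nm; apply: le_trans H _.
rewrite !exprMn sqr_nm -!mulrA ler_wpM2l ?ip_ge0 //.
rewrite -!expRM_natl -!expRD ler_expR /Gm /A.
have := ler_wpM2l (ltW (Gcc_gt0 np)) Vt.
have := ler_wpM2l (ltW (Kcc_gt0 np)) Wt.
lra.
Qed.

Variable delta : R -> R.
(** An inequality, because the truncations start from projections of one datum and share one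
    [delta]. *)
Hypothesis hdelta : forall q, n <= q -> nm q (w 0) <= delta q.
Hypothesis small : delta n < rho.

Let rho_gt0 : 0 < rho.
Proof. by rewrite mulr_gt0 ?expR_gt0 // divr_gt0 ?dis_gt0 ?Gc_gt0. Qed.

Let delta_ge0 q : n <= q -> 0 <= delta q.
Proof. by move=> /hdelta; apply: le_trans; exact: nm_ge0. Qed.

Lemma apriori : forall t, 0 <= t ->
  nm n (w t) <= expR (A n) / (1 - delta n / rho) * delta n * expR (- mu * t) /\
  forall p, n <= p -> nm p (w t) <=
    expR (A p + G p n * (delta n / rho) / (G n n * (1 - delta n / rho)))
    * delta p * expR (- mu * t).
Proof.
have [B [B0 dB HB]] := apriori_linear.
have G0 := Gc_gt0 (lexx n).
have mu0 := dis_gt0 E.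
have lt1 : delta n / rho < 1 by rewrite ltr_pdivrMr ?rho_gt0 // mul1r.
have E0 s : 0 <= expR s :> R by exact: expR_ge0.
pose c := delta n * expR (A n).
have c0 : 0 <= c by rewrite mulr_ge0 ?delta_ge0.
(* The origin of [rho]: it is the value of delta n at which the Bernoulli constant G c / mu reaches
   1. *)
have ec : G n n * c / mu = delta n / rho.
  rewrite /rho /c.
  have -> : - G n n * J n - K n n * J (n + 1) = - A n by rewrite /A; ring.
  rewrite expRN; field.
  by rewrite !(gt_eqF (expR_gt0 _), gt_eqF mu0, gt_eqF G0).
have l0 : 0 < 1 - delta n / rho by rewrite subr_gt0.
have eB : forall t, 0 <= t -> expR (G n n * B t) <= (1 - delta n / rho)^-1.
  rewrite -ec; apply: gronwall_bernoulli => //; last by rewrite ec.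
  move=> s s0; rewrite hlE //; apply: le_trans (HB n s (lexx n) s0) _.
  by rewrite !ler_wpM2r // hdelta.
pose D := c / (1 - delta n / rho).
have bw t : 0 <= t -> nm n (w t) <= D * expR (- mu * t).
  move=> t0; apply: le_trans (HB n t (lexx n) t0) _.
  rewrite /D [in leRHS]mulrAC; apply: ler_pM; rewrite ?mulr_ge0 ?nm_ge0 //.
    by rewrite !ler_wpM2r // hdelta.
  exact: eB.
have D0 : 0 <= D by rewrite divr_ge0 // ltW.
(* D exp (- mu s) integrates to at most D / mu. By [ec], G n n D / mu = x / (1 - x) with x = delta n
   / rho, which produces the last term of the exponent. *)
have BD t : 0 <= t -> B t <= D / mu.
  move=> t0.
  pose h (s : R) := D / mu * expR (- mu * s).
  have dh (s : R) : is_derive s 1 h (- (D * expR (- mu * s))).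
    have hl : is_derive s 1 (fun x : R => - mu * x) (- mu).
      have H := @is_deriveZ _ _ _ (@id R) (- mu) s 1 1 (is_derive_id _ _).
      by apply: is_derive_eq H _; rewrite /GRing.scale /= mulr1.
    have H := @is_deriveZ _ _ _ _ (D / mu) s _ _
      (@is_derive1_comp _ expR _ s _ _ (is_derive_expR _) hl).
    by apply: is_derive_eq H _; rewrite /GRing.scale /=; field; exact: lt0r_neq0.
  have := @ler0_derive_halfline R (fun s => B s + h s)
    (fun s => nm n (w (hl s)) + (- (D * expR (- mu * s)))) _ _ _ 0 t (lexx _) t0.
  rewrite B0 [h 0]/h mulr0 expR0 mulr1 add0r => H.
  have : B t + h t <= D / mu.
    apply: H => s s0.
    - apply: continuousD; first exact: is_derive_continuous (dB _ s0).
      exact: is_derive_continuous (dh s).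
    - exact: (@is_deriveD _ _ _ B h s 1 _ _ (dB _ (ltW s0)) (dh s)).
    - by rewrite subr_le0 hlE ?bw ?(ltW s0).
  apply: le_trans; rewrite lerDl /h; apply: mulr_ge0 => //.
  by rewrite divr_ge0 // ltW.
move=> t t0; split.
  apply: le_trans (bw t t0) _; rewrite /D /c.
  by rewrite le_eqVlt; apply/orP; left; apply/eqP; ring.
move=> p np; apply: le_trans (HB p t np t0) _.
rewrite [expR (A p + _)]expRD.
have -> : expR (A p) * expR (G p n * (delta n / rho) / (G n n * (1 - delta n / rho)))
    * delta p * expR (- mu * t) = delta p * expR (A p) * expR (- mu * t) *
    expR (G p n * (delta n / rho) / (G n n * (1 - delta n / rho))) by ring.
apply: ler_pM; rewrite ?mulr_ge0 ?nm_ge0 //.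
  by rewrite !ler_wpM2r // hdelta.
rewrite ler_expR -!mulrA; apply: ler_wpM2l; first exact/ltW/Gc_gt0.
apply: le_trans (BD t t0) _; rewrite /D.
set s := 1 - delta n / rho in l0 *.
rewrite [delta n * (_ * _)]mulrA -ec.
rewrite le_eqVlt; apply/orP; left; apply/eqP; field.
by rewrite !gt_eqF.
Qed.

End Apriori.

(** * Limits along an ultrafilter *)

Section UltraLimits.
Variables (R : realType) (E : mhd_space R) (U : set_system nat).
Hypothesis UU : UltraFilter U.
Hypothesis oU : \oo `<=` U.
Implicit Types (x y z : nat -> E) (a b c : E).

Definition ucvg x a := forall p, nm p (x m - a) @[m --> U] --> (0 : R).

Lemma ultra_cvg (u : nat -> R) (l : R) : u @ \oo --> l -> u @ U --> l.
Proof. by move=> h A /h; exact: oU. Qed.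

Lemma squeeze_ucvg (f : nat -> R) (g : nat -> R) : (forall m, 0 <= f m) ->
  (forall m, f m <= g m) -> g @ U --> (0 : R) -> f @ U --> (0 : R).
Proof.
move=> f0 fg g0; apply: squeeze_cvgr g0; last exact: cvg_cst.
by apply: nearW => m; rewrite f0 fg.
Qed.

Lemma ucvg_cst a : ucvg (fun=> a) a.
Proof. by move=> p; rewrite subrr nm0; exact: cvg_cst. Qed.

Lemma ucvgD x a y b : ucvg x a -> ucvg y b -> ucvg (fun m => x m + y m) (a + b).
Proof.
move=> xa yb p; apply: (squeeze_ucvg (fun=> nm_ge0 _ _) _).
  by move=> m; rewrite opprD addrACA; exact: nmD.
by rewrite -[0]addr0; apply: cvgD; [exact: xa|exact: yb].
Qed.

Lemma ucvgZ k x a : ucvg x a -> ucvg (fun m => k *: x m) (k *: a).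
Proof.
move=> xa p; have -> : (fun m => nm p (k *: x m - k *: a)) = (fun m => `|k| * nm p (x m - a)).
  by apply/funext => m; rewrite -scalerBr nmZ.
by rewrite -[X in _ --> X](mulr0 `|k|); apply: cvgMr; exact: xa.
Qed.

Lemma ucvgB x a y b : ucvg x a -> ucvg y b -> ucvg (fun m => x m - y m) (a - b).
Proof.
move=> xa yb; have := ucvgD xa (ucvgZ (-1) yb); rewrite scaleN1r.
by under eq_fun do rewrite scaleN1r.
Qed.

Lemma ucvg_Alin x a : ucvg x a -> ucvg (fun m => Alin (x m)) (Alin a).
Proof.
move=> xa p; have [C C0 HC] := Abd_bound E.
apply: (squeeze_ucvg (fun=> nm_ge0 _ _) _).
  by move=> m; rewrite -AlinB; exact: HC.
by rewrite -(mulr0 C); apply: cvgMr; exact: xa.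
Qed.

Lemma ucvg_prj N x a : ucvg x a -> ucvg (fun m => prj N (x m)) (prj N a).
Proof.
move=> xa p; apply: (squeeze_ucvg (fun=> nm_ge0 _ _) _) (xa p).
by move=> m; rewrite -prjB; exact: prj_contract.
Qed.

(** The index of the projection runs with the sequence: [prj m] contracts uniformly in m, and on the
    fixed limit it converges at rate 1 / (m + 1) in exchange for one derivative. *)
Lemma ucvg_prj_seq x a : ucvg x a -> ucvg (fun m => prj m (x m)) a.
Proof.
move=> xa p.
apply: (@squeeze_ucvg _ (fun m => nm p (x m - a) + m.+1%:R^-1 * nm (p + 1) a)
  (fun=> nm_ge0 _ _) _).
  move=> m; apply: le_trans (nm_triangle p (prj m a) _ _) _.
  rewrite -prjB; apply: lerD; first exact: prj_contract.
  by rewrite nm_distC; exact: prj_approx.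
rewrite -[0](addr0 0); apply: cvgD; first exact: xa.
rewrite -(mul0r (nm (p + 1) a)); apply: cvgMl.
by apply: ultra_cvg; exact: cvg_harmonic.
Qed.

Lemma ucvg_Pbil x a y b : ucvg x a -> ucvg y b ->
  ucvg (fun m => Pbil (x m) (y m)) (Pbil a b).
Proof.
move=> xa yb p; have [C [q [C0 _ HC]]] := Pbil_tame E p.
apply: (@squeeze_ucvg _ (fun m => C * nm q (x m - a) * (nm q (y m - b) + nm q b) +
  C * nm q a * nm q (y m - b)) (fun=> nm_ge0 _ _) _).
  move=> m.
  have -> : Pbil (x m) (y m) - Pbil a b = Pbil (x m - a) (y m) + Pbil a (y m - b).
    by rewrite PbilBl PbilBr addrA subrK.
  apply: le_trans (nmD _ _ _) _; apply: lerD; last exact: HC.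
  apply: le_trans (HC _ _) _; rewrite ler_wpM2l ?mulr_ge0 ?nm_ge0 //.
  by rewrite -{1}(subrK b (y m)); exact: nmD.
have := cvgD (cvgM (cvgMr (a := C) (xa q)) (cvgD (yb q) (cvg_cst (nm q b))))
  (cvgMr (a := C * nm q a) (yb q)).
by rewrite !(mulr0, mul0r, addr0); apply.
Qed.

Lemma ucvg_bound x a p (c : nat -> R) (l : R) : ucvg x a ->
  (forall m, nm p (x m) <= c m) -> c @ U --> l -> nm p a <= l.
Proof.
move=> xa xc cl.
have h : (fun m => c m + nm p (x m - a)) @ U --> l.
  by rewrite -[l]addr0; apply: cvgD => //; exact: xa.
apply: (ler_cvg_to (cvg_cst (nm p a)) h); apply: nearW => m.
rewrite -{1}(subKr (x m) a); apply: le_trans (nmB _ _ _) _.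
by rewrite lerD2r.
Qed.

Lemma ucvg_unique x a b : ucvg x a -> ucvg x b -> a = b.
Proof.
move=> xa xb; apply/subr0_eq/(@nm_eq0 _ _ 0)/le_anti; rewrite nm_ge0 andbT.
have h := ucvgB xb xa.
have := ucvg_bound (p := 0) (c := fun=> 0) (l := 0) h _ (cvg_cst _).
by rewrite nm_distC; apply => m; rewrite subrr nm0.
Qed.

(** One ultrafilter selects limits at all times simultaneously, so neither equicontinuity nor
    diagonal extraction is involved. *)
Lemma ultralimit (x : nat -> R -> E) :
  (forall t p : R, 0 <= t -> exists C, forall m, nm p (x m t) <= C) ->
  exists y : R -> E, forall t : R, 0 <= t -> ucvg (fun m => x m t) (y t).
Proof.
move=> bd.
have H (t : R) : exists y : E, 0 <= t -> ucvg (fun m => x m t) y.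
  have [t0|/negP t0] := boolP (0 <= t); last by exists 0 => h; case: t0.
  by have [y hy] := montel UU (fun p => bd t p t0); exists y.
by exists (fun t => sval (cid (H t))) => t t0; exact: (svalP (cid (H t))).
Qed.

End UltraLimits.

Lemma ultrafilter_oo : exists U : set_system nat, UltraFilter U /\ \oo `<=` U.
Proof. exact: ultraFilterLemma. Qed.

(** * Derivatives from second order estimates *)

Section QuadraticEstimate.
Variables (R : realType) (E : mhd_space R).

(** The moduli in [hderiv] are lost under pointwise limits, whereas these uniform quadratic bounds
    survive them. They are assumed forward in time only; for s < t the expansion is taken at s and
    corrected by the Lipschitz bound on [f]. *)
Lemma quadratic_hderiv (x f : R -> E) :
  (forall (p T : R), exists M : R, forall s t : R, 0 <= s -> s <= t -> t <= T ->
    nm p (x t - x s - (t - s) *: f s) <= M * (t - s) ^+ 2) ->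
  (forall (p T : R), exists M : R, forall s t : R, 0 <= s -> s <= t -> t <= T ->
    nm p (f t - f s) <= M * (t - s)) ->
  hderiv x f.
Proof.
move=> H1 H2 t p e t0 e0.
have [M1 {}H1] := H1 p (t + 1); have [M2 {}H2] := H2 p (t + 1).
pose M := `|M1| + `|M2| + 1.
have M0 : 0 < M by rewrite ltr_wpDl // addr_ge0.
exists (Num.min 1 (e / M)); first by rewrite lt_min ltr01 divr_gt0.
move=> s s0; rewrite lt_min ltr_pdivlMr // => /andP[st1 st].
have sq : (s - t) ^+ 2 = `|s - t| * `|s - t| by rewrite -normrM -expr2 ger0_norm // sqr_ge0.
have bd : nm p (x s - x t - (s - t) *: f t) <= (`|M1| + `|M2|) * (s - t) ^+ 2.
  have M1s : M1 * (s - t) ^+ 2 <= `|M1| * (s - t) ^+ 2.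
    by rewrite ler_wpM2r ?sqr_ge0 // ler_norm.
  have M2s : M2 * (s - t) ^+ 2 <= `|M2| * (s - t) ^+ 2.
    by rewrite ler_wpM2r ?sqr_ge0 // ler_norm.
  have M2p : 0 <= `|M2| * (s - t) ^+ 2 by rewrite mulr_ge0 ?sqr_ge0.
  have [ts|st'] := leP t s.
    have s1 : s <= t + 1 by move: st1; rewrite ltr_distl; lra.
    apply: le_trans (H1 t s t0 ts s1) _; lra.
  have tt : t <= t + 1 by rewrite lerDl.
  have -> : x s - x t - (s - t) *: f t =
    - (x t - x s - (t - s) *: f s) + (t - s) *: (f t - f s) by linear_identity.
  apply: le_trans (nmD _ _ _) _; rewrite nmN nmZ ger0_norm ?subr_ge0 ?(ltW st') //.
  have h1 := H1 s t s0 (ltW st') tt; have h2 := H2 s t s0 (ltW st') tt.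
  have := ler_wpM2l (_ : 0 <= t - s) h2; rewrite subr_ge0 (ltW st') => /(_ isT) h3.
  have e1 : (t - s) ^+ 2 = (s - t) ^+ 2 by rewrite -sqrrN opprB.
  have e2 : (t - s) * (M2 * (t - s)) = M2 * (s - t) ^+ 2 by rewrite -e1; ring.
  move: h1 h3; rewrite e1 e2; lra.
apply: le_trans bd _; rewrite sq mulrA ler_wpM2r // mulrC.
apply: le_trans (ltW st); rewrite ler_wpM2l //.
by rewrite /M lerDl.
Qed.

End QuadraticEstimate.

(** * Euler polygons *)

Section EulerPolygon.
Variables (R : realType) (E : mhd_space R) (N : nat) (r : R).
Variable F : R -> E -> E.
Variable L : R.
Hypothesis L0 : 0 <= L.
Hypothesis FS : forall t x, 0 <= t -> prj N x = x -> prj N (F t x) = F t x.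
(** The time increment is weighted by |y| so that linear terms with time-dependent coefficients
    qualify. A single norm r is used; on the range of [prj N] Bernstein's inequality supplies the
    others. *)
Hypothesis FL : forall s t x y, 0 <= s -> 0 <= t -> prj N x = x -> prj N y = y ->
  nm r (F t x - F s y) <= L * (nm r (x - y) + `|t - s| * nm r y).
Hypothesis F0 : forall t, 0 <= t -> F t 0 = 0.
Variable x0 : E.
Hypothesis x0S : prj N x0 = x0.

Let F_bound t x : 0 <= t -> prj N x = x -> nm r (F t x) <= L * nm r x.
Proof.
move=> t0 xS; have := FL t0 t0 xS (prj0 E N).
by rewrite F0 // !subr0 nm0 mulr0 addr0.
Qed.

Fixpoint euler (h : R) j : E :=
  if j is i.+1 then euler h i + h *: F (i%:R * h) (euler h i) else x0.

Section FixedStep.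
Variable h : R.
Hypothesis h0 : 0 < h.
Local Notation e := (euler h).

Let ih0 (i : nat) : 0 <= i%:R * h. Proof. by rewrite mulr_ge0 // ltW. Qed.

Lemma euler_prj j : prj N (e j) = e j.
Proof.
elim: j => [|j IH] //=; by rewrite prjD prjZ IH FS.
Qed.

(** Each step multiplies the norm by at most 1 + h L <= exp (h L). *)
Lemma euler_growth j : nm r (e j) <= expR (L * (j%:R * h)) * nm r x0.
Proof.
elim: j => [|j IH] /=; first by rewrite !(mul0r, mulr0) expR0 mul1r.
apply: le_trans (nmD _ _ _) _; rewrite nmZ gtr0_norm //.
have Fb := F_bound (ih0 j) (euler_prj j).
apply: (@le_trans _ _ ((1 + h * L) * nm r (e j))).
  by rewrite mulrDl mul1r lerD2l -mulrA ler_wpM2l // ltW.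
have -> : L * (j.+1%:R * h) = h * L + L * (j%:R * h) by rewrite -natr1; ring.
rewrite expRD -mulrA; apply: ler_pM; rewrite ?nm_ge0 //.
  by rewrite addr_ge0 // mulr_ge0 // ltW.
exact: expR_ge1Dx.
Qed.

Variable T : R.
Let C := expR (L * T) * nm r x0.

Let C0 : 0 <= C. Proof. by rewrite mulr_ge0 ?expR_ge0 ?nm_ge0. Qed.

Lemma euler_bound j : j%:R * h <= T -> nm r (e j) <= C.
Proof.
move=> jT; apply: le_trans (euler_growth j) _.
by rewrite ler_wpM2r ?nm_ge0 // ler_expR ler_wpM2l.
Qed.

Let nle (i k : nat) : i%:R * h <= (i + k)%:R * h.
Proof. by rewrite ler_wpM2r ?ler_nat ?leq_addr // ltW. Qed.

Lemma euler_lipschitz i k : (i + k)%:R * h <= T ->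
  nm r (e (i + k) - e i) <= k%:R * h * (L * C).
Proof.
elim: k => [|k IH] hT; first by rewrite addn0 subrr nm0 !mul0r.
have hT' : (i + k)%:R * h <= T.
  by apply: le_trans hT; rewrite addnS ler_wpM2r ?ler_nat // ltW.
rewrite addnS /= addrAC; apply: le_trans (nmD _ _ _) _.
rewrite nmZ gtr0_norm // -natr1 mulrDl mulrDl mul1r.
apply: lerD; first exact: IH.
rewrite ler_wpM2l ?(ltW h0) //; apply: le_trans (F_bound (ih0 _) (euler_prj _)) _.
by rewrite ler_wpM2l // euler_bound.
Qed.

(** With M = L (L C + C), the slopes at i and i + k differ by at most M k h, so the error grows by M
    k h^2 in that step, which the increase of M (k h)^2 absorbs. *)
Lemma euler_quadratic i k : (i + k)%:R * h <= T ->
  nm r (e (i + k) - e i - (k%:R * h) *: F (i%:R * h) (e i)) <=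
  L * (L * C + C) * (k%:R * h) ^+ 2.
Proof.
elim: k => [|k IH] hT.
  by rewrite addn0 subrr mul0r scale0r subr0 nm0 expr0n mulr0.
have hT' : (i + k)%:R * h <= T.
  by apply: le_trans hT; rewrite addnS ler_wpM2r ?ler_nat // ltW.
rewrite addnS /=.
set Fk := F ((i + k)%:R * h) _; set Fi := F (i%:R * h) (e i).
have -> : e (i + k) + h *: Fk - e i - (k.+1%:R * h) *: Fi =
  (e (i + k) - e i - (k%:R * h) *: Fi) + h *: (Fk - Fi).
  by rewrite -natr1; linear_identity.
apply: le_trans (nmD _ _ _) _; rewrite nmZ gtr0_norm //.
have kh : 0 <= k%:R * h by exact: ih0.
have FF : nm r (Fk - Fi) <= L * (L * C + C) * (k%:R * h).
  apply: le_trans (FL (ih0 _) (ih0 _) (euler_prj _) (euler_prj _)) _.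
  rewrite -mulrA ler_wpM2l //.
  have -> : (i + k)%:R * h - i%:R * h = k%:R * h by rewrite natrD; ring.
  rewrite ger0_norm //.
  have a1 := euler_lipschitz hT'.
  have a2 : nm r (e i) <= C by apply: euler_bound; apply: le_trans hT'; exact: nle.
  have := ler_wpM2l kh a2; lra.
have M0 : 0 <= L * (L * C + C) by rewrite mulr_ge0 // addr_ge0 // mulr_ge0.
move: M0 FF (IH hT'); set M := L * (_ + C) => M0 FF IHk.
have := ler_wpM2l (ltW h0) FF.
have : 0 <= M * (k%:R * h) * h by do ?apply: mulr_ge0 => //; exact: ltW.
have : 0 <= M * h ^+ 2 by rewrite mulr_ge0 // sqr_ge0.
rewrite -natr1; set a := k%:R; lra.
Qed.

Let ix (t : R) := Num.truncn (t / h).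

Let ix_itv t : 0 <= t -> (ix t)%:R * h <= t /\ t < (ix t)%:R * h + h.
Proof.
move=> t0; have := truncn_itv (divr_ge0 t0 (ltW h0)).
by rewrite ler_pdivlMr // ltr_pdivrMr // -natr1 mulrDl mul1r => /andP[].
Qed.

Lemma euler_bound_at t : 0 <= t -> t <= T -> nm r (e (ix t)) <= C.
Proof. by move=> t0 tT; apply: euler_bound; apply: le_trans tT; have [] := ix_itv t0. Qed.

(** Arbitrary times are rounded down to the grid. The three terms on the right are the grid estimate
    over a time of at most t - s + h, the time shift of the slope at s, and the rounding of t - s;
    for h = 0 only the first survives. *)
Lemma euler_consistent s t : 0 <= s -> s <= t -> t <= T ->
  nm r (e (ix t) - e (ix s) - (t - s) *: F s (e (ix s))) <=
  L * (L * C + C) * (t - s + h) ^+ 2 + (t - s + h) * (L * (h * C)) + h * (L * C).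
Proof.
move=> s0 st tT; have t0 := le_trans s0 st.
have [s1 s2] := ix_itv s0; have [t1 t2] := ix_itv t0.
have ij : (ix s <= ix t)%N by apply: Num.Theory.le_truncn; rewrite ler_wpM2r ?invr_ge0 // ltW.
have [k kE] : exists k, ix t = (ix s + k)%N by exists (ix t - ix s)%N; rewrite subnKC.
have kh : k%:R * h = (ix t)%:R * h - (ix s)%:R * h by rewrite kE natrD; ring.
have hT : (ix s + k)%:R * h <= T by rewrite -kE; apply: le_trans tT.
have Q := euler_quadratic hT; rewrite -kE in Q.
set a := k%:R * h in kh Q.
have a0 : 0 <= a by exact: ih0.
have al : a <= t - s + h by lra.
have ad : `|a - (t - s)| <= h by rewrite ler_norml; lra.
set es := e (ix s) in Q *.
have esC : nm r es <= C by apply: euler_bound_at => //; exact: le_trans tT.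
have esS : prj N es = es by exact: euler_prj.
have -> : e (ix t) - es - (t - s) *: F s es =
  (e (ix t) - es - a *: F ((ix s)%:R * h) es)
  + a *: (F ((ix s)%:R * h) es - F s es) + (a - (t - s)) *: F s es.
  by linear_identity.
apply: le_trans (nmD _ _ _) _; apply: lerD; last first.
  rewrite nmZ; apply: ler_pM; rewrite ?nm_ge0 //.
  by apply: le_trans (F_bound s0 esS) _; rewrite ler_wpM2l.
apply: le_trans (nmD _ _ _) _; apply: lerD.
  apply: le_trans Q _; apply: ler_wpM2l.
    by rewrite mulr_ge0 // addr_ge0 // mulr_ge0.
  by rewrite ler_pXn2r // nnegrE // (le_trans a0).
rewrite nmZ ger0_norm //; apply: ler_pM; rewrite ?nm_ge0 //.
apply: le_trans (FL s0 (ih0 _) esS esS) _; rewrite subrr nm0 add0r ler_wpM2l //.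
apply: ler_pM; rewrite ?nm_ge0 //.
rewrite ler_norml; lra.
Qed.

End FixedStep.

(** Bounds in norm r become bounds in all norms on the range of [prj N], so the step functions have
    an ultralimit. The estimate [euler_consistent] passes to it with h = 0, which is the first
    hypothesis of [quadratic_hderiv]. *)
Lemma projected_ode : exists x : R -> E, [/\ x 0 = x0,
  forall t, 0 <= t -> prj N (x t) = x t &
  hderiv x (fun t => F t (x t))].
Proof.
have [U [UU oU]] := ultrafilter_oo.
pose h m : R := m.+1%:R^-1.
have h0 m : 0 < h m by rewrite invr_gt0 ltr0n.
have hU : h @ U --> (0 : R) by apply: (ultra_cvg oU); exact: cvg_harmonic.
pose X m (t : R) := euler (h m) (Num.truncn (t / h m)).
have XS m t : prj N (X m t) = X m t by exact: euler_prj.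
have Xbd m t T : 0 <= t -> t <= T -> nm r (X m t) <= expR (L * T) * nm r x0.
  by move=> t0 tT; exact: euler_bound_at.
have [x hx] : exists x : R -> E, forall t : R, 0 <= t -> ucvg U (fun m => X m t) (x t).
  apply: ultralimit => // t p t0; have [C HC] := prj_bernstein E r p N.
  exists (`|C| * (expR (L * t) * nm r x0)) => m.
  rewrite -XS; apply: le_trans (HC _) _.
  apply: (@le_trans _ _ (`|C| * nm r (X m t))).
    by rewrite ler_wpM2r ?nm_ge0 // ler_norm.
  by rewrite ler_wpM2l // Xbd.
have xS t : 0 <= t -> prj N (x t) = x t.
  move=> t0; have := ucvg_prj UU N (hx t t0); under eq_fun do rewrite XS.
  by move=> /(ucvg_unique UU (hx t t0)).
have xbd t T : 0 <= t -> t <= T -> nm r (x t) <= expR (L * T) * nm r x0.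
  move=> t0 tT; apply: (ucvg_bound UU (hx t t0) _ (cvg_cst _)) => m.
  exact: Xbd.
have Fx t : 0 <= t -> prj N (F t (x t)) = F t (x t) by move=> t0; rewrite FS // xS.
have quad T : forall s t, 0 <= s -> s <= t -> t <= T ->
    nm r (x t - x s - (t - s) *: F s (x s)) <=
    L * (L * (expR (L * T) * nm r x0) + expR (L * T) * nm r x0) * (t - s) ^+ 2.
  move=> s t s0 st tT; have t0 := le_trans s0 st.
  set C := expR (L * T) * nm r x0.
  have Fcv : nm r (F s (X m s) - F s (x s)) @[m --> U] --> (0 : R).
    apply: (@squeeze_ucvg _ _ UU _ (fun m => L * nm r (X m s - x s)) (fun=> nm_ge0 _ _)).
      move=> m; apply: le_trans (FL s0 s0 (XS m s) (xS s s0)) _.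
      by rewrite subrr normr0 mul0r addr0.
    by rewrite -(mulr0 L); apply: cvgMr; exact: hx.
  have bound m : nm r (x t - x s - (t - s) *: F s (x s)) <=
     L * (L * C + C) * (t - s + h m) ^+ 2 + (t - s + h m) * (L * (h m * C))
     + h m * (L * C)
     + (nm r (X m t - x t) + nm r (X m s - x s)
        + (t - s) * nm r (F s (X m s) - F s (x s))).
    have -> : x t - x s - (t - s) *: F s (x s) =
       (X m t - X m s - (t - s) *: F s (X m s))
       + (- (X m t - x t) + (X m s - x s) + (t - s) *: (F s (X m s) - F s (x s))).
      by linear_identity.
    apply: le_trans (nmD _ _ _) _; apply: lerD; first exact: euler_consistent.
    apply: le_trans (nmD _ _ _) _; rewrite nmZ ger0_norm ?subr_ge0 // lerD2r.
    by apply: le_trans (nmD _ _ _) _; rewrite nmN.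
  have cth : (fun m => t - s + h m) @ U --> t - s.
    by rewrite -[X in _ --> X]addr0; apply: cvgD => //; exact: cvg_cst.
  have lim : (fun m => L * (L * C + C) * (t - s + h m) ^+ 2
     + (t - s + h m) * (L * (h m * C)) + h m * (L * C)
     + (nm r (X m t - x t) + nm r (X m s - x s)
        + (t - s) * nm r (F s (X m s) - F s (x s)))) @ U --> 
     L * (L * C + C) * (t - s) ^+ 2 + (t - s) * (L * (0 * C)) + 0 * (L * C)
     + (0 + 0 + (t - s) * 0).
    apply: cvgD; first apply: cvgD; first apply: cvgD.
    - by apply: cvgMr; under eq_fun do rewrite expr2; rewrite expr2; apply: cvgM.
    - by apply: cvgM => //; apply: cvgMr; apply: cvgMl.
    - by apply: cvgMl.
    - by apply: cvgD; [apply: cvgD; exact: hx|apply: cvgMr].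
  move: lim; rewrite !(mul0r, mulr0, addr0) => lim.
  by apply: (ler_cvg_to (cvg_cst _) lim); apply: nearW.
exists x; split => //.
  apply: (ucvg_unique UU (hx 0 (lexx 0))) => p.
  under eq_fun do rewrite /X mul0r truncn0 /= subrr nm0.
  exact: cvg_cst.
apply: quadratic_hderiv => p T; have [B HB] := prj_bernstein E r p N.
- set M := L * (L * (expR (L * T) * nm r x0) + expR (L * T) * nm r x0).
  exists (`|B| * M) => s t s0 st tT; have t0 := le_trans s0 st.
  have -> : x t - x s - (t - s) *: F s (x s) =
    prj N (x t - x s - (t - s) *: F s (x s)) by rewrite !prjB prjZ !xS // Fx.
  apply: le_trans (HB _) _.
  apply: (@le_trans _ _ (`|B| * nm r (x t - x s - (t - s) *: F s (x s)))).
    by rewrite ler_wpM2r ?nm_ge0 // ler_norm.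
  by rewrite -mulrA ler_wpM2l //; exact: quad.
- set C := expR (L * T) * nm r x0.
  set M := L * (L * C + C).
  (* M T comes from (t - s)^2 <= T (t - s) in the increment of x, L C from its drift, the last C
     from the explicit time dependence of F. *)
  exists (`|B| * (L * (M * T + L * C + C))) => s t s0 st tT.
  have t0 := le_trans s0 st; have sT := le_trans st tT.
  have C0 : 0 <= C by rewrite mulr_ge0 ?expR_ge0 ?nm_ge0.
  have M0 : 0 <= M by rewrite mulr_ge0 // addr_ge0 // mulr_ge0.
  have -> : F t (x t) - F s (x s) = prj N (F t (x t) - F s (x s)).
    by rewrite prjB !Fx.
  apply: le_trans (HB _) _.
  apply: (@le_trans _ _ (`|B| * nm r (F t (x t) - F s (x s)))).
    by rewrite ler_wpM2r ?nm_ge0 // ler_norm.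
  rewrite -mulrA ler_wpM2l //.
  apply: le_trans (FL s0 t0 (xS t t0) (xS s s0)) _; rewrite -mulrA ler_wpM2l //.
  rewrite ger0_norm ?subr_ge0 //.
  have sC : nm r (x s) <= C by apply: xbd.
  have ts : 0 <= t - s by rewrite subr_ge0.
  have d1 : nm r (x t - x s) <= M * (t - s) ^+ 2 + (t - s) * (L * C).
    rewrite -[x t - x s](subrK ((t - s) *: F s (x s))).
    apply: le_trans (nmD _ _ _) _; apply: lerD; first exact: quad.
    rewrite nmZ ger0_norm // ler_wpM2l //.
    by apply: le_trans (F_bound s0 (xS s s0)) _; rewrite ler_wpM2l.
  have d2 := ler_wpM2l ts sC.
  have d3 : M * (t - s) ^+ 2 <= M * T * (t - s).
    rewrite expr2 !mulrA ler_wpM2r // ler_wpM2l //; lra.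
  lra.
Qed.

End EulerPolygon.

(** * Families bounded and Lipschitz in every norm, uniformly in the index *)

Section BoundedFamilies.
Variables (R : realType) (E : mhd_space R).
Implicit Types x y : nat -> R -> E.

Definition fam_bounded x := forall p, exists2 C : R, 0 <= C &
  forall m (t : R), 0 <= t -> nm p (x m t) <= C.

Definition fam_lipschitz x := forall p, exists2 C : R, 0 <= C &
  forall m (s t : R), 0 <= s -> 0 <= t -> nm p (x m t - x m s) <= C * `|t - s|.

Lemma fam_boundedD x y : fam_bounded x -> fam_bounded y ->
  fam_bounded (fun m t => x m t + y m t).
Proof.
move=> hx hy p; have [C C0 HC] := hx p; have [D D0 HD] := hy p.
exists (C + D); first exact: addr_ge0.
by move=> m t t0; apply: le_trans (nmD _ _ _) _; apply: lerD; [exact: HC|exact: HD].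
Qed.

Lemma fam_lipschitzD x y : fam_lipschitz x -> fam_lipschitz y ->
  fam_lipschitz (fun m t => x m t + y m t).
Proof.
move=> hx hy p; have [C C0 HC] := hx p; have [D D0 HD] := hy p.
exists (C + D); first exact: addr_ge0.
move=> m s t s0 t0; rewrite opprD addrACA mulrDl; apply: le_trans (nmD _ _ _) _.
by apply: lerD; [exact: HC|exact: HD].
Qed.

Lemma fam_bounded_Alin x : fam_bounded x -> fam_bounded (fun m t => Alin (x m t)).
Proof.
move=> hx p; have [C C0 HC] := hx (p + 2); have [D D0 HD] := Abd_bound E.
exists (D * C); first exact: mulr_ge0.
by move=> m t t0; apply: le_trans (HD _ _) _; rewrite ler_wpM2l // HC.
Qed.

Lemma fam_lipschitz_Alin x : fam_lipschitz x ->
  fam_lipschitz (fun m t => Alin (x m t)).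
Proof.
move=> hx p; have [C C0 HC] := hx (p + 2); have [D D0 HD] := Abd_bound E.
exists (D * C); first exact: mulr_ge0.
move=> m s t s0 t0; rewrite -AlinB; apply: le_trans (HD _ _) _.
by rewrite -mulrA ler_wpM2l // HC.
Qed.

Lemma fam_bounded_prj x : fam_bounded x -> fam_bounded (fun m t => prj m (x m t)).
Proof.
move=> hx p; have [C C0 HC] := hx p; exists C => // m t t0.
by apply: le_trans (prj_contract _ _ _) _; exact: HC.
Qed.

Lemma fam_lipschitz_prj x : fam_lipschitz x ->
  fam_lipschitz (fun m t => prj m (x m t)).
Proof.
move=> hx p; have [C C0 HC] := hx p; exists C => // m s t s0 t0.
by rewrite -prjB; apply: le_trans (prj_contract _ _ _) _; exact: HC.
Qed.

Lemma fam_bounded_Pbil x y : fam_bounded x -> fam_bounded y ->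
  fam_bounded (fun m t => Pbil (x m t) (y m t)).
Proof.
move=> hx hy p; have [D [q [D0 _ HD]]] := Pbil_tame E p.
have [C C0 HC] := hx q; have [C' C'0 HC'] := hy q.
exists (D * C * C'); first by rewrite !mulr_ge0.
move=> m t t0; apply: le_trans (HD _ _) _; rewrite -!mulrA ler_wpM2l //.
by apply: ler_pM; rewrite ?nm_ge0 // ?HC ?HC'.
Qed.

Lemma fam_lipschitz_Pbil x y : fam_bounded x -> fam_bounded y ->
  fam_lipschitz x -> fam_lipschitz y ->
  fam_lipschitz (fun m t => Pbil (x m t) (y m t)).
Proof.
move=> bx by_ hx hy p; have [D [q [D0 _ HD]]] := Pbil_tame E p.
have [B B0 HB] := bx q; have [B' B'0 HB'] := by_ q.
have [C C0 HC] := hx q; have [C' C'0 HC'] := hy q.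
exists (D * (C * B' + B * C')); first by rewrite mulr_ge0 // addr_ge0 // mulr_ge0.
move=> m s t s0 t0.
have -> : Pbil (x m t) (y m t) - Pbil (x m s) (y m s) =
    Pbil (x m t - x m s) (y m t) + Pbil (x m s) (y m t - y m s).
  by rewrite PbilBl PbilBr addrA subrK.
apply: le_trans (nmD _ _ _) _; apply: le_trans (lerD (HD _ _) (HD _ _)) _.
rewrite -!mulrA -mulrDr ler_wpM2l // mulrDl; apply: lerD.
  by rewrite mulrAC; apply: ler_pM; rewrite ?nm_ge0 // ?HC ?HB'.
by rewrite -mulrA; apply: ler_pM; rewrite ?nm_ge0 // ?HB ?HC'.
Qed.

Lemma fam_lipschitz_hderiv x x' : (forall m, hderiv (x m) (x' m)) ->
  fam_bounded x' -> fam_lipschitz x.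
Proof.
move=> dx bx p; have [C C0 HC] := bx p; exists C => // m s t s0 t0.
wlog st : s t s0 t0 / s <= t.
  move=> H; have [/H|/ltW /H] := leP s t; first exact.
  by rewrite nm_distC distrC; exact.
rewrite ger0_norm ?subr_ge0 //.
have := @mean_value _ _ _ _ p s t 0 C (dx m) s0 st.
rewrite scaler0 subr0; apply => r sr rt.
by rewrite subr0 HC // (le_trans s0).
Qed.

(** The common Lipschitz constant of the derivatives gives a Taylor remainder C (t - s)^2
    independent of m, and such an inequality is closed under limits. *)
Lemma fam_limit_hderiv (U : set_system nat) (UU : UltraFilter U) x x'
    (y y' : R -> E) :
  (forall m, hderiv (x m) (x' m)) -> fam_lipschitz x' ->
  (forall t : R, 0 <= t -> ucvg U (fun m => x m t) (y t)) ->
  (forall t : R, 0 <= t -> ucvg U (fun m => x' m t) (y' t)) ->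
  hderiv y y'.
Proof.
move=> dx lx xy xy'; apply: quadratic_hderiv => p T; have [C C0 HC] := lx p;
  exists C => s t s0 st tT; have t0 := le_trans s0 st.
- have h := ucvgB UU (ucvgB UU (xy t t0) (xy s s0)) (ucvgZ UU (t - s) (xy' s s0)).
  apply: (ucvg_bound UU h _ (cvg_cst _)) => m.
  rewrite expr2 mulrA /=; have := @mean_value _ _ _ _ p s t (x' m s) (C * (t - s)) (dx m) s0 st.
  apply => r sr rt.
  apply: le_trans (HC _ _ _ s0 (le_trans s0 sr)) _.
  by rewrite ger0_norm ?subr_ge0 // ler_wpM2l // lerD2r.
- apply: (ucvg_bound UU (ucvgB UU (xy' t t0) (xy' s s0)) _ (cvg_cst _)) => m.
  by rewrite -(ger0_norm (_ : 0 <= t - s)) ?subr_ge0 // HC.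
Qed.

End BoundedFamilies.

(** * Radial cutoff *)

Section Cutoff.
Variables (R : realType) (E : mhd_space R) (n B : R).
Hypothesis B0 : 0 < B.
Implicit Types x y : E.

(** The radial retraction onto the ball of radius B in norm n, kept as a scalar multiple of x: it
    then preserves the range of each projection, and in the quadratic term the square of this factor
    plays the role of [c] in [energy_perturbation]. *)
Definition cutoff_factor x := B / Num.max B (nm n x).
Definition cutoff x := cutoff_factor x *: x.

Let mx0 x : 0 < Num.max B (nm n x). Proof. by rewrite lt_max B0. Qed.

Lemma cutoff_factor_itv x : 0 <= cutoff_factor x <= 1.
Proof.
rewrite /cutoff_factor divr_ge0 ?(ltW B0) ?(ltW (mx0 x)) //=.
by rewrite ler_pdivrMr ?mx0 // mul1r le_max lexx.
Qed.

Lemma cutoff_id x : nm n x <= B -> cutoff x = x.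
Proof.
by move=> h; rewrite /cutoff /cutoff_factor max_l // divff ?gt_eqF // scale1r.
Qed.

Lemma cutoff0 : cutoff 0 = 0. Proof. exact: scaler0. Qed.

Lemma nm_cutoff x : nm n (cutoff x) <= B.
Proof.
have /andP[c0 _] := cutoff_factor_itv x.
rewrite /cutoff nmZ ger0_norm // /cutoff_factor mulrAC ler_pdivrMr ?mx0 //.
by rewrite ler_wpM2l ?(ltW B0) // le_max lexx orbT.
Qed.

(** With a, b the two denominators, the factors differ by B (b - a) / (a b). As |y| <= b and B <= a,
    this costs at most |b - a| <= |x - y|, on top of |x - y| from the first term. *)
Lemma cutoff_lipschitz x y : nm n (cutoff x - cutoff y) <= 2 * nm n (x - y).
Proof.
have -> : cutoff x - cutoff y =
   cutoff_factor x *: (x - y) + (cutoff_factor x - cutoff_factor y) *: y.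
  by rewrite /cutoff; linear_identity.
have /andP[c0 c1] := cutoff_factor_itv x.
apply: le_trans (nmD _ _ _) _; rewrite !nmZ ger0_norm // mulrDl mul1r.
apply: lerD; first by rewrite ler_piMl ?nm_ge0.
pose a := Num.max B (nm n x); pose b := Num.max B (nm n y).
have a0 : 0 < a by exact: mx0.
have b0 : 0 < b by exact: mx0.
have -> : cutoff_factor x - cutoff_factor y = (B / a / b) * (b - a).
  by rewrite /cutoff_factor -/a -/b; field; rewrite !gt_eqF.
have ab : `|b - a| <= nm n (x - y).
  have := nm_dist n x y; rewrite /a /b !maxEle !ler_norml => /andP[h1 h2].
  by do 2 case: ifPn; rewrite -?ltNge => *; apply/andP; split; lra.
rewrite normrM ger0_norm; last by rewrite !divr_ge0 // ltW.
have yb : nm n y <= b by rewrite le_max lexx orbT.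
have Ba : B / a <= 1 by rewrite ler_pdivrMr // mul1r le_max lexx.
have h1 : nm n y / b <= 1 by rewrite ler_pdivrMr // mul1r.
have -> : B / a / b * `|b - a| * nm n y = (B / a) * (nm n y / b) * `|b - a|.
  by field; rewrite !gt_eqF.
apply: le_trans ab; rewrite -mulrA; apply: le_trans (ler_piMl _ Ba) _.
  by rewrite mulr_ge0 // divr_ge0 ?nm_ge0 // ltW.
exact: ler_piMl.
Qed.

End Cutoff.

(** * Galerkin approximation *)

Section Galerkin.
Variables (R : realType) (E : mhd_space R) (n : R).
Local Notation mu := (dis E).
Local Notation G := (Gc E).
Local Notation K := (Kc E).
Hypothesis hn : crit E + 1 < n.
Variables (v v' : R -> E) (J : R -> R).
Hypothesis dv : hderiv v v'.
Hypothesis bv : fam_bounded (fun _ : nat => v).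
Hypothesis bv' : fam_bounded (fun _ : nat => v').
Hypothesis hJ : forall p,
  (int0oo (fun t => nm p (v (hl t))) <= (J p)%:E)%E.

Let lv : fam_lipschitz (fun _ : nat => v).
Proof. exact: fam_lipschitz_hderiv (fun=> dv) bv'. Qed.

Section OneProjection.
Variables (N : nat) (B : R).
Hypothesis B0 : 0 < B.
Local Notation cut := (@cutoff R E n B).

(** Only the quadratic term is cut off: the others are linear in x and already Lipschitz on the
    range of [prj N]. [Alin] preserves that range since it commutes with the projection. *)
Definition galerkin_field t x : E :=
  Alin x + prj N (Pbil (v t) x + Pbil x (v t) + Pbil (cut x) (cut x)).

Let cutS x : prj N x = x -> prj N (cut x) = cut x.
Proof. by move=> xS; rewrite /cutoff prjZ xS. Qed.

Lemma galerkin_lipschitz : exists2 L, 0 <= L & forall s t x y,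
  0 <= s -> 0 <= t -> prj N x = x -> prj N y = y ->
  nm n (galerkin_field t x - galerkin_field s y) <=
    L * (nm n (x - y) + `|t - s| * nm n y).
Proof.
have [D D0 HD] := Abd_bound E.
have [C [q [C0 nq HC]]] := Pbil_tame E n.
(* Bernstein's inequality: on the range of [prj N] the norms q and n + 2 are controlled by the norm
   n, which undoes the loss of derivatives. *)
have [b [b0 bq b2]] : exists b, [/\ 0 <= b,
    forall x : E, prj N x = x -> nm q x <= b * nm n x &
    forall x : E, prj N x = x -> nm (n + 2) x <= b * nm n x].
  have [b1 H1] := prj_bernstein E n q N; have [b2 H2] := prj_bernstein E n (n + 2) N.
  exists (`|b1| + `|b2|); split; first exact: addr_ge0.
    move=> x xS; rewrite -{1}xS; apply: le_trans (H1 x) _.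
    rewrite ler_wpM2r ?nm_ge0 //; apply: le_trans (ler_norm _) _.
    by rewrite lerDl.
  move=> x xS; rewrite -{1}xS; apply: le_trans (H2 x) _.
  rewrite ler_wpM2r ?nm_ge0 //; apply: le_trans (ler_norm _) _.
  by rewrite lerDr.
have [V V0 HV] := bv q; have [M M0 HM] := lv q.
(* One summand each for the linear part, for the size and the time increment of v (in either slot of
   P), and for the cut-off square, where 4 is two slots times the Lipschitz constant 2. *)
exists (D * b + (2 * (C * V * b) + 2 * (C * M * b)) + 4 * (C * b * B * b)).
  by rewrite !addr_ge0 ?mulr_ge0 // ltW.
move=> s t x y s0 t0 xS yS.
have dS : prj N (x - y) = x - y by rewrite prjB xS yS.
have -> : galerkin_field t x - galerkin_field s y =
  Alin (x - y) + prj N (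
   (Pbil (v t) (x - y) + Pbil (v t - v s) y) +
   (Pbil (x - y) (v t) + Pbil y (v t - v s)) +
   (Pbil (cut x - cut y) (cut x) + Pbil (cut y) (cut x - cut y))).
  rewrite /galerkin_field !(AlinB, PbilBl, PbilBr) !(prjB, prjD); linear_identity.
set d := nm n (x - y); set e := `|t - s| * nm n y.
have d0 : 0 <= d by exact: nm_ge0.
have e0 : 0 <= e by rewrite mulr_ge0 ?nm_ge0.
have i1 : nm n (Alin (x - y)) <= D * b * d.
  by apply: le_trans (HD _ _) _; rewrite -mulrA ler_wpM2l // b2.
have i2 : nm n (Pbil (v t) (x - y)) <= C * V * b * d.
  apply: le_trans (HC _ _) _; rewrite -!mulrA ler_wpM2l //.
  by apply: ler_pM; rewrite ?nm_ge0 ?HV ?bq.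
have i2' : nm n (Pbil (x - y) (v t)) <= C * V * b * d.
  apply: le_trans (HC _ _) _; rewrite mulrAC -!mulrA ler_wpM2l //.
  by apply: ler_pM; rewrite ?nm_ge0 ?HV ?bq.
have i3 : nm n (Pbil (v t - v s) y) <= C * M * b * e.
  apply: le_trans (HC _ _) _; rewrite -!mulrA ler_wpM2l //.
  have -> : M * (b * e) = (M * `|t - s|) * (b * nm n y) by rewrite /e; ring.
  by apply: ler_pM; rewrite ?nm_ge0 ?HM ?bq.
have i3' : nm n (Pbil y (v t - v s)) <= C * M * b * e.
  apply: le_trans (HC _ _) _; rewrite mulrAC -!mulrA ler_wpM2l //.
  have -> : M * (b * e) = (M * `|t - s|) * (b * nm n y) by rewrite /e; ring.
  by apply: ler_pM; rewrite ?nm_ge0 ?HM ?bq.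
have cq z : prj N z = z -> nm q (cut z) <= b * B.
  move=> zS; apply: le_trans (bq _ (cutS zS)) _.
  by rewrite ler_wpM2l // nm_cutoff.
have cd : nm q (cut x - cut y) <= b * (2 * d).
  apply: le_trans (bq _ _) _; first by rewrite prjB !cutS.
  by rewrite ler_wpM2l // cutoff_lipschitz.
have i4 : nm n (Pbil (cut x - cut y) (cut x)) <= 2 * (C * b * B * b * d).
  apply: le_trans (HC _ _) _.
  have -> : 2 * (C * b * B * b * d) = C * ((b * (2 * d)) * (b * B)) by ring.
  rewrite -mulrA ler_wpM2l //.
  by apply: ler_pM; rewrite ?nm_ge0 ?cq.
have i4' : nm n (Pbil (cut y) (cut x - cut y)) <= 2 * (C * b * B * b * d).
  apply: le_trans (HC _ _) _.
  have -> : 2 * (C * b * B * b * d) = C * ((b * B) * (b * (2 * d))) by ring.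
  rewrite -mulrA ler_wpM2l //.
  by apply: ler_pM; rewrite ?nm_ge0 ?cq.
apply: le_trans (nmD _ _ _) _; apply: le_trans (lerD (lexx _) (prj_contract _ _ _)) _.
apply: le_trans (lerD (lexx _) (nmD _ _ _)) _.
have := nmD n (Pbil (v t) (x - y) + Pbil (v t - v s) y)
  (Pbil (x - y) (v t) + Pbil y (v t - v s)).
have := nmD n (Pbil (v t) (x - y)) (Pbil (v t - v s) y).
have := nmD n (Pbil (x - y) (v t)) (Pbil y (v t - v s)).
have := nmD n (Pbil (cut x - cut y) (cut x)) (Pbil (cut y) (cut x - cut y)).
have Bp := ltW B0.
have k1 : 0 <= D * b * e := mulr_ge0 (mulr_ge0 D0 b0) e0.
have k2 : 0 <= C * V * b * e := mulr_ge0 (mulr_ge0 (mulr_ge0 C0 V0) b0) e0.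
have k3 : 0 <= C * M * b * d := mulr_ge0 (mulr_ge0 (mulr_ge0 C0 M0) b0) d0.
have k4 : 0 <= C * b * B * b * e :=
  mulr_ge0 (mulr_ge0 (mulr_ge0 (mulr_ge0 C0 b0) Bp) b0) e0.
lra.
Qed.

Lemma galerkin_exists x0 : prj N x0 = x0 -> exists x : R -> E, [/\ x 0 = x0,
  forall t, 0 <= t -> prj N (x t) = x t &
  hderiv x (fun t => galerkin_field t (x t))].
Proof.
move=> x0S; have [L L0 HL] := galerkin_lipschitz.
apply: (@projected_ode R E N n galerkin_field L L0) => //.
- by move=> t x t0 xS; rewrite /galerkin_field prjD prj_A xS prj_idem.
- by move=> t t0; rewrite /galerkin_field cutoff0 Alin0 !Pbil0l Pbil0r !addr0 prj0 addr0.
Qed.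

(** Since x is in the range, self-adjointness removes the projection, and the two cutoff factors
    combine into a square in [0,1]. *)
Lemma galerkin_energy p t x : n <= p -> 0 <= t -> prj N x = x ->
  ip p (galerkin_field t x) x <= (- mu + (G p p * nm p (v t)
    + K p p * nm (p + 1) (v t) + G p n * nm n x)) * ip p x x.
Proof.
move=> np t0 xS; rewrite /galerkin_field ipDl mulrDl.
apply: lerD; first exact: Alin_dis.
rewrite prj_self xS /cutoff PbilZl PbilZr scalerA.
apply: energy_perturbation => //.
have /andP[c0 c1] := cutoff_factor_itv n B0 x.
by rewrite mulr_ge0 // mulr_ile1.
Qed.

End OneProjection.

Variable w0 : E.
Let rho := mu / G n n * expR (- G n n * J n - K n n * J (n + 1)).
Hypothesis small : nm n w0 < rho.

Lemma perturbation_exists : exists w : R -> E, w 0 = w0 /\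
  hderiv w (fun t => Alin (w t) + (Pbil (v t) (w t) + Pbil (w t) (v t)
    + Pbil (w t) (w t))).
Proof.
pose Bn := expR (G n n * J n + K n n * J (n + 1)) / (1 - nm n w0 / rho) * nm n w0.
have mu0 := dis_gt0 E.
have E1 t : 0 <= t -> expR (- mu * t) <= 1.
  by move=> t0; rewrite -expR0 ler_expR mulNr oppr_le0 mulr_ge0 // ltW.
have rho0 : 0 < rho by apply: le_lt_trans small; exact: nm_ge0.
have l0 : 0 < 1 - nm n w0 / rho by rewrite subr_gt0 ltr_pdivrMr // mul1r.
have Bn0 : 0 <= Bn.
  by rewrite mulr_ge0 ?nm_ge0 // divr_ge0 ?expR_ge0 // ltW.
(* The radius is Bn + 1 because Bn vanishes for w0 = 0. *)
have B0 : 0 < Bn + 1 by rewrite ltr_wpDl.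
have H N : exists x : R -> E, [/\ x 0 = prj N w0,
    forall t, 0 <= t -> prj N (x t) = x t &
    hderiv x (fun t => galerkin_field N (Bn + 1) t (x t))].
  by apply: galerkin_exists => //; exact: prj_idem.
pose w N := sval (cid (H N)).
have w00 N : w N 0 = prj N w0 by case: (svalP (cid (H N))).
have wS N : forall t, 0 <= t -> prj N (w N t) = w N t by case: (svalP (cid (H N))).
have dw N : hderiv (w N) (fun t => galerkin_field N (Bn + 1) t (w N t)).
  by case: (svalP (cid (H N))).
have ap N : forall t, 0 <= t -> nm n (w N t) <= Bn * expR (- mu * t) /\
    forall p, n <= p -> nm p (w N t) <=
    expR (G p p * J p + K p p * J (p + 1) +
      G p n * (nm n w0 / rho) / (G n n * (1 - nm n w0 / rho)))
    * nm p w0 * expR (- mu * t).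
  apply: (@apriori R E n hn v v' (w N) _ J dv (dw N) hJ _ (fun q => nm q w0)) => //.
    by move=> p t np t0; apply: galerkin_energy => //; exact: wS.
  by move=> q nq; rewrite w00 prj_contract.
(* The a priori bound, valid for the cut-off equation, lies below the cutoff radius; the equation
   solved is therefore the uncut one. *)
have cutE N t : 0 <= t -> cutoff n (Bn + 1) (w N t) = w N t.
  move=> t0; apply: cutoff_id => //; have [h _] := ap N t t0; apply: le_trans h _.
  by apply: le_trans (ler_wpM2l Bn0 (E1 t t0)) _; rewrite mulr1 lerDl.
pose f N t := Alin (w N t) +
  prj N (Pbil (v t) (w N t) + Pbil (w N t) (v t) + Pbil (w N t) (w N t)).
have {}dw N : hderiv (w N) (f N).
  by apply: eq_hderiv (dw N) => // t t0; rewrite /galerkin_field cutE.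
have bw : fam_bounded w.
  (* The a priori bounds concern norms from n on; lower ones are dominated by the norm q. *)
  move=> p; pose q := Num.max n p.
  have nq : n <= q by rewrite le_max lexx.
  have pq : p <= q by rewrite le_max lexx orbT.
  exists (expR (G q q * J q + K q q * J (q + 1) +
      G q n * (nm n w0 / rho) / (G n n * (1 - nm n w0 / rho))) * nm q w0).
    by rewrite mulr_ge0 ?expR_ge0 ?nm_ge0.
  move=> N t t0; apply: le_trans (nm_mono _ pq) _.
  have [_ h] := ap N t t0; apply: le_trans (h q nq) _.
  by rewrite ler_piMr ?E1 // mulr_ge0 ?expR_ge0 ?nm_ge0.
have bf : fam_bounded f.
  apply: fam_boundedD; first exact: fam_bounded_Alin.
  apply: fam_bounded_prj; apply: fam_boundedD; first apply: fam_boundedD;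
    exact: fam_bounded_Pbil.
have lw : fam_lipschitz w := fam_lipschitz_hderiv dw bf.
have lf : fam_lipschitz f.
  apply: fam_lipschitzD; first exact: fam_lipschitz_Alin.
  apply: fam_lipschitz_prj; apply: fam_lipschitzD; first apply: fam_lipschitzD;
    exact: fam_lipschitz_Pbil.
have [U [UU oU]] := ultrafilter_oo.
have [y hy] : exists y : R -> E, forall t : R, 0 <= t -> ucvg U (fun m => w m t) (y t).
  by apply: ultralimit => t p t0; have [C _ HC] := bw p; exists C => m; exact: HC.
exists y; split.
  apply: (ucvg_unique UU (hy 0 (lexx 0))); under eq_fun do rewrite w00.
  exact: (ucvg_prj_seq UU oU (ucvg_cst UU w0)).
(* What remains is that [f] converges to the full right-hand side, the projections disappearing in
   the limit. *)
apply: (fam_limit_hderiv UU dw lf hy) => t t0.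
have h := hy t t0; have hv := ucvg_cst UU (v t).
apply: ucvgD; first exact: ucvg_Alin.
apply: ucvg_prj_seq => //; apply: ucvgD; first apply: ucvgD; exact: ucvg_Pbil.
Qed.

End Galerkin.

(** * Smoothness and stability of solutions *)

Section Smoothness.
Variables (R : realType) (E : mhd_space R).

Definition vfield (x : E) : E := Alin x + Pbil x x.

(* Along a solution every time derivative is a polynomial expression in the
   solution; [dexpr] differentiates such expressions. *)
Inductive expr := EVar | EAlin of expr | EPbil of expr & expr | EAdd of expr & expr.

Fixpoint eval (u : R -> E) (e : expr) (t : R) : E :=
  match e with
  | EVar => u t
  | EAlin e1 => Alin (eval u e1 t)
  | EPbil e1 e2 => Pbil (eval u e1 t) (eval u e2 t)
  | EAdd e1 e2 => eval u e1 t + eval u e2 t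
  end.

Fixpoint dexpr (e : expr) : expr :=
  match e with
  | EVar => EAdd (EAlin EVar) (EPbil EVar EVar)
  | EAlin e1 => EAlin (dexpr e1)
  | EPbil e1 e2 => EAdd (EPbil (dexpr e1) e2) (EPbil e1 (dexpr e2))
  | EAdd e1 e2 => EAdd (dexpr e1) (dexpr e2)
  end.

Lemma solution_smooth (u : R -> E) : hderiv u (fun t => vfield (u t)) ->
  exists g : nat -> R -> E, g 0%N = u /\ forall j, hderiv (g j) (g j.+1).
Proof.
move=> du.
have H e : hderiv (eval u e) (eval u (dexpr e)).
  elim: e => [|e1 h1|e1 h1 e2 h2|e1 h1 e2 h2] //=.
  - exact: hderiv_Alin.
  - exact: hderiv_Pbil.
  - exact: hderivD.
by exists (fun j => eval u (iter j dexpr EVar)); split => // j; exact: H.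
Qed.

End Smoothness.

Section Stability.
Variables (R : realType) (E : mhd_space R) (n : R).
Local Notation mu := (dis E).
Local Notation G := (Gc E).
Local Notation K := (Kc E).
Hypothesis hn : crit E + 1 < n.
Variables (v : R -> E) (J : R -> R).
Hypothesis dv : hderiv v (fun t => vfield (v t)).
Hypothesis hJ : forall p,
  (int0oo (fun t => nm p (v (hl t))) <= (J p)%:E)%E.
Let rho := mu / G n n * expR (- G n n * J n - K n n * J (n + 1)).

Lemma perturbation_bounds (u : R -> E) :
  hderiv u (fun t => vfield (u t)) -> nm n (u 0 - v 0) < rho ->
  let delta q := nm q (u 0 - v 0) in forall t, 0 <= t ->
  nm n (u t - v t) <= expR (G n n * J n + K n n * J (n + 1))
    / (1 - delta n / rho) * delta n * expR (- mu * t) /\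
  forall p, n <= p -> nm p (u t - v t) <=
    expR (G p p * J p + K p p * J (p + 1) +
      G p n * (delta n / rho) / (G n n * (1 - delta n / rho)))
    * delta p * expR (- mu * t).
Proof.
move=> du small delta.
pose w t := u t - v t.
(* The trivial factor 1 puts the exact equation in the form of [energy_perturbation]. *)
pose w' t := Alin (w t) + (Pbil (v t) (w t) + Pbil (w t) (v t) + 1 *: Pbil (w t) (w t)).
have dw : hderiv w w'.
  have dN : hderiv (fun t => - v t) (fun t => - vfield (v t)).
    move=> t p e t0 e0; have [d d0 H] := dv p t0 e0; exists d => // s s0 sd.
    by rewrite scalerN -!opprD nmN; exact: H.
  apply: eq_hderiv (hderivD du dN) => // t t0.
  rewrite /w' /w /vfield !(AlinB, PbilBl, PbilBr); linear_identity.
apply: (@apriori R E n hn v _ w w' J dv dw hJ) => //.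
move=> p t np t0; rewrite /w' ipDl mulrDl; apply: lerD; first exact: Alin_dis.
by apply: energy_perturbation => //; rewrite ler01 lexx.
Qed.

Hypothesis bv : fam_bounded (fun _ : nat => v).

Lemma perturbed_solution_exists (u0 : E) : nm n (u0 - v 0) < rho ->
  exists u : R -> E, u 0 = u0 /\ hderiv u (fun t => vfield (u t)).
Proof.
move=> small.
(* The equation itself bounds the time derivative of v in every norm, as the Galerkin scheme
   requires. *)
have bv' : fam_bounded (fun _ : nat => fun t => vfield (v t)).
  by apply: fam_boundedD; [exact: fam_bounded_Alin|exact: fam_bounded_Pbil].
have [w [w0 dw]] := perturbation_exists hn dv bv bv' hJ small.
exists (fun t => w t + v t); split; first by rewrite w0 subrK.
apply: eq_hderiv (hderivD dw dv) => // t t0.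
rewrite /vfield !(AlinD, PbilDl, PbilDr); linear_identity.
Qed.

End Stability.

(** * Sums of summable families *)

Section RealSum.
Variables (R : realType) (I : choiceType) (D : set I).
Implicit Types (f g : I -> R) (s : seq I).

Definition rsummable f := (esum D (fun i => (`|f i|)%:E) < +oo)%E.

Lemma eq_rsum f g : (forall i, D i -> f i = g i) -> rsum D f = rsum D g.
Proof.
move=> fg; rewrite /rsum; congr (fine (_ - _)); apply: eq_esum => i Di.
  by rewrite !funeposE fg.
by rewrite !funenegE fg.
Qed.

Lemma rsum0 : rsum D (fun=> 0 : R) = 0.
Proof.
rewrite /rsum !esum1 ?sube0 // => i _; rewrite ?funeposE ?funenegE ?oppe0 //;
  exact/max_idPl.
Qed.

Lemma rsummable_le f g : (forall i, D i -> `|f i| <= `|g i|) -> rsummable g -> rsummable f.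
Proof. by move=> fg; apply: le_lt_trans; apply: le_esum => i /fg; rewrite lee_fin. Qed.

Lemma rsummable0 : rsummable (fun=> 0).
Proof. by rewrite /rsummable esum1 // => i _; rewrite normr0. Qed.

Lemma rsummableD f g : rsummable f -> rsummable g -> rsummable (fun i => f i + g i).
Proof.
move=> hf hg; have := lte_add_pinfty hf hg; rewrite -esumD //.
apply: le_lt_trans; apply: le_esum => i _.
by rewrite -EFinD lee_fin ler_normD.
Qed.

Lemma rsummableN f : rsummable f -> rsummable (fun i => - f i).
Proof. by apply: rsummable_le => i _; rewrite normrN. Qed.

Lemma rsummable_norm f : rsummable f -> rsummable (fun i => `|f i|).
Proof. by apply: rsummable_le => i _; rewrite normr_id. Qed.

Lemma rsum_ge0E f : (forall i, D i -> 0 <= f i) -> rsummable f ->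
  (rsum D f)%:E = esum D (fun i => (f i)%:E).
Proof.
move=> f0 sf; rewrite /rsum.
have -> : esum D ((fun i => (f i)%:E)^\+)%E = esum D (fun i => (f i)%:E).
  by apply: eq_esum => i /f0 fi; rewrite funeposE; apply/max_idPl; rewrite lee_fin.
have -> : esum D ((fun i => (f i)%:E)^\-)%E = 0%E.
  apply: esum1 => i /f0 fi; rewrite funenegE; apply/max_idPr.
  by rewrite -EFinN lee_fin oppr_le0.
rewrite sube0 fineK // ge0_fin_numE; last by apply: esum_ge0 => i /f0; rewrite lee_fin.
by apply: le_lt_trans sf; apply: le_esum => i _; rewrite lee_fin ler_norm.
Qed.

(** [esumB] speaks of the positive and negative parts of a difference, exactly the shape of [rsum];
    additivity of [rsum] rests on it. *)
Lemma rsumB_ge0 f g : (forall i, D i -> 0 <= f i) -> (forall i, D i -> 0 <= g i) ->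
  rsummable f -> rsummable g -> rsum D (fun i => f i - g i) = rsum D f - rsum D g.
Proof.
move=> f0 g0 sf sg; apply: EFin_inj; rewrite EFinB (rsum_ge0E f0 sf) (rsum_ge0E g0 sg).
have h := @esumB _ _ D (fun i => (f i)%:E) (fun i => (g i)%:E) sf sg.
have h1 : forall i, D i -> (0 <= (f i)%:E)%E by move=> i /f0; rewrite lee_fin.
have h2 : forall i, D i -> (0 <= (g i)%:E)%E by move=> i /g0; rewrite lee_fin.
rewrite -(h h1 h2) /rsum fineK //.
by rewrite [X in X \is a fin_num](h h1 h2) -(rsum_ge0E f0 sf) -(rsum_ge0E g0 sg).
Qed.

Lemma rsumD_ge0 f g : (forall i, D i -> 0 <= f i) -> (forall i, D i -> 0 <= g i) ->
  rsummable f -> rsummable g -> rsum D (fun i => f i + g i) = rsum D f + rsum D g.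
Proof.
move=> f0 g0 sf sg; apply: EFin_inj; rewrite EFinD !rsum_ge0E //; last 2 first.
- by move=> i Di; rewrite addr_ge0 ?f0 ?g0.
- exact: rsummableD.
by rewrite -esumD // => i ?; rewrite lee_fin ?f0 ?g0.
Qed.

Let pos f i := Num.max (f i) 0.
Let neg f i := Num.max (- f i) 0.

Let pos_ge0 f i : 0 <= pos f i. Proof. by rewrite le_max lexx orbT. Qed.
Let neg_ge0 f i : 0 <= neg f i. Proof. by rewrite le_max lexx orbT. Qed.

Let posneg f i : f i = pos f i - neg f i.
Proof.
rewrite /pos /neg !maxEle; do 2 case: ifPn; rewrite -?ltNge => *; lra.
Qed.

Let pos_summable f : rsummable f -> rsummable (pos f).
Proof.
apply: rsummable_le => i _; rewrite ger0_norm ?pos_ge0 // ge_max ler_norm normr_ge0 //.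
Qed.

Let neg_summable f : rsummable f -> rsummable (neg f).
Proof.
apply: rsummable_le => i _; rewrite ger0_norm ?neg_ge0 // ge_max normr_ge0 andbT.
by rewrite -normrN ler_norm.
Qed.

Let rsum_posneg f : rsummable f -> rsum D f = rsum D (pos f) - rsum D (neg f).
Proof.
move=> sf; rewrite -rsumB_ge0 //; [|exact: pos_summable|exact: neg_summable].
by apply: eq_rsum => i _; exact: posneg.
Qed.

(** The positive part of f + g is not the sum of the positive parts, but f + g is still a difference
    of two nonnegative summable families, to which [rsumB_ge0] applies. *)
Lemma rsumD f g : rsummable f -> rsummable g ->
  rsum D (fun i => f i + g i) = rsum D f + rsum D g.
Proof.
move=> sf sg.
have [pf nf pg ng] := And4 (pos_summable sf) (neg_summable sf) (pos_summable sg) (neg_summable sg).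
rewrite (rsum_posneg sf) (rsum_posneg sg) addrACA -opprD -!rsumD_ge0 //.
rewrite -rsumB_ge0; first last.
- exact: rsummableD.
- exact: rsummableD.
- by move=> i _; exact: addr_ge0.
- by move=> i _; exact: addr_ge0.
by apply: eq_rsum => i _; rewrite (posneg f) (posneg g); ring.
Qed.

Lemma rsumN f : rsummable f -> rsum D (fun i => - f i) = - rsum D f.
Proof.
move=> sf; apply: (addrI (rsum D f)); rewrite subrr -rsumD //; last exact: rsummableN.
by rewrite -[RHS]rsum0; apply: eq_rsum => i _; rewrite subrr.
Qed.

Lemma rsumB f g : rsummable f -> rsummable g ->
  rsum D (fun i => f i - g i) = rsum D f - rsum D g.
Proof. by move=> sf sg; rewrite rsumD ?rsumN //; exact: rsummableN. Qed.

Lemma ler_seq_rsum f s : (forall i, D i -> 0 <= f i) -> rsummable f ->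
  uniq s -> {subset s <= D} -> \sum_(i <- s) f i <= rsum D f.
Proof.
move=> f0 sf us sD; rewrite -lee_fin rsum_ge0E //; apply: esum_ge.
exists [set` s]; first by split; [exact: finite_seq|move=> i /sD; rewrite inE].
by rewrite -fsbig_seq // sumEFin.
Qed.

Lemma rsummable_seq f C : (forall s, uniq s -> {subset s <= D} ->
  \sum_(i <- s) `|f i| <= C) -> rsummable f.
Proof.
move=> h; apply: (@le_lt_trans _ _ C%:E); last exact: ltry.
apply: ge_ereal_sup => _ [X [finX XD] <-].
rewrite fsbig_finite //= sumEFin lee_fin; apply: h; first exact: finmap.fset_uniq.
by move=> i; rewrite in_fset_set // inE => /XD; rewrite inE.
Qed.

(** Bounded finite sums give summability as well, so [fine] is applied to a finite value and the
    supremum can be compared with C. *)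
Lemma rsum_le_seq f C : (forall i, D i -> 0 <= f i) ->
  (forall s, uniq s -> {subset s <= D} -> \sum_(i <- s) f i <= C) ->
  rsum D f <= C.
Proof.
move=> f0 h.
have sf : rsummable f.
  apply: (@rsummable_seq f C) => s us sD; rewrite (eq_big_seq f) ?h // => i /sD.
  by rewrite inE => /f0 fi; rewrite ger0_norm.
rewrite -lee_fin rsum_ge0E //; apply: ge_ereal_sup => _ [X [finX XD] <-].
rewrite fsbig_finite //= sumEFin lee_fin; apply: h; first exact: finmap.fset_uniq.
by move=> i; rewrite in_fset_set // inE => /XD; rewrite inE.
Qed.

Lemma rsum_ge0 f : (forall i, D i -> 0 <= f i) -> 0 <= rsum D f.
Proof.
move=> f0; rewrite /rsum fine_ge0 //.
have -> : esum D ((fun i => (f i)%:E)^\-)%E = 0%E.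
  apply: esum1 => i /f0 fi; rewrite funenegE; apply/max_idPr.
  by rewrite -EFinN lee_fin oppr_le0.
by rewrite sube0; apply: esum_ge0 => i _; exact: funepos_ge0.
Qed.

Lemma ler_rsum f g : (forall i, D i -> f i <= g i) -> rsummable f -> rsummable g ->
  rsum D f <= rsum D g.
Proof.
move=> fg sf sg; rewrite -subr_ge0 -rsumB //; apply: rsum_ge0 => i /fg.
by rewrite subr_ge0.
Qed.

Lemma ler_norm_rsum f : rsummable f -> `|rsum D f| <= rsum D (fun i => `|f i|).
Proof.
move=> sf; have nf := rsummable_norm sf; rewrite ler_norml; apply/andP; split.
  rewrite -rsumN //; apply: ler_rsum => //; last exact: rsummableN.
  by move=> i _; rewrite lerNl -normrN ler_norm.
by apply: ler_rsum => // i _; exact: ler_norm.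
Qed.

Lemma rsummableZ c f : rsummable f -> rsummable (fun i => c * f i).
Proof.
move=> sf; apply: (@rsummable_seq _ (`|c| * rsum D (fun i => `|f i|))) => s us sD.
under eq_bigr do rewrite normrM; rewrite -mulr_sumr ler_wpM2l //.
by apply: ler_seq_rsum => //; exact: rsummable_norm.
Qed.

(** For c > 0 the inequality <= follows from finite sums; applied to c^-1 and the family c f it
    gives the converse. *)
Let rsumZ_ge0 c f : 0 <= c -> (forall i, D i -> 0 <= f i) -> rsummable f ->
  rsum D (fun i => c * f i) = c * rsum D f.
Proof.
rewrite le_eqVlt => /predU1P[<- f0 sf|c0 f0 sf].
  by rewrite mul0r -[RHS]rsum0; apply: eq_rsum => i _; rewrite mul0r.
have le k g : 0 < k -> (forall i, D i -> 0 <= g i) -> rsummable g ->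
    rsum D (fun i => k * g i) <= k * rsum D g.
  move=> k0 g0 sg; apply: rsum_le_seq => [i /g0|s us sD]; first exact/mulr_ge0/ltW.
  by rewrite -mulr_sumr ler_pM2l //; exact: ler_seq_rsum.
apply/le_anti/andP; split; first exact: le.
have := le c^-1 (fun i => c * f i); rewrite invr_gt0 c0 => /(_ isT).
rewrite -ler_pdivlMl // => h; apply: le_trans (h _ _); last 2 first.
- by move=> i /f0; exact/mulr_ge0/ltW.
- exact: rsummableZ.
rewrite le_eqVlt; apply/orP; left; apply/eqP; apply: eq_rsum => i _.
by rewrite mulKf // gt_eqF.
Qed.

Lemma rsumZ c f : rsummable f -> rsum D (fun i => c * f i) = c * rsum D f.
Proof.
move=> sf.
have H k : 0 <= k -> rsum D (fun i => k * f i) = k * rsum D f.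
  move=> k0; rewrite (rsum_posneg sf) mulrBr -!rsumZ_ge0 //;
    [|exact: neg_summable|exact: pos_summable].
  rewrite -rsumB; [|exact/rsummableZ/pos_summable|exact/rsummableZ/neg_summable].
  by apply: eq_rsum => i _; rewrite -mulrBr -posneg.
have [c0|c0] := leP 0 c; first exact: H.
have := H (- c); rewrite oppr_ge0 (ltW c0) => /(_ isT).
under eq_rsum do rewrite mulNr; rewrite rsumN ?mulNr; last exact: rsummableZ.
by move/oppr_inj.
Qed.

Lemma rsum_eq0 f : (forall i, D i -> 0 <= f i) -> rsummable f -> rsum D f = 0 ->
  forall i, D i -> f i = 0.
Proof.
move=> f0 sf s0 i Di; apply/le_anti; rewrite f0 // andbT -s0.
have := @ler_seq_rsum f [:: i] f0 sf isT; rewrite big_seq1; apply.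
by move=> j; rewrite inE => /eqP ->; rewrite inE.
Qed.

End RealSum.

Import ComplexField.Normc.
Local Open Scope complex_scope.

(** * Fourier coefficients *)

Section Fields.
Variables (R : realType) (d : nat).
Implicit Types (k h : lattice d) (a b c : 'rV[R[i]]_d) (p q : R) (v w : vcoef R d).

(** The Euclidean inner product of R^(2d), which is what the Hermitian product becomes after [inner]
    takes real parts. *)
Definition rdot a b : R := complex.Re (dotc (conjv a) b).

Lemma rdotE a b : rdot a b = \sum_(r < d)
  (complex.Re (a 0 r) * complex.Re (b 0 r) + complex.Im (a 0 r) * complex.Im (b 0 r)).
Proof.
rewrite /rdot /dotc (raddf_sum (@complex.Re R)); apply: eq_bigr => r _.
rewrite !mxE; case: (a 0 r) => x y; case: (b 0 r) => z t /=; ring.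
Qed.

Lemma rdotC a b : rdot a b = rdot b a.
Proof. by rewrite !rdotE; apply: eq_bigr => r _; ring. Qed.

Lemma rdotDl a b c : rdot (a + b) c = rdot a c + rdot b c.
Proof.
rewrite !rdotE -big_split; apply: eq_bigr => r _; rewrite !mxE.
case: (a 0 r) => x y; case: (b 0 r) => z t /=; ring.
Qed.

Lemma rdotZl (l : R) a b : rdot (l%:C *: a) b = l * rdot a b.
Proof.
rewrite !rdotE mulr_sumr; apply: eq_bigr => r _; rewrite !mxE.
case: (a 0 r) => x y /=; ring.
Qed.

Lemma rdot0l a : rdot 0 a = 0.
Proof. by rewrite rdotE big1 // => r _; rewrite !mxE /=; ring. Qed.

Lemma sqnormE a : sqnormv a = rdot a a.
Proof.
rewrite rdotE; apply: eq_bigr => r _; case: (a 0 r) => x y /=.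
by rewrite sqr_sqrtr ?addr_ge0 ?sqr_ge0 // !expr2.
Qed.

Lemma rdot_ge0 a : 0 <= rdot a a.
Proof.
by rewrite rdotE; apply: sumr_ge0 => r _; rewrite -!expr2 addr_ge0 ?sqr_ge0.
Qed.

Lemma rdot_eq0 a : rdot a a = 0 -> a = 0.
Proof.
rewrite rdotE => /eqP; rewrite psumr_eq0; last first.
  by move=> r _; rewrite -!expr2 addr_ge0 ?sqr_ge0.
move=> /allP h; apply/rowP => r; rewrite mxE.
have := h r; rewrite mem_index_enum => /(_ isT); rewrite -!expr2.
rewrite paddr_eq0 ?sqr_ge0 // !sqrf_eq0.
by case: (a 0 r) => x y /= /andP[/eqP -> /eqP ->].
Qed.

Lemma rdot_bound a b : `|rdot a b| <= rdot a a + rdot b b.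
Proof.
have h1 := rdot_ge0 (a + b); have h2 := rdot_ge0 (a + (-1)%:C *: b).
move: h1 h2; rewrite !rdotDl ![rdot _ (_ + _)]rdotC !rdotDl !rdotZl.
rewrite ![rdot _ (_ *: _)]rdotC !rdotZl (rdotC b a).
have := rdot_ge0 a; have := rdot_ge0 b.
move=> *; rewrite ler_norml; apply/andP; split; lra.
Qed.

Lemma latnorm0 : latnorm R (0 : lattice d) = 0.
Proof. by rewrite /latnorm big1 ?sqrtr0 // => r _; rewrite mxE expr0n. Qed.

Lemma latnormN k : latnorm R (- k) = latnorm R k.
Proof.
rewrite /latnorm; congr Num.sqrt; apply: eq_bigr => r _.
by rewrite mxE intrN sqrrN.
Qed.

Lemma latnorm_ge0 k : 0 <= latnorm R k. Proof. exact: sqrtr_ge0. Qed.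

Lemma sqr_latnorm k : latnorm R k ^+ 2 = \sum_(r < d) (k 0 r)%:~R ^+ 2.
Proof. by rewrite sqr_sqrtr // sumr_ge0 // => r _; exact: sqr_ge0. Qed.

Lemma ler_coord_latnorm k r : `|(k 0 r)%:~R| <= latnorm R k.
Proof.
rewrite -(@ler_pXn2r _ 2) ?nnegrE ?latnorm_ge0 // sqr_latnorm real_normK ?num_real //.
by rewrite (bigD1 r) //= lerDl sumr_ge0 // => i _; exact: sqr_ge0.
Qed.

Lemma latnorm_ge1 k : k != 0 -> 1 <= latnorm R k.
Proof.
move=> k0; have [r kr] : exists r, k 0 r != 0.
  apply/existsP; apply: contraNT k0; rewrite negb_exists => /forallP h.
  by apply/eqP/rowP => r; rewrite mxE; apply/eqP; rewrite -[_ == _]negbK h.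
apply: le_trans (ler_coord_latnorm k r).
by rewrite -intr_norm -[1]/(1%:~R) ler_int -gtz0_ge1 normr_gt0.
Qed.

Definition wt p k : R := latnorm R k `^ (2 * p).

Lemma wt_ge0 p k : 0 <= wt p k. Proof. exact: powR_ge0. Qed.

Lemma wt_gt0 p k : k != 0 -> 0 < wt p k.
Proof. by move=> k0; apply/powR_gt0/(lt_le_trans ltr01)/latnorm_ge1. Qed.

Lemma wt_mono p q k : p <= q -> k != 0 -> wt p k <= wt q k.
Proof. by move=> pq k0; apply: ler_powR; rewrite ?latnorm_ge1 // ler_pM2l. Qed.

Lemma wtD1 p k : k != 0 -> wt (p + 1) k = wt p k * latnorm R k ^+ 2.
Proof.
move=> k0; rewrite /wt mulrDr mulr1 powRD ?powR_mulrn ?latnorm_ge0 //.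
by rewrite (gt_eqF (lt_le_trans ltr01 (latnorm_ge1 k0))) implybT.
Qed.

Lemma wt0 k : wt 0 k = 1. Proof. by rewrite /wt mulr0 powRr0. Qed.

Definition fsum (f : lattice d -> R) : R := rsum [set~ 0] f.
Definition fsummable (f : lattice d -> R) := rsummable [set~ 0] f.

Lemma inner_fsum p v w : inner p v w = fsum (fun k => wt p k * rdot (v k) (w k)).
Proof.
rewrite /inner /csum /=; apply: eq_rsum => k _; rewrite /rdot /wt.
case: (dotc _ _) => x y /=; ring.
Qed.

Definition energy_summable p v := fsummable (fun k => wt p k * rdot (v k) (v k)).

Definition hfield v := [/\ forall k, v k = conjv (v (- k)),
  forall k, dotc (latc R k) (v k) = 0, v 0 = 0 & forall p, energy_summable p v].

Lemma neq0_setC (k : lattice d) : [set~ 0] k -> k != 0.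
Proof. by move=> /= /eqP. Qed.

Lemma fsum_sqnorm p v : energy_summable p v ->
  (fsum (fun k => wt p k * rdot (v k) (v k)))%:E =
  (\esum_(k in [set~ 0%R]) (latnorm R k `^ (2 * p) * sqnormv (v k))%:E)%E.
Proof.
move=> s; rewrite /fsum rsum_ge0E //; first by apply: eq_esum => k _; rewrite sqnormE.
by move=> k _; rewrite mulr_ge0 ?wt_ge0 ?rdot_ge0.
Qed.

Lemma normc_le_rdot a r : normc (a 0 r) ^+ 2 <= rdot a a.
Proof.
rewrite -sqnormE /sqnormv (bigD1 r) //= lerDl sumr_ge0 // => i _; exact: sqr_ge0.
Qed.

Lemma rdot_le_energy p v k : energy_summable p v -> k != 0 ->
  wt p k * rdot (v k) (v k) <= fsum (fun k => wt p k * rdot (v k) (v k)).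
Proof.
move=> s k0.
have := @ler_seq_rsum _ _ [set~ 0] (fun k => wt p k * rdot (v k) (v k)) [:: k].
rewrite big_seq1; apply => //; last by move=> j; rewrite !inE => /eqP ->; apply/eqP.
by move=> j _; rewrite mulr_ge0 ?wt_ge0 ?rdot_ge0.
Qed.

Lemma hfield_bounded v : v 0 = 0 -> energy_summable 0 v ->
  forall k, rdot (v k) (v k) <= fsum (fun k => wt 0 k * rdot (v k) (v k)).
Proof.
move=> v0 s k; have [->|k0] := eqVneq k 0.
  rewrite v0 rdot0l; apply: rsum_ge0 => j _.
  by rewrite mulr_ge0 ?wt_ge0 ?rdot_ge0.
by apply: le_trans (rdot_le_energy s k0); rewrite wt0 mul1r.
Qed.

(** Polynomial growth is recovered with exponent 0: finite energy in H^0 bounds all coefficients by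
    its square root. *)
Lemma hfieldP v : Hinf v <-> hfield v.
Proof.
split=> [h|[h1 h2 h3 h4] p].
  have [[h1 _] h2 h3 _] := h 0; split => // p; have [_ _ _ h4] := h p.
  apply: le_lt_trans h4; apply: le_esum => k _; rewrite lee_fin sqnormE.
  by rewrite ger0_norm // mulr_ge0 ?wt_ge0 ?rdot_ge0.
split => //; last by rewrite -fsum_sqnorm // ltry.
split => //; pose M := fsum (fun k => wt 0 k * rdot (v k) (v k)).
exists (Num.sqrt M), 0%N => k r; rewrite expr0 mulr1.
rewrite -[normc _]ger0_norm; last by case: (v k 0 r) => *; exact: sqrtr_ge0.
rewrite -sqrtr_sqr; apply: ler_wsqrtr; apply: le_trans (normc_le_rdot _ _) _.
exact: hfield_bounded.
Qed.

Lemma cross_summable p v w : energy_summable p v -> energy_summable p w ->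
  fsummable (fun k => wt p k * rdot (v k) (w k)).
Proof.
move=> sv sw; have := rsummableD sv sw; apply: rsummable_le => k _.
rewrite -mulrDr !normrM [`|wt _ _|]ger0_norm ?wt_ge0 // ler_wpM2l ?wt_ge0 //.
by rewrite [leRHS]ger0_norm ?rdot_bound // addr_ge0 ?rdot_ge0.
Qed.

Lemma energy_summable_le p v w : (forall k, rdot (w k) (w k) <= rdot (v k) (v k)) ->
  energy_summable p v -> energy_summable p w.
Proof.
move=> h; apply: rsummable_le => k _.
rewrite !ger0_norm ?mulr_ge0 ?wt_ge0 ?rdot_ge0 //.
by rewrite ler_wpM2l ?wt_ge0.
Qed.

Lemma energy_summableD p v w : energy_summable p v -> energy_summable p w ->
  energy_summable p (v + w).
Proof.
(* [rdot_bound] has no factor 1/2, so |a + b|^2 is bounded by 3 (|a|^2 + |b|^2). *)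
move=> sv sw; have := rsummableZ 3 (rsummableD sv sw); apply: rsummable_le => k _.
rewrite !ger0_norm ?mulr_ge0 ?addr_ge0 ?mulr_ge0 ?wt_ge0 ?rdot_ge0 //.
have := rdot_bound (v k) (w k); have := ler_norm (rdot (v k) (w k)).
rewrite rdotDl ![rdot _ (_ + _)]rdotC !rdotDl (rdotC (w k) (v k)) => h1 h2.
rewrite -mulrDr mulrCA ler_wpM2l ?wt_ge0 //; lra.
Qed.

Lemma energy_summableZ p (l : R) v : energy_summable p v ->
  energy_summable p (l%:C *: v).
Proof.
move=> /(rsummableZ (l ^+ 2)); apply: rsummable_le => k _.
rewrite rdotZl rdotC rdotZl.
by rewrite mulrCA (mulrCA (wt _ _)) mulrA -expr2.
Qed.

Lemma conjvD a b : conjv (a + b) = conjv a + conjv b.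
Proof. by apply/rowP => r; rewrite !mxE rmorphD. Qed.

Lemma conjvZ (l : R) a : conjv (l%:C *: a) = l%:C *: conjv a.
Proof.
apply/rowP => r; rewrite !mxE; case: (a 0 r) => x y; apply/eqP.
by rewrite eq_complex /=; apply/andP; split; apply/eqP; ring.
Qed.

Lemma dotcDr a b c : dotc c (a + b) = dotc c a + dotc c b.
Proof. by rewrite /dotc -big_split; apply: eq_bigr => r _; rewrite mxE mulrDr. Qed.

Lemma dotcZr (l : R[i]) a c : dotc c (l *: a) = l * dotc c a.
Proof. by rewrite /dotc mulr_sumr; apply: eq_bigr => r _; rewrite mxE mulrCA. Qed.

Lemma hfieldD v w : hfield v -> hfield w -> hfield (v + w).
Proof.
move=> [v1 v2 v3 v4] [w1 w2 w3 w4]; split.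
- by move=> k; rewrite [LHS]/GRing.add /= [in LHS]v1 [in LHS]w1 -conjvD.
- by move=> k; rewrite [(v + w) k]/GRing.add /= dotcDr v2 w2 addr0.
- by rewrite [LHS]/GRing.add /= v3 w3 addr0.
- by move=> p; exact: energy_summableD.
Qed.

Lemma hfieldZ (l : R) v : hfield v -> hfield (l%:C *: v).
Proof.
move=> [v1 v2 v3 v4]; split.
- by move=> k; rewrite [LHS]/GRing.scale /= [in LHS]v1 -conjvZ.
- by move=> k; rewrite [(_ *: v) k]/GRing.scale /= dotcZr v2 mulr0.
- by rewrite [LHS]/GRing.scale /= v3 scaler0.
- by move=> p; exact: energy_summableZ.
Qed.

Lemma scaleN1C v : (-1)%:C *: v = - v.
Proof. by rewrite rmorphN1 scaleN1r. Qed.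

Lemma hfieldN v : hfield v -> hfield (- v).
Proof. by rewrite -scaleN1C; exact: hfieldZ. Qed.

Lemma hfield0 : hfield 0.
Proof.
split => [k|k||p] //.
- by apply/rowP => r; rewrite !mxE conjc0.
- by rewrite /dotc big1 // => r _; rewrite !mxE mulr0.
- apply: (rsummable_le _ (@rsummable0 R _ [set~ 0])) => k _.
  by rewrite rdot0l mulr0 normr0.
Qed.

End Fields.

(** In a compact interval the image ultrafilter has a cluster point, and an ultrafilter converges to
    each of its cluster points. *)
Lemma bounded_ultra (R : realType) (U : set_system nat) (UU : UltraFilter U)
    (u : nat -> R) (C : R) : (forall m, `|u m| <= C) -> exists l : R, u @ U --> l.
Proof.
move=> uC.
have [l [_ cl]] : [set` `[- C, C]] `&` cluster (u @ U) !=set0.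
  apply: (@segment_compact R (- C) C); rewrite /fmap /=.
  by apply: filterS filterT => m _; rewrite /= in_itv /= -ler_norml.
exists l => B Bl; have [//|h] := in_ultra_setVsetC (u @^-1` B) UU.
by have [z [] /=] := cl (~` B) B h Bl.
Qed.

Lemma sum_restrict (R : realType) (I : eqType) (s t : seq I) (f : I -> R) :
  uniq s -> uniq t -> (forall k, 0 <= f k) ->
  (forall k, k \in s -> k \notin t -> f k = 0) ->
  \sum_(k <- s) f k <= \sum_(k <- t) f k.
Proof.
move=> us ut f0 fs0.
have e0 : \sum_(k <- s | ~~ mem t k) f k = 0.
  by rewrite big_seq_cond big1 // => k /andP[ks kt]; exact: fs0.
rewrite (bigID (mem t)) /= e0 addr0.
rewrite [leRHS](bigID (mem s)) /= -big_filter -[X in _ <= X + _]big_filter.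
rewrite (perm_big [seq i <- t | i \in s]); last first.
  apply: uniq_perm; rewrite ?filter_uniq // => k.
  by rewrite !mem_filter andbC.
by rewrite lerDl; apply: sumr_ge0.
Qed.

Section Lattice.
Variables (R : realType) (d : nat).
Implicit Types k : lattice d.

Lemma lattice_ball_finite (M : R) : exists s : seq (lattice d),
  uniq s /\ forall k, latnorm R k <= M -> k \in s.
Proof.
pose B := Num.truncn M.
(* Coordinates in [-B, B] are encoded by the ordinals 0, ..., 2B through a shift by B. *)
pose row (f : {ffun 'I_d -> 'I_(B + B).+1}) : lattice d :=
  \row_r ((f r : nat)%:Z - B%:Z).
exists (undup [seq row f | f : {ffun 'I_d -> 'I_(B + B).+1}]).
split; first exact: undup_uniq.
move=> k kM; rewrite mem_undup.
have kB r : `|k 0 r| <= B%:Z.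
  have h : `|(k 0 r)%:~R| <= M := le_trans (ler_coord_latnorm R k r) kM.
  have M0 : 0 <= M := le_trans (normr_ge0 _) h.
  move: h; rewrite -intr_norm -[`|k 0 r|]gez0_abs // => h.
  by rewrite lez_nat truncn_ge_nat.
pose f : {ffun 'I_d -> 'I_(B + B).+1} := [ffun r => inord (absz (k 0 r + B%:Z))].
apply/mapP; exists f; first by rewrite mem_enum.
apply/rowP => r; rewrite mxE ffunE.
have := kB r; rewrite ler_norml => /andP[k1 k2].
have k0 : 0 <= k 0 r + B%:Z by rewrite -lerBlDr sub0r.
rewrite inordK.
  by rewrite gez0_abs // addrK.
by rewrite ltnS -lez_nat gez0_abs // PoszD lerD2r.
Qed.

(** The list may be strictly larger than the ball: it only serves to dominate sums and to contain
    supports. *)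
Definition lball N : seq (lattice d) := sval (cid (lattice_ball_finite N.+1%:R)).

Lemma lball_uniq N : uniq (lball N).
Proof. by rewrite /lball; case: cid => s /= []. Qed.

Lemma mem_lball N k : latnorm R k <= N.+1%:R -> k \in lball N.
Proof. by rewrite /lball; case: cid => s /= [_]; apply. Qed.

End Lattice.

(** * The Laplacian and truncation as Fourier multipliers *)

Section FieldOperators.
Variables (R : realType) (d : nat).
Implicit Types (k : lattice d) (p q : R) (v w : vcoef R d) (N : nat).

Lemma inner_linl p (l : R) v v' w : energy_summable p v -> energy_summable p v' ->
  energy_summable p w ->
  inner p (l%:C *: v + v') w = l * inner p v w + inner p v' w.
Proof.
move=> sv sv' sw; have c1 := cross_summable sv sw; have c2 := cross_summable sv' sw.
rewrite !inner_fsum /fsum -rsumZ // -rsumD //; last exact: rsummableZ.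
by apply: eq_rsum => k _; rewrite rdotDl rdotZl; ring.
Qed.

Lemma inner_sym p v w : inner p v w = inner p w v.
Proof. by rewrite !inner_fsum; apply: eq_rsum => k _; rewrite rdotC. Qed.

Lemma inner_ge0 p v : 0 <= inner p v v.
Proof.
by rewrite inner_fsum; apply: rsum_ge0 => k _; rewrite mulr_ge0 ?wt_ge0 ?rdot_ge0.
Qed.

Lemma inner_eq0 p v : v 0 = 0 -> energy_summable p v -> inner p v v = 0 -> v = 0.
Proof.
move=> v0 sv; rewrite inner_fsum => s0; apply/funext => k.
have [->|k0] := eqVneq k 0; first by rewrite v0.
have h : wt p k * rdot (v k) (v k) = 0.
  apply: (@rsum_eq0 _ _ [set~ 0] (fun k => wt p k * rdot (v k) (v k)) _ sv s0 k).
    by move=> j _; rewrite mulr_ge0 ?wt_ge0 ?rdot_ge0.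
  exact/eqP.
by apply/rdot_eq0/eqP; move/eqP: h; rewrite mulf_eq0 gt_eqF ?wt_gt0.
Qed.

Lemma inner_mono p q v : p <= q -> energy_summable p v -> energy_summable q v ->
  inner p v v <= inner q v v.
Proof.
move=> pq sp sq; rewrite !inner_fsum; apply: ler_rsum => // k /neq0_setC k0.
by rewrite ler_wpM2r ?rdot_ge0 // wt_mono.
Qed.

Lemma laplacianE v k : laplacian v k = (- latnorm R k ^+ 2)%:C *: v k.
Proof.
rewrite /laplacian fct_sumE; apply/rowP => r; rewrite summxE mxE.
under eq_bigr => s _ do rewrite /deriv_dir !mxE mulrA.
rewrite -mulr_suml; congr (_ * _).
rewrite sqr_latnorm -sumrN rmorph_sum /=; apply: eq_bigr => s _.
rewrite (_ : (k 0 s)%:~R = ((k 0 s)%:~R : R)%:C); last by rewrite rmorph_int.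
by apply/eqP; rewrite eq_complex /=; apply/andP; split; apply/eqP; ring.
Qed.

Lemma dotc_latN k (a : 'rV[R[i]]_d) : dotc (latc R (- k)) a = - dotc (latc R k) a.
Proof.
by rewrite /dotc -sumrN; apply: eq_bigr => r _; rewrite !mxE intrN mulNr.
Qed.

Lemma rdot_laplacian v w k :
  rdot (laplacian v k) (w k) = - latnorm R k ^+ 2 * rdot (v k) (w k).
Proof. by rewrite laplacianE rdotZl. Qed.

Lemma wtD2 p k : k != 0 -> wt (p + 2) k = wt p k * latnorm R k ^+ 2 * latnorm R k ^+ 2.
Proof. by move=> k0; rewrite (_ : p + 2 = p + 1 + 1) ?wtD1 //; ring. Qed.

Lemma laplacian_summable p v : energy_summable (p + 2) v ->
  energy_summable p (laplacian v).
Proof.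
apply: rsummable_le => k /neq0_setC k0.
suff -> : wt p k * rdot (laplacian v k) (laplacian v k) = wt (p + 2) k * rdot (v k) (v k) by [].
by rewrite rdot_laplacian rdotC rdot_laplacian wtD2 //; ring.
Qed.

Lemma hfield_laplacian v : hfield v -> hfield (laplacian v).
Proof.
move=> [v1 v2 v3 v4]; split.
- by move=> k; rewrite !laplacianE latnormN [in LHS]v1 conjvZ.
- by move=> k; rewrite laplacianE dotcZr v2 mulr0.
- by rewrite laplacianE v3 scaler0.
- by move=> p; exact: laplacian_summable.
Qed.

Lemma inner_laplacian p v : energy_summable (p + 1) v ->
  inner p (laplacian v) v = - inner (p + 1) v v.
Proof.
move=> s; rewrite !inner_fsum /fsum -rsumN //; apply: eq_rsum => k /neq0_setC k0.
by rewrite rdot_laplacian wtD1 //; ring.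
Qed.

Lemma inner_laplacian2 p v : inner p (laplacian v) (laplacian v) = inner (p + 2) v v.
Proof.
rewrite !inner_fsum; apply: eq_rsum => k /neq0_setC k0.
by rewrite rdot_laplacian rdotC rdot_laplacian wtD2 //; ring.
Qed.

Lemma laplacian_lin (l : R) v w :
  laplacian (l%:C *: v + w) = l%:C *: laplacian v + laplacian w.
Proof.
apply/funext => k; rewrite [RHS]/GRing.add /= [(l%:C *: laplacian v) k]/GRing.scale /=.
rewrite !laplacianE [(_ + w) k]/GRing.add /= [(_ *: v) k]/GRing.scale /=.
by rewrite scalerDr !scalerA mulrC.
Qed.

Definition trunc N v : vcoef R d := fun k => if latnorm R k <= N.+1%:R then v k else 0.

Lemma rdot_trunc N v k : rdot (trunc N v k) (trunc N v k) <= rdot (v k) (v k).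
Proof. by rewrite /trunc; case: ifP => // _; rewrite rdot0l rdot_ge0. Qed.

Lemma hfield_trunc N v : hfield v -> hfield (trunc N v).
Proof.
move=> [v1 v2 v3 v4]; split.
- move=> k; rewrite /trunc latnormN; case: ifP => // _.
  by apply/rowP => r; rewrite !mxE conjc0.
- move=> k; rewrite /trunc; case: ifP => // _.
  by rewrite /dotc big1 // => r _; rewrite !mxE mulr0.
- by rewrite /trunc; case: ifP.
- move=> p; apply: energy_summable_le (v4 p) => k; exact: rdot_trunc.
Qed.

Lemma trunc_lin N (l : R) v w : trunc N (l%:C *: v + w) = l%:C *: trunc N v + trunc N w.
Proof.
apply/funext => k; rewrite [RHS]/GRing.add /= [(_ *: _) k]/GRing.scale /= /trunc.
by case: ifP => // _; rewrite scaler0 addr0.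
Qed.

Lemma trunc_idem N v : trunc N (trunc N v) = trunc N v.
Proof. by apply/funext => k; rewrite /trunc; case: (latnorm R k <= _). Qed.

Lemma inner_trunc N p v w : inner p (trunc N v) w = inner p v (trunc N w).
Proof.
rewrite !inner_fsum; apply: eq_rsum => k _; rewrite /trunc; case: ifP => // _.
by rewrite rdot0l rdotC rdot0l.
Qed.

Lemma trunc_laplacian N v : trunc N (laplacian v) = laplacian (trunc N v).
Proof.
apply/funext => k; rewrite laplacianE /trunc laplacianE.
by case: ifP => // _; rewrite scaler0.
Qed.

(** On the retained nonzero modes 1 <= |k| <= N + 1, so the ratio of the weights, |k|^(2 (q - p)),
    is at most (N + 1)^(2 |q - p|). *)
Lemma trunc_bernstein N p q : exists2 C, 0 <= C & forall v, energy_summable p v ->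
  energy_summable q v -> inner q (trunc N v) (trunc N v) <= C * inner p v v.
Proof.
pose C : R := N.+1%:R `^ (2 * `|q - p|).
exists C; first exact: powR_ge0.
move=> v sp sq; rewrite !inner_fsum /fsum -rsumZ //; apply: ler_rsum; last 2 first.
- by apply: energy_summable_le sq; exact: rdot_trunc.
- exact: rsummableZ.
move=> k /neq0_setC k0; rewrite /trunc; case: ifPn => kN; last first.
  by rewrite rdot0l mulr0 !mulr_ge0 ?powR_ge0 ?wt_ge0 ?rdot_ge0.
rewrite mulrA ler_wpM2r ?rdot_ge0 //.
have k1 := latnorm_ge1 R k0.
have -> : wt q k = latnorm R k `^ (2 * (q - p)) * wt p k.
  rewrite /wt -powRD; first by congr (_ `^ _); ring.
  by rewrite (gt_eqF (lt_le_trans ltr01 k1)) implybT.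
rewrite ler_wpM2r ?wt_ge0 //; apply: (@le_trans _ _ (latnorm R k `^ (2 * `|q - p|))).
  by apply: ler_powR => //; rewrite ler_pM2l // ler_norm.
by apply: ge0_ler_powR; rewrite ?nnegrE ?latnorm_ge0 // mulr_ge0.
Qed.

(** Discarded modes have |k| > N + 1, so that 1 <= (N + 1)^-2 |k|^2, and |k|^2 is the weight gained
    between p and p + 1. *)
Lemma inner_tail N p v : energy_summable p v -> energy_summable (p + 1) v ->
  inner p (v - trunc N v) (v - trunc N v) <= (N.+1%:R^-1) ^+ 2 * inner (p + 1) v v.
Proof.
move=> sp sp1; rewrite !inner_fsum /fsum -rsumZ //.
have tail k : (v - trunc N v) k = if latnorm R k <= N.+1%:R then 0 else v k.
  rewrite [LHS]/GRing.add /= [(- _) k]/GRing.opp /= /trunc.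
  by case: ifP => _; rewrite ?subrr ?subr0.
apply: ler_rsum; last 2 first.
- apply: energy_summable_le sp => k; rewrite tail.
  by case: ifP => // _; rewrite rdot0l rdot_ge0.
- exact: rsummableZ.
move=> k /neq0_setC k0; rewrite tail; case: ifPn => [_|].
  by rewrite rdot0l mulr0 !mulr_ge0 ?sqr_ge0 ?wt_ge0 ?rdot_ge0.
rewrite -ltNge => Nk; rewrite mulrA ler_wpM2r ?rdot_ge0 // wtD1 // mulrCA.
rewrite ler_peMr ?wt_ge0 // -exprMn exprn_ege1 //.
by rewrite mulrC ler_pdivlMr ?ltr0n // mul1r ltW.
Qed.

Lemma inner_trunc_le N p v : inner p (trunc N v) (trunc N v) <=
  \sum_(k <- lball R d N) wt p k * rdot (v k) (v k).
Proof.
rewrite inner_fsum; apply: rsum_le_seq => [k _|s us _].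
  by rewrite mulr_ge0 ?wt_ge0 ?rdot_ge0.
apply: (@le_trans _ _ (\sum_(k <- lball R d N) wt p k * rdot (trunc N v k) (trunc N v k))).
  apply: sum_restrict => //; first exact: lball_uniq.
    by move=> k; rewrite mulr_ge0 ?wt_ge0 ?rdot_ge0.
  move=> k _; rewrite /trunc; case: ifPn => [/mem_lball -> //|_ _].
  by rewrite rdot0l mulr0.
by apply: ler_sum => k _; rewrite ler_wpM2l ?wt_ge0 ?rdot_trunc.
Qed.

(** Pythagoras: the two pieces have disjoint Fourier supports. *)
Lemma inner_split N p v : energy_summable p v ->
  inner p v v = inner p (trunc N v) (trunc N v) + inner p (v - trunc N v) (v - trunc N v).
Proof.
move=> sp; rewrite !inner_fsum /fsum -rsumD; last 2 first.
- by apply: energy_summable_le sp; exact: rdot_trunc.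
- apply: energy_summable_le sp => k.
  rewrite [(v - _) k]/GRing.add /= [(- _) k]/GRing.opp /= /trunc.
  by case: ifP => _; rewrite ?subrr ?subr0 ?rdot0l ?rdot_ge0.
apply: eq_rsum => k _.
rewrite [(v - _) k]/GRing.add /= [(- _) k]/GRing.opp /= /trunc.
by case: ifP => _; rewrite ?subrr ?subr0 rdot0l; ring.
Qed.

End FieldOperators.

(** * The Montel property *)

Section CoordinateLimits.
Variables (R : realType) (U : set_system nat) (UF : ProperFilter U).

Lemma cvg_finite_sum (I : Type) (s : seq I) (f : nat -> I -> R) (l : I -> R) :
  (forall i, f m i @[m --> U] --> l i) ->
  \sum_(i <- s) f m i @[m --> U] --> \sum_(i <- s) l i.
Proof.
move=> fl; elim: s => [|i s IH].
  by rewrite big_nil; under eq_fun do rewrite big_nil; exact: cvg_cst.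
by rewrite big_cons; under eq_fun do rewrite big_cons; exact: cvgD.
Qed.

Variable d : nat.

Definition coord_cvg (a : nat -> 'rV[R[i]]_d) (b : 'rV[R[i]]_d) := forall r,
  complex.Re (a m 0 r) @[m --> U] --> complex.Re (b 0 r) /\
  complex.Im (a m 0 r) @[m --> U] --> complex.Im (b 0 r).

Lemma coord_cvg_rdot a b : coord_cvg a b ->
  rdot (a m) (a m) @[m --> U] --> rdot b b.
Proof.
move=> ab; rewrite rdotE; under eq_fun do rewrite rdotE.
apply: cvg_finite_sum => r; have [h1 h2] := ab r.
by apply: cvgD; apply: cvgM.
Qed.

Lemma coord_cvg_unique a b c : coord_cvg a b -> coord_cvg a c -> b = c.
Proof.
move=> ab ac; apply/rowP => r; have [b1 b2] := ab r; have [c1 c2] := ac r.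
apply/eqP; rewrite eq_complex.
rewrite (cvg_unique (@Rhausdorff R) b1 c1) (cvg_unique (@Rhausdorff R) b2 c2).
by rewrite !eqxx.
Qed.

Lemma coord_cvg_cst b : coord_cvg (fun=> b) b.
Proof. by move=> r; split; exact: cvg_cst. Qed.

Lemma coord_cvgB a b c : coord_cvg a b -> coord_cvg (fun m => a m - c) (b - c).
Proof.
move=> ab r; have [b1 b2] := ab r; rewrite !mxE !raddfB /=.
split; under eq_fun do rewrite !mxE raddfB /=.
  by apply: cvgB => //; exact: cvg_cst.
by apply: cvgB => //; exact: cvg_cst.
Qed.

Lemma Re_conj (z : R[i]) : complex.Re z^* = complex.Re z.
Proof. by case: z. Qed.

Lemma Im_conj (z : R[i]) : complex.Im z^* = - complex.Im z.
Proof. by case: z. Qed.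

Lemma coord_cvg_conj a b : coord_cvg a b -> coord_cvg (fun m => conjv (a m)) (conjv b).
Proof.
move=> ab r; have [b1 b2] := ab r; rewrite !mxE Re_conj Im_conj.
split; under eq_fun do rewrite !mxE ?Re_conj ?Im_conj; first by [].
exact: cvgN.
Qed.

Lemma Re_dotc_lat (k : lattice d) (a : 'rV[R[i]]_d) : complex.Re (dotc (latc R k) a) =
  \sum_(r < d) (k 0 r)%:~R * complex.Re (a 0 r).
Proof.
rewrite /dotc (raddf_sum (@complex.Re R)); apply: eq_bigr => r _; rewrite !mxE.
rewrite (_ : (k 0 r)%:~R = ((k 0 r)%:~R : R)%:C); last by rewrite rmorph_int.
by case: (a 0 r) => x y /=; ring.
Qed.

Lemma Im_dotc_lat (k : lattice d) (a : 'rV[R[i]]_d) : complex.Im (dotc (latc R k) a) =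
  \sum_(r < d) (k 0 r)%:~R * complex.Im (a 0 r).
Proof.
rewrite /dotc (raddf_sum (@complex.Im R)); apply: eq_bigr => r _; rewrite !mxE.
rewrite (_ : (k 0 r)%:~R = ((k 0 r)%:~R : R)%:C); last by rewrite rmorph_int.
by case: (a 0 r) => x y /=; ring.
Qed.

Lemma coord_cvg_dotc_lat (k : lattice d) a b : coord_cvg a b ->
  (forall m, dotc (latc R k) (a m) = 0) -> dotc (latc R k) b = 0.
Proof.
move=> ab a0; apply/eqP; rewrite eq_complex Re_dotc_lat Im_dotc_lat.
apply/andP; split; apply/eqP.
- have h : \sum_(r < d) (k 0 r)%:~R * complex.Re (a m 0 r) @[m --> U] -->
     \sum_(r < d) (k 0 r)%:~R * complex.Re (b 0 r).
    by apply: cvg_finite_sum => r; apply: cvgMr; have [] := ab r.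
  have e : (fun m => \sum_(r < d) (k 0 r)%:~R * complex.Re (a m 0 r)) = fun=> 0.
    by apply/funext => m; rewrite -Re_dotc_lat a0.
  rewrite e in h; exact: (cvg_unique (@Rhausdorff R) h (cvg_cst _)).
- have h : \sum_(r < d) (k 0 r)%:~R * complex.Im (a m 0 r) @[m --> U] -->
     \sum_(r < d) (k 0 r)%:~R * complex.Im (b 0 r).
    by apply: cvg_finite_sum => r; apply: cvgMr; have [] := ab r.
  have e : (fun m => \sum_(r < d) (k 0 r)%:~R * complex.Im (a m 0 r)) = fun=> 0.
    by apply/funext => m; rewrite -Im_dotc_lat a0.
  rewrite e in h; exact: (cvg_unique (@Rhausdorff R) h (cvg_cst _)).
Qed.

(** Fatou's lemma in elementary form: finite sums of the limit are limits of finite sums, all at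
    most C. *)
Lemma energy_summable_limit p (x : nat -> vcoef R d) (y : vcoef R d) (C : R) :
  (forall k, coord_cvg (fun m => x m k) (y k)) ->
  (forall m, energy_summable p (x m)) -> (forall m, inner p (x m) (x m) <= C) ->
  energy_summable p y.
Proof.
move=> xy sx xC; apply: (@rsummable_seq _ _ _ _ C) => s us s0.
have -> : \sum_(k <- s) `|wt p k * rdot (y k) (y k)| =
    \sum_(k <- s) wt p k * rdot (y k) (y k).
  by apply: eq_bigr => k _; rewrite ger0_norm // mulr_ge0 ?wt_ge0 ?rdot_ge0.
have h : \sum_(k <- s) wt p k * rdot (x m k) (x m k) @[m --> U] -->
    \sum_(k <- s) wt p k * rdot (y k) (y k).
  apply: cvg_finite_sum => k; apply: cvgMr; exact: coord_cvg_rdot.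
apply: (ler_cvg_to h (cvg_cst C)); apply: nearW => m.
apply: le_trans (xC m); rewrite inner_fsum; apply: ler_seq_rsum => //.
  by move=> k _; rewrite mulr_ge0 ?wt_ge0 ?rdot_ge0.
exact: sx.
Qed.

End CoordinateLimits.

Section Montel.
Variables (R : realType) (d : nat) (U : set_system nat) (UU : UltraFilter U).

Lemma ler_rdot_coord (a : 'rV[R[i]]_d) r :
  `|complex.Re (a 0 r)| <= rdot a a + 1 /\ `|complex.Im (a 0 r)| <= rdot a a + 1.
Proof.
have := normc_le_rdot a r; case: (a 0 r) => x y /=.
rewrite sqr_sqrtr ?addr_ge0 ?sqr_ge0 // => h.
have x2 := sqr_ge0 x; have y2 := sqr_ge0 y.
have e (z : R) : `|z| <= z ^+ 2 + 1.
  have := sqr_ge0 (`|z| - 1); rewrite sqrrB real_normK ?num_real // expr1n mulr1.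
  have := normr_ge0 z; lra.
by split; [apply: le_trans (e x) _|apply: le_trans (e y) _]; lra.
Qed.

Lemma inner_sub_le p (v w : vcoef R d) : energy_summable p v -> energy_summable p w ->
  inner p (v - w) (v - w) <= 3 * (inner p v v + inner p w w).
Proof.
move=> sv sw; have sw' : energy_summable p (- w).
  by rewrite -scaleN1C; exact: energy_summableZ.
rewrite !inner_fsum /fsum -rsumD // -rsumZ; last exact: rsummableD.
apply: ler_rsum; [|exact: energy_summableD|exact/rsummableZ/rsummableD].
move=> k _; rewrite -mulrDr mulrCA ler_wpM2l ?wt_ge0 //.
have -> : (v - w) k = v k + (-1)%:C *: w k by rewrite rmorphN1 scaleN1r.
have := rdot_bound (v k) (w k); rewrite ler_norml => /andP[].
rewrite rdotDl ![rdot _ (_ + _)]rdotC !rdotDl !rdotZl.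
rewrite ![rdot _ (_ *: _)]rdotC !rdotZl (rdotC (w k) (v k)).
lra.
Qed.

(** Rellich's compactness: coefficients converge along the ultrafilter one by one, reality and
    vanishing divergence pass to the limit, and convergence in norm p uses the bound in norm p + 1
    to make the high modes uniformly small. *)
Lemma hfield_montel (x : nat -> vcoef R d) : (forall m, hfield (x m)) ->
  (forall p, exists C, forall m, inner p (x m) (x m) <= C) ->
  exists2 y, hfield y & forall p, inner p (x m - y) (x m - y) @[m --> U] --> (0 : R).
Proof.
move=> hx bd; have UF : ProperFilter U by exact: ultra_proper.
have sx m p : energy_summable p (x m) by case: (hx m).
have [C0 HC0] := bd 0.
have xb m k : rdot (x m k) (x m k) <= C0.
  apply: le_trans (HC0 m); rewrite inner_fsum; apply: hfield_bounded => //.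
  by case: (hx m).
have lre k r : exists l : R, complex.Re (x m k 0 r) @[m --> U] --> l.
  apply: (@bounded_ultra _ _ UU _ (C0 + 1)) => m.
  by have [h _] := ler_rdot_coord (x m k) r; apply: le_trans h _; rewrite lerD2r.
have lim k r : exists l : R, complex.Im (x m k 0 r) @[m --> U] --> l.
  apply: (@bounded_ultra _ _ UU _ (C0 + 1)) => m.
  by have [_ h] := ler_rdot_coord (x m k) r; apply: le_trans h _; rewrite lerD2r.
pose y : vcoef R d := fun k => \row_r (sval (cid (lre k r)) +i* sval (cid (lim k r))).
have xy k : coord_cvg U (fun m => x m k) (y k).
  by move=> r; rewrite mxE /=; split; [case: (cid (lre k r))|case: (cid (lim k r))].
have sy p : energy_summable p y.
  by have [C HC] := bd p; exact: (energy_summable_limit UF xy (fun m => sx m p) HC).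
exists y.
  split => //.
  - move=> k; apply: (coord_cvg_unique UF (xy k)).
    have e : (fun m => x m k) = (fun m => conjv (x m (- k))).
      by apply/funext => m; have [h _ _ _] := hx m; exact: h.
    by rewrite e; apply: coord_cvg_conj.
  - by move=> k; apply: (coord_cvg_dotc_lat UF (xy k)) => m; have [_ h _ _] := hx m.
  - apply: (coord_cvg_unique UF (xy 0)).
    have e : (fun m => x m 0) = fun=> 0.
      by apply/funext => m; have [_ _ h _] := hx m.
    by rewrite e; exact: coord_cvg_cst.
move=> p.
pose z m := x m - y.
have sz m q : energy_summable q (z m).
  by apply: energy_summableD => //; rewrite -scaleN1C; exact: energy_summableZ.
have [C HC] := bd (p + 1).
pose D := 3 * (C + inner (p + 1) y y).
have zD m : inner (p + 1) (z m) (z m) <= D.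
  by apply: le_trans (inner_sub_le _ _) _ => //; rewrite ler_pM2l // lerD2r.
have D0 : 0 <= D := le_trans (inner_ge0 _ _) (zD 0%N).
apply/cvgrPdist_le => e e0.
(* With N + 1 > 2 D / e the tail is below e / 2, even after one of the two factors (N + 1)^-1 is
   estimated by 1. *)
pose N := Num.truncn (2 * D / e).
have ND : (N.+1%:R^-1) ^+ 2 * D <= e / 2.
  have h : 2 * D / e < N.+1%:R by exact: truncnS_gt.
  rewrite expr2 -mulrA; apply: (@le_trans _ _ (N.+1%:R^-1 * D)).
    have i1 : N.+1%:R^-1 <= 1 :> R by rewrite invf_le1 ?ler1n ?ltr0n.
    have i0 : 0 <= N.+1%:R^-1 :> R by rewrite invr_ge0.
    exact: (ler_piMl (mulr_ge0 i0 D0) i1).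
  rewrite ltr_pdivrMr // in h.
  by rewrite mulrC ler_pdivrMr ?ltr0n // mulrAC ler_pdivlMr //; move: h; lra.
have low : \sum_(k <- lball R d N) wt p k * rdot (z m k) (z m k) @[m --> U] --> (0 : R).
  have h : \sum_(k <- lball R d N) wt p k * rdot (z m k) (z m k) @[m --> U] -->
     \sum_(k <- lball R d N) wt p k * rdot (y k - y k) (y k - y k).
    by apply: cvg_finite_sum => k; apply: cvgMr; apply: coord_cvg_rdot; exact: coord_cvgB.
  move: h; rewrite [X in _ --> X -> _]big1 // => k _.
  by rewrite subrr rdot0l mulr0.
have e2 : 0 < e / 2 by rewrite divr_gt0.
have /cvgrPdist_le/(_ _ e2) := low.
apply: filterS => m; rewrite !sub0r !normrN => h.
rewrite ger0_norm ?inner_ge0 // -/(z m) (inner_split N (sz m p)).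
have -> : e = e / 2 + e / 2 by field.
apply: lerD.
  by apply: le_trans (inner_trunc_le _ _ _) _; apply: le_trans (ler_norm _) h.
apply: le_trans (inner_tail _ _ _) _ => //.
by apply: le_trans ND; rewrite ler_wpM2l // sqr_ge0.
Qed.

End Montel.

(** * The Leray projection *)

Section Leray.
Variables (R : realType) (d : nat).
Implicit Types (k : lattice d) (a b c : 'rV[R[i]]_d).

Lemma sub_lat_kermx k a : (a <= kermx (latc R k)^T)%MS = (dotc (latc R k) a == 0).
Proof.
rewrite sub_kermx; apply/eqP/eqP => [/matrixP/(_ 0 0)|h].
  rewrite !mxE => <-; apply: eq_bigr => r _; by rewrite !mxE mulrC.
apply/matrixP => i j; rewrite (ord1 i) (ord1 j) !mxE -[RHS]h; apply: eq_bigr => r _.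
by rewrite !mxE mulrC.
Qed.

Lemma leray_div k a : dotc (latc R k) (a *m leray_mx R k) = 0.
Proof. by apply/eqP; rewrite -sub_lat_kermx proj_ortho_sub. Qed.

Lemma leray_id k a : dotc (latc R k) a = 0 -> a *m leray_mx R k = a.
Proof. by move=> h; apply: proj_ortho_id; rewrite sub_lat_kermx h. Qed.

Lemma leray_orth k a c : dotc (latc R k) c = 0 ->
  dotc (conjv c) (a - a *m leray_mx R k) = 0.
Proof.
move=> /eqP; rewrite -sub_lat_kermx => /submxP[D cE].
have /orthomx1P h := proj_ortho_compl_sub (kermx (latc R k)^T) a.
rewrite -/(leray_mx R k) in h; set e := a - _ in h *.
have : (e *m map_mx Num.conj (c^T)) 0 0 = 0.
  by rewrite cE trmx_mul map_mxM mulmxA h mul0mx mxE.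
by rewrite mxE => <-; apply: eq_bigr => r _; rewrite !mxE mulrC.
Qed.

(** The variational characterisation of the projection: b lies in the subspace and a - b is
    orthogonal to it. It spares any computation with [proj_ortho]. *)
Lemma leray_uniq k a b : dotc (latc R k) b = 0 ->
  (forall c, dotc (latc R k) c = 0 -> dotc (conjv c) (a - b) = 0) ->
  a *m leray_mx R k = b.
Proof.
move=> kb h; rewrite -[a](subrK b) mulmxDl (leray_id kb).
rewrite [_ *m _]proj_ortho_0 ?add0r //; apply/orthomx1P.
apply/matrixP => i j; rewrite (ord1 i) mxE [RHS]mxE.
have kr : dotc (latc R k) (row j (kermx (latc R k)^T)) = 0.
  by apply/eqP; rewrite -sub_lat_kermx; exact: row_sub.
rewrite -[RHS](h _ kr) /dotc.
by apply: eq_bigr => r _; rewrite !mxE mulrC.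
Qed.

Lemma dotc_conjv a b : dotc (conjv a) (conjv b) = (dotc a b)^*.
Proof.
by rewrite /dotc rmorph_sum; apply: eq_bigr => r _; rewrite !mxE rmorphM.
Qed.

Lemma conjv_latc k : conjv (latc R k) = latc R k.
Proof. by apply/rowP => r; rewrite !mxE rmorph_int. Qed.

Lemma conjvK a : conjv (conjv a) = a.
Proof. by apply/rowP => r; rewrite !mxE conjcK. Qed.

(** As k is real, the subspaces at k and - k coincide and are stable under conjugation; hence the
    projection preserves the reality condition. *)
Lemma leray_conj k a : conjv a *m leray_mx R (- k) = conjv (a *m leray_mx R k).
Proof.
apply: leray_uniq => [|c].
  by rewrite dotc_latN -(conjv_latc k) dotc_conjv leray_div conjc0 oppr0.
rewrite dotc_latN => /eqP; rewrite oppr_eq0 => /eqP kc.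
have kc' : dotc (latc R k) (conjv c) = 0.
  by rewrite -(conjv_latc k) dotc_conjv kc conjc0.
have -> : conjv a - conjv (a *m leray_mx R k) = conjv (a - a *m leray_mx R k).
  by apply/rowP => r; rewrite !mxE rmorphB.
by rewrite -[c]conjvK dotc_conjv (leray_orth _ kc') conjc0.
Qed.

End Leray.

(** * The advection term *)

Section ComplexSums.
Variables (R : realType) (d : nat).
Implicit Types (f g : lattice d -> R[i]).

Local Notation csumT := (csum [set: lattice d]).

Definition csummable f := rsummable [set: lattice d] (fun h => complex.Re (f h)) /\
  rsummable [set: lattice d] (fun h => complex.Im (f h)).

Lemma eq_csum f g : f =1 g -> csumT f = csumT g.
Proof. by move=> /funext ->. Qed.

Lemma csum0 : csumT (fun=> 0 : R[i]) = 0.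
Proof. by rewrite /csum /= !rsum0. Qed.

Lemma csummableD f g : csummable f -> csummable g -> csummable (fun h => f h + g h).
Proof.
move=> [f1 f2] [g1 g2]; split.
  by under eq_fun do rewrite raddfD /=; exact: rsummableD.
by under eq_fun do rewrite raddfD /=; exact: rsummableD.
Qed.

Lemma csumD f g : csummable f -> csummable g ->
  csumT (fun h => f h + g h) = csumT f + csumT g.
Proof.
move=> [f1 f2] [g1 g2]; rewrite /csum.
under eq_fun do rewrite raddfD /=.
under [in X in _ +i* X]eq_fun do rewrite raddfD /=.
by rewrite !rsumD.
Qed.

Lemma csummableZ z f : csummable f -> csummable (fun h => z * f h).
Proof.
case: z => x y [f1 f2]; split.
  have := rsummableD (rsummableZ x f1) (rsummableZ (- y) f2).
  apply: rsummable_le => h _; rewrite le_eqVlt; apply/orP; left; apply/eqP.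
  by congr (`|_|); case: (f h) => a b /=; ring.
have := rsummableD (rsummableZ x f2) (rsummableZ y f1).
apply: rsummable_le => h _; rewrite le_eqVlt; apply/orP; left; apply/eqP.
by congr (`|_|); case: (f h) => a b /=; ring.
Qed.

Lemma csumZ z f : csummable f -> csumT (fun h => z * f h) = z * csumT f.
Proof.
case: z => x y [f1 f2]; rewrite /csum.
have -> : rsum setT (fun h => complex.Re ((x +i* y) * f h)) =
    x * rsum setT (fun h => complex.Re (f h)) - y * rsum setT (fun h => complex.Im (f h)).
  rewrite -!rsumZ // -rsumB; [|exact: rsummableZ|exact: rsummableZ].
  by apply: eq_rsum => h _; case: (f h).
have -> : rsum setT (fun h => complex.Im ((x +i* y) * f h)) =
    x * rsum setT (fun h => complex.Im (f h)) + y * rsum setT (fun h => complex.Re (f h)).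
  rewrite -!rsumZ // -rsumD; [|exact: rsummableZ|exact: rsummableZ].
  by apply: eq_rsum => h _; case: (f h).
by [].
Qed.

Lemma csum_conj f : csummable f -> csumT (fun h => (f h)^*) = (csumT f)^*.
Proof.
move=> [f1 f2]; rewrite /csum /=; congr (_ +i* _).
  by apply: eq_rsum => h _; case: (f h).
by rewrite -rsumN //; apply: eq_rsum => h _; case: (f h).
Qed.

Lemma rsum_opp (f : lattice d -> R) :
  rsum [set: lattice d] (fun h => f (- h)) = rsum [set: lattice d] f.
Proof.
have b : set_bij [set: lattice d] [set: lattice d] -%R.
  by rewrite setTT_bijective; exact: inv_bij (@opprK _).
by rewrite /rsum; congr (fine (_ - _)); rewrite [RHS](@reindex_esum _ _ _ _ _ _ _ b);
  apply: eq_esum => h _; rewrite ?funeposE ?funenegE.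
Qed.

Lemma csum_opp f : csumT (fun h => f (- h)) = csumT f.
Proof.
rewrite /csum (rsum_opp (fun h => complex.Re (f h))).
by rewrite (rsum_opp (fun h => complex.Im (f h))).
Qed.

Lemma csum_sum (I : Type) (s : seq I) (F : I -> lattice d -> R[i]) :
  (forall i, csummable (F i)) ->
  csummable (fun h => \sum_(i <- s) F i h) /\
  csumT (fun h => \sum_(i <- s) F i h) = \sum_(i <- s) csumT (F i).
Proof.
move=> sF; elim: s => [|i s [IH1 IH2]].
  rewrite big_nil; under eq_fun do rewrite big_nil.
  by rewrite csum0; split => //; split; exact: rsummable0.
rewrite big_cons; under eq_fun do rewrite big_cons.
by split; [exact: csummableD|rewrite csumD // IH2].
Qed.

Lemma csummable_seq f C : (forall s, uniq s -> \sum_(h <- s) normc (f h) <= C) ->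
  csummable f.
Proof.
move=> H; split; apply: (@rsummable_seq _ _ _ _ C) => s us _;
  apply: le_trans (H s us); apply: ler_sum => h _; case: (f h) => x y /=.
  by rewrite -sqrtr_sqr ler_wsqrtr // lerDl sqr_ge0.
by rewrite -sqrtr_sqr ler_wsqrtr // lerDr sqr_ge0.
Qed.

(** Dominated convergence: a finite list [s] carries all but e of the total mass, and [P N] holds on
    all of [s] for large N, so the missing mass is at most e. *)
Lemma rsum_exhaust (P : nat -> lattice d -> bool) (f : lattice d -> R) :
  (forall h, exists N0 : nat, forall N, (N0 <= N)%N -> P N h) ->
  rsummable setT f ->
  rsum setT (fun h => if P N h then f h else 0) @[N --> \oo] --> rsum setT f.
Proof.
move=> hP sf; have nf := rsummable_norm sf.
apply/cvgrPdist_le => e e0.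
have [s us hs] : exists2 s : seq (lattice d), uniq s &
    rsum setT (fun h => `|f h|) - e <= \sum_(h <- s) `|f h|.
  apply: contrapT => nex.
  have : rsum setT (fun h => `|f h|) <= rsum setT (fun h => `|f h|) - e.
    apply: rsum_le_seq => // s us _; rewrite leNgt; apply/negP => h.
    by apply: nex; exists s => //; exact: ltW.
  lra.
have [N0 HN0] : exists N0 : nat, forall N, (N0 <= N)%N -> forall h, h \in s -> P N h.
  elim: s {us hs} => [|h s [N1 H1]]; first by exists 0%N.
  have [N2 H2] := hP h; exists (maxn N1 N2) => N; rewrite geq_max => /andP[n1 n2] j.
  by rewrite inE => /orP[/eqP ->|]; [exact: H2|exact: H1].
exists N0 => // N /= HN.
have sg : rsummable setT (fun h => if P N h then f h else 0).
  by apply: rsummable_le sf => h _; case: ifP => // _; rewrite normr0.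
rewrite -rsumB //; apply: le_trans (ler_norm_rsum _) _.
  by apply: rsummableD => //; exact: rsummableN.
have -> : rsum setT (fun h => `|f h - (if P N h then f h else 0)|) =
    rsum setT (fun h => `|f h|) - rsum setT (fun h => `|if P N h then f h else 0|).
  rewrite -rsumB //; last exact: rsummable_norm.
  by apply: eq_rsum => h _; case: ifP; rewrite ?subrr ?normr0 ?subr0.
have : \sum_(h <- s) `|f h| <= rsum setT (fun h => `|if P N h then f h else 0|).
  have -> : \sum_(h <- s) `|f h| = \sum_(h <- s) `|if P N h then f h else 0|.
    by apply: eq_big_seq => h hin; rewrite HN0.
  by apply: ler_seq_rsum => //; [exact: rsummable_norm|move=> h _; rewrite inE].
lra.
Qed.

End ComplexSums.

Section CoordinateLimitsMatrix.
Variables (R : realType) (d : nat) (U : set_system nat) (UF : ProperFilter U).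
Implicit Types (a : nat -> 'rV[R[i]]_d) (b : 'rV[R[i]]_d) (M : 'M[R[i]]_d).

Lemma Re_mulmx b M r : complex.Re ((b *m M) 0 r) =
  \sum_s (complex.Re (b 0 s) * complex.Re (M s r) - complex.Im (b 0 s) * complex.Im (M s r)).
Proof.
rewrite mxE (raddf_sum (@complex.Re R)); apply: eq_bigr => s _.
by case: (b 0 s) => ? ?; case: (M s r).
Qed.

Lemma Im_mulmx b M r : complex.Im ((b *m M) 0 r) =
  \sum_s (complex.Re (b 0 s) * complex.Im (M s r) + complex.Im (b 0 s) * complex.Re (M s r)).
Proof.
rewrite mxE (raddf_sum (@complex.Im R)); apply: eq_bigr => s _.
by case: (b 0 s) => ? ?; case: (M s r).
Qed.

Lemma coord_cvg_mulmx a b M : coord_cvg U a b -> coord_cvg U (fun m => a m *m M) (b *m M).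
Proof.
move=> ab r; rewrite Re_mulmx Im_mulmx.
split; [under eq_fun do rewrite Re_mulmx | under eq_fun do rewrite Im_mulmx];
  apply: cvg_finite_sum => s; have [h1 h2] := ab s.
  by apply: cvgB; apply: cvgMl.
by apply: cvgD; apply: cvgMl.
Qed.

Lemma coord_cvgN a b : coord_cvg U a b -> coord_cvg U (fun m => - a m) (- b).
Proof.
move=> ab r; have [h1 h2] := ab r; rewrite !mxE !raddfN /=.
by split; under eq_fun do rewrite !mxE raddfN /=; exact: cvgN.
Qed.

End CoordinateLimitsMatrix.

(** * The bilinear term, mode by mode *)

Section Advection.
Variables (R : realType) (d : nat).
Implicit Types (k h : lattice d) (v w : vcoef R d).

Definition adv_term v w k (s r : 'I_d) h : R[i] := v h 0 s * deriv_dir s w (k - h) 0 r.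

Definition adv_factor : R[i] := ((2 * pi) `^ (- (d%:R / 2)))%:C.

Lemma advectE v w k r :
  advect v w k 0 r = \sum_(s < d) adv_factor * csum setT (adv_term v w k s r).
Proof. by rewrite mxE. Qed.

Lemma seq_rdot_le v s : v 0 = 0 -> energy_summable 0 v -> uniq s ->
  \sum_(h <- s) rdot (v h) (v h) <= inner 0 v v.
Proof.
move=> v0 sv us; rewrite inner_fsum.
apply: (@le_trans _ _ (\sum_(h <- [seq h <- s | h != 0]) rdot (v h) (v h))).
  apply: sum_restrict => // [|h|h hs]; [exact: filter_uniq|exact: rdot_ge0|].
  by rewrite mem_filter hs andbT negbK => /eqP ->; rewrite v0 rdot0l.
rewrite (eq_bigr (fun h => wt 0 h * rdot (v h) (v h))); last first.
  by move=> h _; rewrite wt0 mul1r.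
apply: ler_seq_rsum => //; rewrite ?filter_uniq //.
  by move=> h _; rewrite mulr_ge0 ?wt_ge0 ?rdot_ge0.
by move=> h; rewrite mem_filter inE => /andP[/eqP].
Qed.

Lemma seq_lat_rdot_le w s : energy_summable 1 w -> uniq s ->
  \sum_(h <- s) latnorm R h ^+ 2 * rdot (w h) (w h) <= inner 1 w w.
Proof.
move=> sw us; rewrite inner_fsum.
apply: (@le_trans _ _ (\sum_(h <- [seq h <- s | h != 0])
    latnorm R h ^+ 2 * rdot (w h) (w h))).
  apply: sum_restrict => // [|h|h hs]; first exact: filter_uniq.
    by rewrite mulr_ge0 ?sqr_ge0 ?rdot_ge0.
  rewrite mem_filter hs andbT negbK => /eqP ->.
  by rewrite latnorm0 expr0n mul0r.
rewrite (eq_bigr (fun h => wt 1 h * rdot (w h) (w h))); last first.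
  by move=> h _; rewrite /wt mulr1 powR_mulrn ?latnorm_ge0.
apply: ler_seq_rsum => //; rewrite ?filter_uniq //.
  by move=> h _; rewrite mulr_ge0 ?wt_ge0 ?rdot_ge0.
by move=> h; rewrite mem_filter inE => /andP[/eqP].
Qed.

(** From x (y z) <= x^2 + (y z)^2: the term is dominated by an L^2 density of v plus one of the
    gradient of w, so the convolution sum converges absolutely for v in H^0 and w in H^1. *)
Lemma normc_adv_term v w k s r h : normc (adv_term v w k s r h) <=
  rdot (v h) (v h) + latnorm R (k - h) ^+ 2 * rdot (w (k - h)) (w (k - h)).
Proof.
have nc0 (z : R[i]) : 0 <= normc z by case: z => *; exact: sqrtr_ge0.
rewrite /adv_term normcM /deriv_dir mxE normcM.
set x := normc (v h 0 s); set y := normc ('i * _); set z := normc (w _ 0 r).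
have x0 : 0 <= x by exact: nc0.
have y0 : 0 <= y by exact: nc0.
have z0 : 0 <= z by exact: nc0.
have hx : x ^+ 2 <= rdot (v h) (v h) by exact: normc_le_rdot.
have hz : z ^+ 2 <= rdot (w (k - h)) (w (k - h)) by exact: normc_le_rdot.
have hy : y ^+ 2 <= latnorm R (k - h) ^+ 2.
  rewrite /y mxE normcM.
  have -> : normc 'i%C = 1 :> R by rewrite /= expr0n expr1n add0r sqrtr1.
  rewrite mul1r (_ : ((k - h) 0 s)%:~R = (((k - h) 0 s)%:~R : R)%:C); last by rewrite rmorph_int.
  rewrite /= expr0n addr0 sqr_sqrtr ?sqr_ge0 // -real_normK ?num_real //.
  by rewrite ler_pXn2r ?nnegrE ?latnorm_ge0 // ler_coord_latnorm.
have h1 : x * (y * z) <= x ^+ 2 + (y * z) ^+ 2.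
  have yz := mulr_ge0 y0 z0; have := sqr_ge0 (x - y * z).
  have := mulr_ge0 x0 yz; rewrite sqrrB; lra.
apply: le_trans h1 _; apply: lerD => //; rewrite exprMn.
by apply: ler_pM; rewrite ?sqr_ge0.
Qed.

Lemma adv_csummable v w k s r : hfield v -> hfield w ->
  csummable (adv_term v w k s r).
Proof.
move=> [_ _ v0 sv] [_ _ _ sw].
apply: (@csummable_seq _ _ _ (inner 0 v v + inner 1 w w)) => t ut.
apply: le_trans (ler_sum _ (fun h _ => normc_adv_term v w k s r h)) _.
rewrite big_split; apply: lerD; first exact: seq_rdot_le.
rewrite -(big_map (fun h => k - h) xpredT
  (fun h => latnorm R h ^+ 2 * rdot (w h) (w h))).
apply: seq_lat_rdot_le => //; rewrite map_inj_uniq // => h1 h2.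
by move/addrI/oppr_inj.
Qed.

Lemma adv_term_linl (l : R) v v' w k s r h :
  adv_term (l%:C *: v + v') w k s r h = l%:C * adv_term v w k s r h + adv_term v' w k s r h.
Proof. by rewrite /adv_term [(_ + _) h]/GRing.add /= !mxE; ring. Qed.

Lemma adv_term_linr (l : R) v v' w k s r h :
  adv_term w (l%:C *: v + v') k s r h = l%:C * adv_term w v k s r h + adv_term w v' k s r h.
Proof. by rewrite /adv_term /deriv_dir [(_ + _) (k - h)]/GRing.add /= !mxE; ring. Qed.

Lemma fmul_adv v w k s r :
  fmul (fun h => v h 0 s) (fun h => deriv_dir s w h 0 r) k =
  adv_factor * csum setT (adv_term v w k s r).
Proof. by []. Qed.

Lemma Pop_linl (l : R) v v' w : hfield v -> hfield v' -> hfield w ->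
  Pop (l%:C *: v + v') w = l%:C *: Pop v w + Pop v' w.
Proof.
move=> hv hv' hw; apply/funext => k.
rewrite [RHS]/GRing.add /= [(_ *: _) k]/GRing.scale /= /Pop ![(- _) k]/GRing.opp /= /leray.
rewrite scalerN -opprD scalemxAl -mulmxDl; congr (- (_ *m _)).
apply/rowP => r; rewrite !mxE mulr_sumr -big_split; apply: eq_bigr => s _.
rewrite !fmul_adv (eq_csum (adv_term_linl l v v' w k s r)) csumD ?csumZ.
- by rewrite /=; ring.
- exact: adv_csummable.
- exact/csummableZ/adv_csummable.
- exact: adv_csummable.
Qed.

Lemma Pop_linr (l : R) v v' w : hfield v -> hfield v' -> hfield w ->
  Pop w (l%:C *: v + v') = l%:C *: Pop w v + Pop w v'.
Proof.
move=> hv hv' hw; apply/funext => k.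
rewrite [RHS]/GRing.add /= [(_ *: _) k]/GRing.scale /= /Pop ![(- _) k]/GRing.opp /= /leray.
rewrite scalerN -opprD scalemxAl -mulmxDl; congr (- (_ *m _)).
apply/rowP => r; rewrite !mxE mulr_sumr -big_split; apply: eq_bigr => s _.
rewrite !fmul_adv (eq_csum (adv_term_linr l v v' w k s r)) csumD ?csumZ.
- by rewrite /=; ring.
- exact: adv_csummable.
- exact/csummableZ/adv_csummable.
- exact: adv_csummable.
Qed.

(** The substitution h -> - h in the convolution turns the reality of v and w into that of the
    product. *)
Lemma advect_conj v w k : hfield v -> hfield w ->
  advect v w (- k) = conjv (advect v w k).
Proof.
move=> hv hw; apply/rowP => r; rewrite advectE mxE advectE rmorph_sum.
have E (z : R[i]) : conjc (adv_factor * z) = adv_factor * conjc z.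
  by rewrite rmorphM; congr (_ * _); exact: conjc_real.
apply: eq_bigr => s _; rewrite [RHS](E (csum setT (adv_term v w k s r))).
rewrite -(csum_conj (adv_csummable k s r hv hw)).
congr (_ * _); rewrite -csum_opp; apply: eq_csum => h.
have [v1 _ _ _] := hv; have [w1 _ _ _] := hw.
rewrite /adv_term rmorphM /deriv_dir.
have -> : v (- h) 0 s = conjc (v h 0 s) by rewrite [in LHS]v1 opprK mxE.
have -> : k - - h = - (- k - h) by rewrite opprB !opprK addrC.
congr (_ * _); first by rewrite -[LHS]conjcK.
rewrite [in LHS]w1 !mxE.
set x := w _ 0 r; set z := - k 0 s - h 0 s.
have zC (y : int) : (y%:~R : R[i]) = (y%:~R : R)%:C by rewrite rmorph_int.
rewrite !zC intrN; case: x => x1 x2; apply/eqP.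
by rewrite eq_complex /=; apply/andP; split; apply/eqP; ring.
Qed.

(** At k = 0 the derivative acts on w at - h, so summing over s inside the convolution produces h .
    v_h, which vanishes: the divergence condition on v makes the advection mean-free. *)
Lemma advect_zero v w : hfield v -> hfield w -> advect v w 0 = 0.
Proof.
move=> hv hw; apply/rowP => r; rewrite advectE [RHS]mxE -mulr_sumr.
have [_ <-] := @csum_sum R d _ (index_enum 'I_d) (fun s => adv_term v w 0 s r)
  (fun s => adv_csummable 0 s r hv hw).
rewrite (_ : (fun h => _) = fun=> 0); first by rewrite csum0 mulr0.
apply/funext => h; have [_ v2 _ _] := hv.
rewrite /adv_term /deriv_dir sub0r.
under eq_bigr => s _ do rewrite !mxE.
transitivity (- ('i%C * w (- h) 0 r) * dotc (latc R h) (v h)); last by rewrite v2 mulr0.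
rewrite /dotc mulr_sumr; apply: eq_bigr => s _.
by rewrite !mxE intrN; ring.
Qed.

Lemma PopE v w k : Pop v w k = - (advect v w k *m leray_mx R k).
Proof. by []. Qed.

Lemma PopN_conj v w k : hfield v -> hfield w -> Pop v w k = conjv (Pop v w (- k)).
Proof.
move=> hv hw; rewrite !PopE.
have -> : advect v w (- k) *m leray_mx R (- k) = conjv (advect v w k *m leray_mx R k).
  by rewrite advect_conj // leray_conj.
by apply/rowP => r; rewrite !mxE rmorphN /= conjcK.
Qed.

Lemma Pop_div v w k : dotc (latc R k) (Pop v w k) = 0.
Proof.
by rewrite PopE -scaleN1r dotcZr leray_div mulr0.
Qed.

Lemma Pop_zero v w : hfield v -> hfield w -> Pop v w 0 = 0.
Proof. by move=> hv hw; rewrite PopE advect_zero // mul0mx oppr0. Qed.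

(** Two truncated fields interact only on the finite set [S] of sums of retained modes. *)
Lemma Pop_trunc_summable N p v w : energy_summable p (Pop (trunc N v) (trunc N w)).
Proof.
pose S := undup [seq a + b | a <- lball R d N, b <- lball R d N].
have supp k : k \notin S -> Pop (trunc N v) (trunc N w) k = 0.
  move=> kS; rewrite PopE (_ : advect _ _ k = 0) ?mul0mx ?oppr0 //.
  apply/rowP => r; rewrite advectE [RHS]mxE big1 // => s _.
  rewrite (_ : adv_term _ _ _ _ _ = fun=> 0) ?csum0 ?mulr0 //.
  apply/funext => h; rewrite /adv_term /deriv_dir /trunc.
  case: ifPn => h1; last by rewrite mxE mul0r.
  case: ifPn => h2; last by rewrite scaler0 [X in _ * X]mxE mulr0.
  case/negP: kS; rewrite mem_undup; apply/allpairsP; exists (h, k - h) => /=.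
  by split; [exact: mem_lball|exact: mem_lball|rewrite addrC subrK].
pose f k := wt p k * rdot (Pop (trunc N v) (trunc N w) k) (Pop (trunc N v) (trunc N w) k).
have f0 k : 0 <= f k by rewrite mulr_ge0 ?wt_ge0 ?rdot_ge0.
apply: (@rsummable_seq _ _ _ _ (\sum_(k <- S) f k)) => s us _.
rewrite (eq_bigr f) => [|k _]; last by rewrite ger0_norm ?f0.
apply: sum_restrict => //; first exact: undup_uniq.
by move=> k _ /supp kS; rewrite /f kS rdot0l mulr0.
Qed.

(** For fixed k the truncated convolution is the original one restricted to an exhaustion of the
    lattice, so [rsum_exhaust] applies; the Leray matrix at k does not depend on N. *)
Lemma Pop_trunc_cvg v w k : hfield v -> hfield w ->
  coord_cvg \oo (fun N => Pop (trunc N v) (trunc N w) k) (Pop v w k).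
Proof.
move=> hv hw.
pose P k N (h : lattice d) := (latnorm R h <= N.+1%:R) && (latnorm R (k - h) <= N.+1%:R).
have hP h : exists N0 : nat, forall N, (N0 <= N)%N -> P k N h.
  exists (maxn (Num.truncn (latnorm R h)) (Num.truncn (latnorm R (k - h)))) => N.
  rewrite geq_max => /andP[n1 n2].
  have le j : (Num.truncn (latnorm R j) <= N)%N -> latnorm R j <= N.+1%:R.
    by rewrite Num.Theory.truncn_le_nat => /ltW.
  by rewrite /P !le.
have T N s r : adv_term (trunc N v) (trunc N w) k s r =
    fun h => if P k N h then adv_term v w k s r h else 0.
  apply/funext => h; rewrite /adv_term /deriv_dir /trunc /P.
  case: ifP => _ /=; last by rewrite mxE mul0r.
  by case: ifP => _ //=; rewrite scaler0 [X in _ * X]mxE mulr0.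
have adv : coord_cvg \oo (fun N => advect (trunc N v) (trunc N w) k) (advect v w k).
  have c s r : (rsum setT (fun h => complex.Re (adv_term (trunc N v) (trunc N w) k s r h))
      @[N --> \oo] --> rsum setT (fun h => complex.Re (adv_term v w k s r h))) /\
    (rsum setT (fun h => complex.Im (adv_term (trunc N v) (trunc N w) k s r h))
      @[N --> \oo] --> rsum setT (fun h => complex.Im (adv_term v w k s r h))).
    have [s1 s2] := adv_csummable k s r hv hw; split.
      have := rsum_exhaust hP s1.
      rewrite (_ : (fun N => _) =
          (fun N => rsum setT (fun h => complex.Re (adv_term (trunc N v) (trunc N w) k s r h)))) //.
      by apply/funext => N; rewrite T; apply: eq_rsum => h _; case: ifP.
    have := rsum_exhaust hP s2.
    rewrite (_ : (fun N => _) =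
          (fun N => rsum setT (fun h => complex.Im (adv_term (trunc N v) (trunc N w) k s r h)))) //.
    by apply/funext => N; rewrite T; apply: eq_rsum => h _; case: ifP.
  move=> r; split.
    under eq_fun do rewrite advectE (raddf_sum (@complex.Re R)).
    rewrite advectE (raddf_sum (@complex.Re R)); apply: cvg_finite_sum => s.
    have [c1 c2] := c s r.
    have e z : complex.Re (adv_factor * z) = (2 * pi) `^ (- (d%:R / 2)) * complex.Re z.
      by case: z => a b /=; ring.
    rewrite [X in _ --> X]e (_ : (fun N => _) = (fun N => (2 * pi) `^ (- (d%:R / 2)) *
      rsum setT (fun h => complex.Re (adv_term (trunc N v) (trunc N w) k s r h)))).
      exact: cvgMr.
    by apply/funext => N; exact: e.
  under eq_fun do rewrite advectE (raddf_sum (@complex.Im R)).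
  rewrite advectE (raddf_sum (@complex.Im R)); apply: cvg_finite_sum => s.
  have [c1 c2] := c s r.
  have e z : complex.Im (adv_factor * z) = (2 * pi) `^ (- (d%:R / 2)) * complex.Im z.
    by case: z => a b /=; ring.
  rewrite [X in _ --> X]e (_ : (fun N => _) = (fun N => (2 * pi) `^ (- (d%:R / 2)) *
    rsum setT (fun h => complex.Im (adv_term (trunc N v) (trunc N w) k s r h)))).
    exact: cvgMr.
  by apply/funext => N; exact: e.
exact/coord_cvgN/coord_cvg_mulmx.
Qed.

End Advection.

(** * Pairs of fields *)

Section PairBasics.
Variables (R : realType) (d : nat).
Implicit Types (p q : R) (v w : vcoef R d) (x y z : pair_field R d).

Lemma energy_summable_mono p q v : p <= q -> energy_summable q v -> energy_summable p v.
Proof.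
move=> pq; apply: rsummable_le => k /neq0_setC k0.
by rewrite !ger0_norm ?mulr_ge0 ?wt_ge0 ?rdot_ge0 // ler_wpM2r ?rdot_ge0 // wt_mono.
Qed.

Lemma inner_trunc_contract N p v : energy_summable p v ->
  inner p (trunc N v) (trunc N v) <= inner p v v.
Proof.
move=> sv; rewrite !inner_fsum; apply: ler_rsum => //.
  by move=> k _; rewrite ler_wpM2l ?wt_ge0 ?rdot_trunc.
by apply: energy_summable_le sv; exact: rdot_trunc.
Qed.

Lemma Hnorm2E p x : Hnorm2 p x = Num.sqrt (inner2 p x x).
Proof. by rewrite /Hnorm2 /Hnorm !sqr_sqrtr ?inner_ge0. Qed.

Lemma inner2_ge0 p x : 0 <= inner2 p x x.
Proof. by rewrite addr_ge0 ?inner_ge0. Qed.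

Lemma Pop0l v : Pop 0 v = 0.
Proof.
apply/funext => k; rewrite PopE (_ : advect _ _ k = 0) ?mul0mx ?oppr0 //.
apply/rowP => r; rewrite advectE [RHS]mxE big1 // => s _.
rewrite (_ : adv_term _ _ _ _ _ = fun=> 0) ?csum0 ?mulr0 //.
by apply/funext => h; rewrite /adv_term mxE mul0r.
Qed.

Definition hfield2 x := hfield x.1 /\ hfield x.2.

Lemma hfield2P x : Hinf2 x <-> hfield2 x.
Proof.
split=> [h|[h1 h2] p]; last by split; move: p; apply/hfieldP.
by split; apply/hfieldP => p; have [] := h p.
Qed.

(** The estimate is used for truncations, whose images are finitely supported, with a bound [C]
    uniform in N; [energy_summable_limit] then yields summability. Pairs with vanishing second
    component isolate [Pop v w] in [Pop2], up to a nonnegative term in the squared norm. *)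
Lemma hfield_Pop (K : R -> R -> R) v w : P_constants d K -> hfield v -> hfield w ->
  hfield (Pop v w).
Proof.
move=> hK hv hw; split.
- by move=> k; exact: PopN_conj.
- by move=> k; exact: Pop_div.
- exact: Pop_zero.
move=> p; pose q := Num.max p (d%:R / 2 + 1).
have pq : p <= q by rewrite le_max lexx.
have cq : d%:R / 2 < q by rewrite lt_max ltrDl ltr01 orbT.
apply: (energy_summable_mono pq).
have [K0 HK] := hK q q cq (lexx q).
have sv s : energy_summable s v by case: hv.
have sw s : energy_summable s w by case: hw.
pose C := K q q * (Hnorm2 q (v, 0) * Hnorm2 (q + 1) (w, 0)).
have ptr N (s : R) (u : vcoef R d) : energy_summable s u ->
    Hnorm2 s (trunc N u, 0) <= Hnorm2 s (u, 0).
  move=> su; rewrite !Hnorm2E; apply: ler_wsqrtr; rewrite /inner2 lerD2r.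
  exact: inner_trunc_contract.
apply: (@energy_summable_limit _ \oo _ _ q (fun N => Pop (trunc N v) (trunc N w)) _ (C ^+ 2)).
- by move=> k; exact: Pop_trunc_cvg.
- by move=> N; exact: Pop_trunc_summable.
move=> N.
have hv2 : Hinf2 (trunc N v, 0 : vcoef R d).
  by apply/hfield2P; split; [exact: hfield_trunc|exact: hfield0].
have hw2 : Hinf2 (trunc N w, 0 : vcoef R d).
  by apply/hfield2P; split; [exact: hfield_trunc|exact: hfield0].
have := HK _ _ (hv2 q) (hw2 (q + 1)).
set X := Hnorm2 q _; set a := Hnorm2 q _; set b := Hnorm2 (q + 1) _.
move=> h.
have X0 : 0 <= X by exact: sqrtr_ge0.
have aN : a <= Hnorm2 q (v, 0) by exact: ptr.
have bN : b <= Hnorm2 (q + 1) (w, 0) by exact: ptr.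
have a0 : 0 <= a by exact: sqrtr_ge0.
have b0 : 0 <= b by exact: sqrtr_ge0.
have ab := ler_pM a0 b0 aN bN.
have XC : X <= C.
  apply: le_trans h _; rewrite /C.
  rewrite (_ : 2^-1 * K q q * (a * b + a * b) = K q q * (a * b)); last by field.
  by rewrite ler_pM2l.
apply: (@le_trans _ _ (X ^+ 2)); last by rewrite ler_pXn2r // nnegrE // (le_trans X0).
rewrite /X Hnorm2E sqr_sqrtr ?inner2_ge0 // /inner2 /Pop2 /= Pop0l subr0.
by rewrite lerDl inner_ge0.
Qed.

End PairBasics.

(** A subtype that will be a module over R rather than R[i]: the reality condition is not stable
    under complex multiples. *)
Record hpair (R : realType) (d : nat) := HPair {
  hval : pair_field R d;
  hvalP : hfield2 hval }.

HB.instance Definition _ (R : realType) d := gen_eqMixin (hpair R d).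
HB.instance Definition _ (R : realType) d := gen_choiceMixin (hpair R d).

Section PairModule.
Variables (R : realType) (d : nat).
Local Notation H := (hpair R d).

Lemma hval_inj : injective (@hval R d).
Proof.
by move=> [x hx] [y hy] /= xy; subst y; congr HPair; exact: Prop_irrelevance.
Qed.

Definition hscale (l : R) (x : pair_field R d) : pair_field R d :=
  (l%:C *: x.1, l%:C *: x.2).

Lemma hfield2D (x y : pair_field R d) : hfield2 x -> hfield2 y -> hfield2 (x + y).
Proof. by move=> [x1 x2] [y1 y2]; split; exact: hfieldD. Qed.
Lemma hfield2N (x : pair_field R d) : hfield2 x -> hfield2 (- x).
Proof. by move=> [x1 x2]; split; exact: hfieldN. Qed.
Lemma hfield2_0 : hfield2 (0 : pair_field R d).
Proof. by split; exact: hfield0. Qed.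
Lemma hfield2Z l (x : pair_field R d) : hfield2 x -> hfield2 (hscale l x).
Proof. by move=> [x1 x2]; split; exact: hfieldZ. Qed.

Definition hp0 : H := HPair hfield2_0.
Definition hpadd (x y : H) : H := HPair (hfield2D (hvalP x) (hvalP y)).
Definition hpopp (x : H) : H := HPair (hfield2N (hvalP x)).
Definition hpscale (l : R) (x : H) : H := HPair (hfield2Z l (hvalP x)).

Lemma hpaddA : associative hpadd.
Proof. by move=> x y z; apply: hval_inj; rewrite /= addrA. Qed.
Lemma hpaddC : commutative hpadd.
Proof. by move=> x y; apply: hval_inj; rewrite /= addrC. Qed.
Lemma hpadd0 : left_id hp0 hpadd.
Proof. by move=> x; apply: hval_inj; rewrite /= add0r. Qed.
Lemma hpaddN : left_inverse hp0 hpopp hpadd.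
Proof. by move=> x; apply: hval_inj; rewrite /= addNr. Qed.

HB.instance Definition _ := GRing.isZmodule.Build H hpaddA hpaddC hpadd0 hpaddN.

Lemma hpscaleA a b x : hpscale a (hpscale b x) = hpscale (a * b) x.
Proof. by apply: hval_inj; rewrite /= /hscale /= !scalerA rmorphM. Qed.
Lemma hpscale1 : left_id 1 hpscale.
Proof. by move=> x; apply: hval_inj; rewrite /= /hscale !scale1r; case: hval. Qed.
Lemma hpscaleDr : right_distributive hpscale +%R.
Proof. by move=> l x y; apply: hval_inj; rewrite /= /hscale /= !scalerDr. Qed.
Lemma hpscaleDl x : {morph hpscale^~ x : a b / a + b}.
Proof. by move=> a b; apply: hval_inj; rewrite /= /hscale /= !rmorphD !scalerDl. Qed.

HB.instance Definition _ :=
  GRing.Zmodule_isLmodule.Build R H hpscaleA hpscale1 hpscaleDr hpscaleDl.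

End PairModule.

(** * Dissipation and bilinearity for single fields *)

Section SingleField.
Variables (R : realType) (d : nat).
Implicit Types (p l c : R) (v w : vcoef R d).

Lemma hfield_energy p v : hfield v -> energy_summable p v.
Proof. by case. Qed.

Lemma innerZ p l v w : energy_summable p v -> energy_summable p w ->
  inner p (l%:C *: v) w = l * inner p v w.
Proof.
move=> sv sw; rewrite !inner_fsum /fsum -rsumZ; last exact: cross_summable.
by apply: eq_rsum => k _; rewrite rdotZl mulrCA.
Qed.

(** Poincare's inequality in Fourier form: |v|_(p+1) >= |v|_p because nonzero modes have |k| >=
    1. *)
Lemma inner_dissipation p c m v : hfield v -> 0 <= m -> m <= c ->
  inner p (c%:C *: laplacian v) v <= - m * inner p v v.
Proof.
move=> hv m0 mc; have s q := hfield_energy q hv.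
rewrite (innerZ _ (hfield_energy p (hfield_laplacian hv)) (s p)).
rewrite (inner_laplacian (s (p + 1))) mulrN mulNr lerN2.
apply: ler_pM => //; first exact: inner_ge0.
by apply: (inner_mono _ (s p) (s (p + 1))); rewrite lerDl.
Qed.

Lemma inner_dissipation2 p c v : hfield v ->
  inner p (c%:C *: laplacian v) (c%:C *: laplacian v) = c ^+ 2 * inner (p + 2) v v.
Proof.
move=> hv; have hl := hfield_laplacian hv; have s := hfield_energy p hl.
have sc := hfield_energy p (hfieldZ c hl).
by rewrite (innerZ c s sc) inner_sym (innerZ c s s) inner_laplacian2 mulrA -expr2.
Qed.

Lemma dissipation_lin c l v w : c%:C *: laplacian (l%:C *: v + w) =
  l%:C *: (c%:C *: laplacian v) + c%:C *: laplacian w.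
Proof.
by rewrite laplacian_lin scalerDr !scalerA (mulrC c%:C).
Qed.

Lemma PopB_linl l (a b c e x y : vcoef R d) : hfield a -> hfield b -> hfield c ->
  hfield e -> hfield x -> hfield y ->
  Pop (l%:C *: a + b) x - Pop (l%:C *: c + e) y =
  l%:C *: (Pop a x - Pop c y) + (Pop b x - Pop e y).
Proof.
move=> ha hb hc he hx hy; rewrite (Pop_linl l ha hb hx) (Pop_linl l hc he hy).
by rewrite scalerBr opprD addrACA.
Qed.

Lemma PopB_linr l (a b c e x y : vcoef R d) : hfield a -> hfield b -> hfield c ->
  hfield e -> hfield x -> hfield y ->
  Pop x (l%:C *: a + b) - Pop y (l%:C *: c + e) =
  l%:C *: (Pop x a - Pop y c) + (Pop x b - Pop y e).
Proof.
move=> ha hb hc he hx hy; rewrite (Pop_linr l ha hb hx) (Pop_linr l hc he hy).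
by rewrite scalerBr opprD addrACA.
Qed.

Lemma trunc_scale N l v : trunc N (l%:C *: v) = l%:C *: trunc N v.
Proof.
apply/funext => k; rewrite /trunc [RHS]/GRing.scale /=.
by case: ifP => // _; rewrite scaler0.
Qed.

Lemma trunc_dissipation N c v :
  trunc N (c%:C *: laplacian v) = c%:C *: laplacian (trunc N v).
Proof. by rewrite trunc_scale trunc_laplacian. Qed.

End SingleField.

(** * The torus as an instance of the abstract scale *)

Section TorusSpace.
Variables (R : realType) (d : nat) (nu eta : R).
Hypotheses (nu0 : 0 < nu) (eta0 : 0 < eta).
Variables (K G : R -> R -> R).
Hypotheses (hK : P_constants d K) (hG : energy_constants d G).
Local Notation H := (hpair R d).
Implicit Types (p q l : R) (x y z : H).

Let h1 (x : H) : hfield (hval x).1. Proof. by case: (hvalP x). Qed.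
Let h2 (x : H) : hfield (hval x).2. Proof. by case: (hvalP x). Qed.

Lemma min_gt0 : 0 < Num.min nu eta.
Proof. by rewrite lt_min nu0. Qed.

Definition hip p x y : R := inner2 p (hval x) (hval y).

Let s1 p x : energy_summable p (hval x).1 := hfield_energy p (h1 x).
Let s2 p x : energy_summable p (hval x).2 := hfield_energy p (h2 x).

Lemma hip_linl p l x y z : hip p (l *: x + y) z = l * hip p x z + hip p y z.
Proof.
rewrite /hip /inner2 (inner_linl l (s1 p x) (s1 p y) (s1 p z)).
by rewrite (inner_linl l (s2 p x) (s2 p y) (s2 p z)) mulrDr addrACA.
Qed.

Lemma hip_sym p x y : hip p x y = hip p y x.
Proof. by rewrite /hip /inner2 inner_sym (inner_sym p (hval x).2). Qed.

Lemma hip_ge0 p x : 0 <= hip p x x.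
Proof. exact: inner2_ge0. Qed.

Lemma hip_eq0 p x : hip p x x = 0 -> x = 0.
Proof.
move=> /eqP; rewrite /hip /inner2 paddr_eq0 ?inner_ge0 // => /andP[/eqP e1 /eqP e2].
apply: hval_inj.
have z1 : (hval x).1 0 = 0 by case: (h1 x).
have z2 : (hval x).2 0 = 0 by case: (h2 x).
have := inner_eq0 z1 (hfield_energy p (h1 x)) e1; have := inner_eq0 z2 (hfield_energy p (h2 x)) e2.
by case: (hval x) => a b /= -> ->.
Qed.

Lemma hip_mono p q x : p <= q -> hip p x x <= hip q x x.
Proof.
move=> pq.
exact: lerD (inner_mono pq (s1 p x) (s1 q x)) (inner_mono pq (s2 p x) (s2 q x)).
Qed.

Lemma hfield2_Aop (x : pair_field R d) : hfield2 x -> hfield2 (Aop nu eta x).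
Proof. by move=> [x1 x2]; split; apply/hfieldZ/hfield_laplacian. Qed.

Definition hA x : H := HPair (hfield2_Aop (hvalP x)).

Lemma hA_lin l x y : hA (l *: x + y) = l *: hA x + hA y.
Proof. by apply: hval_inj; congr pair; exact: dissipation_lin. Qed.

Lemma hA_dis p x : hip p (hA x) x <= - Num.min nu eta * hip p x x.
Proof.
have m1 : Num.min nu eta <= nu by rewrite ge_min lexx.
have m2 : Num.min nu eta <= eta by rewrite ge_min lexx orbT.
rewrite /hip /inner2 mulrDr.
exact: lerD (inner_dissipation p (h1 x) (ltW min_gt0) m1)
  (inner_dissipation p (h2 x) (ltW min_gt0) m2).
Qed.

Lemma hA_bound p x : ipnorm hip p (hA x) <= (nu + eta) * ipnorm hip (p + 2) x.
Proof.
have l0 : 0 <= nu + eta := addr_ge0 (ltW nu0) (ltW eta0).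
rewrite /ipnorm -[X in X * _](ger0_norm l0) -sqrtr_sqr -sqrtrM ?sqr_ge0 //.
apply: ler_wsqrtr; rewrite /hip /inner2 mulrDr.
rewrite (inner_dissipation2 p nu (h1 x)) (inner_dissipation2 p eta (h2 x)).
have n1 : nu ^+ 2 <= (nu + eta) ^+ 2.
  by rewrite ler_pXn2r ?nnegrE ?(ltW nu0) // lerDl ltW.
have n2 : eta ^+ 2 <= (nu + eta) ^+ 2.
  by rewrite ler_pXn2r ?nnegrE ?(ltW eta0) // lerDr ltW.
exact: lerD (ler_wpM2r (inner_ge0 _ _) n1) (ler_wpM2r (inner_ge0 _ _) n2).
Qed.

Lemma hfield2_Pop2 (x y : pair_field R d) : hfield2 x -> hfield2 y -> hfield2 (Pop2 x y).
Proof.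
move=> [x1 x2] [y1 y2]; split.
  exact: hfieldD (hfield_Pop hK x1 y1) (hfieldN (hfield_Pop hK x2 y2)).
exact: hfieldD (hfield_Pop hK x1 y2) (hfieldN (hfield_Pop hK x2 y1)).
Qed.

Definition hP x y : H := HPair (hfield2_Pop2 (hvalP x) (hvalP y)).

Lemma hP_linl l x y z : hP (l *: x + y) z = l *: hP x z + hP y z.
Proof. by apply: hval_inj; congr pair; exact: PopB_linl. Qed.

Lemma hP_linr l x y z : hP z (l *: x + y) = l *: hP z x + hP z y.
Proof. by apply: hval_inj; congr pair; exact: PopB_linr. Qed.

Lemma hnormE p x : ipnorm hip p x = Hnorm2 p (hval x).
Proof. by rewrite Hnorm2E. Qed.

Let hsp p x : Hsp2 p (hval x).
Proof. by have /hfield2P := hvalP x; apply. Qed.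

Lemma hP_bound p n : d%:R / 2 < n -> n <= p -> 0 < K p n /\
  forall v w, ipnorm hip p (hP v w) <= 2^-1 * K p n *
    (ipnorm hip p v * ipnorm hip (n + 1) w + ipnorm hip n v * ipnorm hip (p + 1) w).
Proof.
move=> dn np; have [K0 HK] := hK dn np; split => // v w.
by rewrite !hnormE; apply: HK; exact: hsp.
Qed.

Lemma hP_energy p n : d%:R / 2 + 1 < n -> n <= p -> 0 < G p n /\
  forall v w, `|hip p (hP v w) w| <= 2^-1 * G p n *
    (ipnorm hip p v * ipnorm hip n w + ipnorm hip n v * ipnorm hip p w)
      * ipnorm hip p w.
Proof.
move=> dn np; have [G0 HG] := hG dn np; split => // v w.
by rewrite !hnormE; apply: HG; exact: hsp.
Qed.

Lemma hfield2_trunc N (x : pair_field R d) : hfield2 x -> hfield2 (trunc N x.1, trunc N x.2).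
Proof. by move=> [x1 x2]; split; exact: hfield_trunc. Qed.

Definition htr N x : H := HPair (hfield2_trunc N (hvalP x)).

Lemma htr_lin N l x y : htr N (l *: x + y) = l *: htr N x + htr N y.
Proof. by apply: hval_inj; congr pair; exact: trunc_lin. Qed.

Lemma htr_idem N x : htr N (htr N x) = htr N x.
Proof. by apply: hval_inj; congr pair; exact: trunc_idem. Qed.

Lemma htr_self p N x y : hip p (htr N x) y = hip p x (htr N y).
Proof. by congr (_ + _); exact: inner_trunc. Qed.

Lemma htr_A N x : htr N (hA x) = hA (htr N x).
Proof. by apply: hval_inj; congr pair; exact: trunc_dissipation. Qed.

Lemma htr_bernstein p q N : exists C, forall x,
  ipnorm hip q (htr N x) <= C * ipnorm hip p x.
Proof.
have [C C0 HC] := trunc_bernstein d N p q.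
exists (Num.sqrt C) => x; rewrite /ipnorm -sqrtrM //; apply: ler_wsqrtr.
rewrite /hip /inner2 mulrDr.
exact: lerD (HC _ (s1 p x) (s1 q x)) (HC _ (s2 p x) (s2 q x)).
Qed.

Lemma htr_approx p N x :
  ipnorm hip p (x - htr N x) <= N.+1%:R^-1 * ipnorm hip (p + 1) x.
Proof.
have i0 : 0 <= N.+1%:R^-1 :> R by rewrite invr_ge0.
rewrite /ipnorm -[X in X * _](ger0_norm i0) -sqrtr_sqr -sqrtrM ?sqr_ge0 //.
apply: ler_wsqrtr; rewrite /hip /inner2 mulrDr.
exact: lerD (inner_tail N (s1 p x) (s1 (p + 1) x)) (inner_tail N (s2 p x) (s2 (p + 1) x)).
Qed.

Lemma h_montel (U : set_system nat) : UltraFilter U -> forall x : nat -> H,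
  (forall p, exists C, forall m, ipnorm hip p (x m) <= C) ->
  exists y, forall p, ipnorm hip p (x m - y) @[m --> U] --> (0 : R).
Proof.
move=> UU x bd.
have sq p : exists C, forall m, hip p (x m) (x m) <= C.
  have [C HC] := bd p; exists (C ^+ 2) => m; rewrite -[leLHS]sqr_sqrtr ?hip_ge0 //.
  have n0 : 0 <= ipnorm hip p (x m) by exact: sqrtr_ge0.
  have h := HC m.
  by apply: lerXn2r; rewrite ?nnegrE //; exact: le_trans n0 h.
have b1 p : exists C, forall m, inner p (hval (x m)).1 (hval (x m)).1 <= C.
  by have [C HC] := sq p; exists C => m; apply: le_trans (HC m); rewrite lerDl inner_ge0.
have b2 p : exists C, forall m, inner p (hval (x m)).2 (hval (x m)).2 <= C.
  by have [C HC] := sq p; exists C => m; apply: le_trans (HC m); rewrite lerDr inner_ge0.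
have [y1 hy1 cy1] := hfield_montel UU (fun m => h1 (x m)) b1.
have [y2 hy2 cy2] := hfield_montel UU (fun m => h2 (x m)) b2.
exists (HPair (conj hy1 hy2 : hfield2 (y1, y2))) => p.
have UF : Filter U by exact: (@ultra_proper _ _ UU).
have h : hip p (x m - HPair (conj hy1 hy2 : hfield2 (y1, y2)))
    (x m - HPair (conj hy1 hy2 : hfield2 (y1, y2))) @[m --> U] --> (0 : R).
  by rewrite -[X in _ --> X](addr0 0); exact: (cvgD (cy1 p) (cy2 p)).
have h' := cvg_comp _ _ h (@sqrt_continuous R 0).
by rewrite -[X in _ --> X](sqrtr0 R); exact: h'.
Qed.

Definition torus_space : mhd_space R := @MHDSpace R H hip hip_linl hip_sym hip_ge0
  hip_eq0 hip_mono hA hA_lin (Num.min nu eta) min_gt0 hA_dis (nu + eta)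
  hA_bound hP hP_linl hP_linr (d%:R / 2) K G hP_bound hP_energy htr htr_lin htr_idem
  htr_self htr_A htr_bernstein htr_approx h_montel.

End TorusSpace.

Local Close Scope complex_scope.

(** * Decay and transfer *)

Section DecayIntegrals.
Variable R : realType.
Implicit Types f g : R -> R.

Lemma eq_int0oo f g : (forall t : R, 0 <= t -> f t = g t) -> int0oo f = int0oo g.
Proof.
move=> fg; apply: eq_integral => t; rewrite inE /= in_itv /= andbT => t0.
by rewrite fg.
Qed.

Lemma le_int0oo f g : (forall t : R, 0 <= t -> 0 <= f t <= g t) ->
  measurable_fun [set: R] f -> measurable_fun [set: R] g ->
  (int0oo f <= int0oo g)%E.
Proof.
move=> fg mf mg; apply: ge0_le_integral => //.
- move=> x xi; have : (x : R) \in `[0, +oo[ := xi.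
  by rewrite in_itv /= andbT lee_fin => /fg /andP[].
- by apply/measurable_EFinP; apply: measurable_funS mf.
- by apply/measurable_EFinP; apply: measurable_funS mg.
- move=> x xi; have : (x : R) \in `[0, +oo[ := xi.
  by rewrite in_itv /= andbT lee_fin => /fg /andP[].
Qed.

Lemma cvg_expRN (r : R) : 0 < r -> expR (- r * t) @[t --> +oo] --> (0 : R).
Proof.
move=> r0.
rewrite (_ : (fun x => expR (- r * x)) = (fun z => expR (- z)) \o (fun z => r * z)); last first.
  by apply: eq_fun => x; rewrite mulNr.
apply: (@cvg_comp _ _ _ _ _ _ (pinfty_nbhs R)); last exact: cvgr_expR.
exact: gt0_cvgMry.
Qed.

Lemma continuous_expRMl (C r : R) : continuous (fun t : R => C * expR (- r * t)).
Proof.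
move=> t; apply: cvgMr.
have h : (fun x : R => - r * x) @ t --> - r * t by apply: cvgMr; exact: cvg_id.
exact: (cvg_comp _ _ h (@continuous_expR R _)).
Qed.

Lemma int0oo_expR (C r : R) : 0 < r -> 0 <= C ->
  (int0oo (fun t => (C * expR (- r * t))%R) < +oo)%E.
Proof.
move=> r0 C0.
pose F (t : R) := - (C / r) * expR (- r * t).
have dF (t : R) : is_derive t 1 F (C * expR (- r * t)).
  have hl : is_derive t 1 (fun x : R => - r * x) (- r).
    have H := @is_deriveZ _ _ _ (@id R) (- r) t 1 1 (is_derive_id _ _).
    by apply: is_derive_eq H _; rewrite /GRing.scale /= mulr1.
  have H := @is_deriveZ _ _ _ _ (- (C / r)) t _ _
    (@is_derive1_comp _ expR _ t _ _ (is_derive_expR _) hl).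
  by apply: is_derive_eq H _; rewrite /GRing.scale /=; field; exact: lt0r_neq0.
have cF : continuous F by move=> t; exact: is_derive_continuous (dF t).
rewrite /int0oo (@ge0_continuous_FTC2y _ _ F 0 0) ?ltry //.
- by move=> x _; rewrite mulr_ge0 ?expR_ge0.
- exact/continuous_subspaceT/continuous_expRMl.
- by rewrite -(mulr0 (- (C / r))); apply: cvgMr; exact: cvg_expRN.
- by apply: cvg_at_right_filter; exact: cF.
- by move=> x _; rewrite derive1E; have [_] := dF x.
Qed.

Lemma int0oo_powR_decay (f : R -> R) (C r gamma : R) : 0 < r -> 0 <= C -> 0 < gamma ->
  continuous f -> (forall t : R, 0 <= t -> 0 <= f t <= C * expR (- r * t)) ->
  (int0oo (fun t => (f t `^ gamma)%R) < +oo)%E.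
Proof.
move=> r0 C0 g0 cf fb.
have rg : 0 < r * gamma by rewrite mulr_gt0.
apply: le_lt_trans (int0oo_expR rg (powR_ge0 C gamma)).
apply: le_int0oo.
- move=> t t0; have /andP[f0 f1] := fb t t0; rewrite powR_ge0 /=.
  have -> : C `^ gamma * expR (- (r * gamma) * t) = (C * expR (- r * t)) `^ gamma.
    rewrite powRM ?expR_ge0 // -expRM; congr (_ * expR _); ring.
  by apply: ge0_ler_powR; rewrite ?nnegrE ?mulr_ge0 ?expR_ge0 // ltW.
- apply: (@measurableT_comp _ _ _ _ _ _ (fun x : R => x `^ gamma) setT f).
    exact: measurable_powR.
  exact: continuous_measurable_fun.
- by apply: continuous_measurable_fun; exact: continuous_expRMl.
Qed.

End DecayIntegrals.

(** * Difference quotients *)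

Section DifferenceQuotient.
Variables (R : realType) (E : mhd_space R).

(** The bridge to [is_tderiv], whose quotient is taken along neighbourhoods punctured at t. *)
Lemma hderivP (f f' : R -> E) : hderiv f f' <-> forall t p e : R, 0 <= t -> 0 < e ->
  exists2 dl, 0 < dl & forall s, 0 <= s -> s != t -> `|s - t| < dl ->
    nm p ((s - t)^-1 *: (f s - f t) - f' t) <= e.
Proof.
have key s t p : s != t -> nm p (f s - f t - (s - t) *: f' t) =
    nm p ((s - t)^-1 *: (f s - f t) - f' t) * `|s - t|.
  move=> st; have st0 : s - t != 0 by rewrite subr_eq0.
  rewrite mulrC -nmZ; congr nm.
  by rewrite scalerBr scalerA mulfV // scale1r.
split=> H t p e t0 e0; have [dl dl0 Hd] := H t p e t0 e0; exists dl => // s s0.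
  move=> st sd; rewrite -(ler_pM2r (_ : 0 < `|s - t|)) ?normr_gt0 ?subr_eq0 //.
  by rewrite -key //; exact: Hd.
have [-> _|st sd] := eqVneq s t.
  by rewrite !subrr scale0r subr0 nm0 normr0 mulr0.
by rewrite key // ler_wpM2r //; exact: Hd.
Qed.

End DifferenceQuotient.

Lemma half_bounds (R : realFieldType) (x : R) : 0 <= x -> x <= 2^-1 ->
  [/\ 0 < 1 - x, (1 - x)^-1 <= 2 & x / (1 - x) <= 1].
Proof.
move=> x0 x1; have y0 : 0 < 1 - x by lra.
split=> //; last by rewrite ler_pdivrMr //; lra.
by rewrite -[leLHS]mul1r ler_pdivrMr //; lra.
Qed.

(** * Transfer from the scale to pairs of Fourier families *)

Section Transfer.
Variables (R : realType) (d : nat) (nu eta : R).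
Variables (E : mhd_space R) (hv : E -> pair_field R d).
Local Notation mu := (Num.min nu eta).
Local Notation G := (Gc E).
Local Notation K := (Kc E).
(** The torus is seen only through these hypotheses, several of which hold by computation for
    [torus_space]; the proofs below rewrite with them instead of unfolding Fourier sums. *)
Hypothesis disE : dis E = mu.
Hypothesis critE : crit E = d%:R / 2.
Hypothesis nmE : forall p x, nm p x = Hnorm2 p (hv x).
Hypothesis hvB : forall x y, hv (x - y) = hv x - hv y.
Hypothesis hvZ : forall (l : R) x, hv (l *: x) = l%:C%C *: hv x.
Hypothesis hv_vfield : forall x, hv (vfield x) = Aop nu eta (hv x) + Pop2 (hv x) (hv x).
Hypothesis hvP : forall x, Hinf2 (hv x).
Hypothesis hv_surj : forall u, Hinf2 u -> exists x, hv x = u.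

Lemma timedom_oo (t : R) : timedom (+oo%E) t <-> 0 <= t.
Proof. by split=> [[]|t0] //; split => //; rewrite ltry. Qed.

Lemma hderiv_of_tderiv (f f' : R -> pair_field R d) (g g' : R -> E) :
  (forall t : R, 0 <= t -> hv (g t) = f t) -> (forall t : R, 0 <= t -> hv (g' t) = f' t) ->
  is_tderiv +oo%E f f' -> hderiv g g'.
Proof.
move=> gf gf' df; apply/hderivP => t p e t0 e0.
have [_ _ /(_ p) /cvgrPdist_le /(_ e e0)] := df t (iffRL (timedom_oo t) t0).
rewrite near_withinE => /nbhs_ballP[dl /= dl0 H].
exists dl => // s s0 st sd.
have := H s _ st (iffRL (timedom_oo s) s0).
rewrite /ball /= distrC => /(_ sd).
rewrite sub0r normrN ger0_norm ?sqrtr_ge0 // => h.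
rewrite nmE hvB hvZ hvB (gf s s0) (gf t t0) (gf' t t0); exact: h.
Qed.

Lemma tderiv_of_hderiv (g g' : R -> E) : hderiv g g' ->
  is_tderiv +oo%E (fun t => hv (g t)) (fun t => hv (g' t)).
Proof.
move=> dg t /timedom_oo t0; split; [exact: hvP|exact: hvP|].
move=> p; apply/cvgrPdist_le => e e0; rewrite near_withinE.
have /hderivP/(_ t p e t0 e0)[dl dl0 H] := dg.
apply/nbhs_ballP; exists dl => // s sd st /timedom_oo s0.
have {}sd : `|s - t| < dl by move: sd; rewrite /ball /= distrC.
have := H s s0 st sd; rewrite nmE hvB hvZ hvB => h.
by rewrite sub0r normrN ger0_norm ?sqrtr_ge0.
Qed.

(** A solution may take arbitrary values at negative times, so the lift reads [u] at [hl t], where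
    membership in H^infinity is known. *)
Lemma solution_lift (u : R -> pair_field R d) : MHD_solution nu eta +oo%E u ->
  exists2 g : R -> E, forall t, 0 <= t -> hv (g t) = u t &
    hderiv g (fun t => vfield (g t)).
Proof.
move=> [_ _ du].
have hu (t : R) : exists x, hv x = u (hl t).
  by apply: hv_surj; have [] := du (hl t) (iffRL (timedom_oo _) (hl_ge0 t)).
pose g (t : R) : E := sval (cid (hu t)).
have gE t : 0 <= t -> hv (g t) = u t.
  by move=> t0; rewrite /g; case: cid => x /= ->; rewrite hlE.
exists g => //; apply: (hderiv_of_tderiv gE _ du) => t t0.
by rewrite hv_vfield gE.
Qed.

Lemma solution_of_hderiv (g : R -> E) : hderiv g (fun t => vfield (g t)) ->
  MHD_solution nu eta +oo%E (fun t => hv (g t)).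
Proof.
move=> dg; split; first exact: ltry.
- have [f [f0 df]] := solution_smooth dg.
  exists (fun j t => hv (f j t)); split; first by rewrite f0.
  by move=> j; exact: tderiv_of_hderiv.
- have := tderiv_of_hderiv dg; congr is_tderiv.
  by apply/funext => t; exact: hv_vfield.
Qed.

(** Exponential decay in all norms is clause g and contains f; b and c follow from the limit of the
    exponential, d and e by integrating its powers, and a from the limit at [n0], where the
    threshold mu / G is positive. *)
Lemma decaying_of_exp (g g' : R -> E) : hderiv g g' ->
  (forall p, exists2 C : R, 0 <= C & forall t, 0 <= t ->
    nm p (g t) <= C * expR (- mu * t)) ->
  decaying nu eta G (fun t => hv (g t)).
Proof.
move=> dg H.
have mu0 : 0 < mu by rewrite -disE dis_gt0.
pose n0 : R := crit E + 1 + 1.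
have n01 : crit E + 1 < n0 by rewrite ltrDl.
have n02 : d%:R / 2 + 1 < n0 by rewrite -critE.
have dg_ p : exists2 C : R, 0 <= C & forall t, 0 <= t ->
    Hnorm2 p (hv (g t)) <= C * expR (- mu * t).
  by have [C C0 HC] := H p; exists C; [exact: C0|move=> t t0; rewrite -nmE; exact: HC].
have dc p : Hnorm2 p (hv (g t)) @[t --> +oo] --> (0 : R).
  have [C C0 HC] := dg_ p.
  have h : C * expR (- mu * t) @[t --> +oo] --> (0 : R).
    by rewrite -(mulr0 C); apply: cvgMr; exact: cvg_expRN.
  apply: squeeze_cvgr h; last exact: cvg_cst.
  near=> t; rewrite sqrtr_ge0 /=; apply: HC.
  by near: t; exact: nbhs_pinfty_ge.
have de p gamma : 0 < gamma ->
    (int0oo (fun t => (Hnorm2 p (hv (g t)) `^ gamma)%R) < +oo)%E.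
  move=> gm0; have [C C0 HC] := H p.
  rewrite (@eq_int0oo _ _ (fun t => nm p (g (hl t)) `^ gamma)); last first.
    by move=> t t0; rewrite (hlE t0) nmE.
  apply: (@int0oo_powR_decay _ _ C (mu)) => //.
    exact: continuous_nm dg.
  by move=> t t0; rewrite nm_ge0 hlE ?HC.
split => //.
- have G0 : 0 < G n0 n0 by have [] := @Pbil_energy _ E n0 n0 n01 (lexx n0).
  have e0 : 0 < mu / G n0 n0 by rewrite divr_gt0.
  have /cvgrPdist_lt/(_ _ e0) h := dc n0.
  have : \forall t \near +oo, 0 <= t /\ Hnorm2 n0 (hv (g t)) < mu / G n0 n0.
    near=> t; split; first by near: t; exact: nbhs_pinfty_ge.
    have : `|0 - Hnorm2 n0 (hv (g t))| < mu / G n0 n0 by near: t; exact: h.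
    by rewrite sub0r normrN ger0_norm ?sqrtr_ge0.
  by move=> /filter_ex[t [t0 ht]]; exists n0, t.
- by exists n0.
- by exists n0, 1; split => //; exact: de.
- by exists n0.
Unshelve. all: by end_near. Qed.

Theorem stability_transfer
    (v0 : pair_field R d) (hv0 : Einf nu eta G v0)
    (v : R -> pair_field R d) (hsol : global_decaying_solution nu eta G v)
    (hvv0 : v 0 = v0)
    (J : R -> R)
    (hJ : forall p, 0 <= J p /\
          (int0oo (fun t => Hnorm2 p (v t)) <= (J p)%:E)%E)
    (n : R) (hn : d%:R / 2 + 1 < n) :
  let rho := mu / G n n * expR (- G n n * J n - K n n * J (n + 1)) in
  [/\ forall u0 : pair_field R d,
        Hinf2 u0 -> Hnorm2 n (u0 - v0) < rho -> Einf nu eta G u0,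
      forall (u0 : pair_field R d) (u : R -> pair_field R d),
        Hinf2 u0 -> Hnorm2 n (u0 - v0) < rho ->
        global_decaying_solution nu eta G u -> u 0 = u0 ->
        let delta q := Hnorm2 q (u0 - v0) in
        forall t, 0 <= t ->
          Hnorm2 n (u t - v t) <=
            expR (G n n * J n + K n n * J (n + 1)) / (1 - delta n / rho)
              * delta n * expR (- mu * t) /\
          forall p, n < p ->
            Hnorm2 p (u t - v t) <=
              expR (G p p * J p + K p p * J (p + 1) +
                    G p n * (delta n / rho) / (G n n * (1 - delta n / rho)))
                * delta p * expR (- mu * t)
    & forall (u0 : pair_field R d) (u : R -> pair_field R d),
        Hinf2 u0 -> Hnorm2 n (u0 - v0) <= rho / 2 ->
        global_decaying_solution nu eta G u -> u 0 = u0 ->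
        let delta q := Hnorm2 q (u0 - v0) in
        forall t, 0 <= t ->
          Hnorm2 n (u t - v t) <=
            2 * expR (G n n * J n + K n n * J (n + 1))
              * delta n * expR (- mu * t) /\
          forall p, n < p ->
            Hnorm2 p (u t - v t) <=
              expR (G p p * J p + K p p * J (p + 1) + G p n / G n n)
                * delta p * expR (- mu * t)].
Proof.
move=> rho.
have [hsv hdv] := hsol.
have [g gE dgv] := solution_lift hsv.
have hn' : crit E + 1 < n by rewrite critE.
have Gn0 : 0 < G n n by exact: Gc_gt0.
have mu0 : 0 < mu by rewrite -disE dis_gt0.
have hJ' p : (int0oo (fun t => nm p (g (hl t))) <= (J p)%:E)%E.
  have [_ h] := hJ p; rewrite (eq_int0oo (g := fun t => Hnorm2 p (v t))); first exact: h.
  by move=> t t0; rewrite (hlE t0) nmE (gE t t0).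
have decv p : exists2 C : R, 0 <= C & forall t, 0 <= t ->
    nm p (g t) <= C * expR (- mu * t).
  have [C C0 HC] := decaying_g hdv p; exists C => // t t0.
  by rewrite nmE (gE t t0); exact: HC.
have E1 t : 0 <= t -> expR (- mu * t) <= 1.
  by move=> t0; rewrite -expR0 ler_expR mulNr oppr_le0 mulr_ge0 // ltW.
(* Exponential decay bounds v uniformly in time in every norm, as the construction of the perturbed
   solution asks. *)
have bv : fam_bounded (fun _ : nat => g).
  move=> p; have [C C0 HC] := decv p; exists C => // _ t t0.
  by apply: le_trans (HC t t0) _; rewrite ler_piMr // E1.
have rho0 : 0 < rho by rewrite mulr_gt0 ?expR_gt0 // divr_gt0.
have bnd := @perturbation_bounds R E n hn' g J dgv hJ'.
have ex := @perturbed_solution_exists R E n hn' g J dgv hJ' bv.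
rewrite disE in bnd ex.
have bounds (u0 : pair_field R d) (u : R -> pair_field R d) :
    Hinf2 u0 -> Hnorm2 n (u0 - v0) < rho ->
    global_decaying_solution nu eta G u -> u 0 = u0 ->
    let delta q := Hnorm2 q (u0 - v0) in
    forall t, 0 <= t ->
      Hnorm2 n (u t - v t) <=
        expR (G n n * J n + K n n * J (n + 1)) / (1 - delta n / rho)
          * delta n * expR (- mu * t) /\
      forall p, n < p ->
        Hnorm2 p (u t - v t) <=
          expR (G p p * J p + K p p * J (p + 1) +
                G p n * (delta n / rho) / (G n n * (1 - delta n / rho)))
            * delta p * expR (- mu * t).
  move=> hu0 small [hu _] u00 delta t t0.
  have [f fE df] := solution_lift hu.
  have e q s : 0 <= s -> nm q (f s - g s) = Hnorm2 q (u s - v s).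
    by move=> s0; rewrite nmE hvB (fE s s0) (gE s s0).
  have e0 q : nm q (f 0 - g 0) = delta q by rewrite (e q 0 (lexx 0)) u00 hvv0.
  have small' : nm n (f 0 - g 0) < rho by rewrite e0.
  have [b1 b2] := bnd f df small' t t0.
  rewrite !(e0 n) (e n t t0) in b1; split; first exact: b1.
  by move=> p np; have := b2 p (ltW np); rewrite !(e0 n) (e0 p) (e p t t0).
split; [|exact: bounds|].
- move=> u0 hu0 small.
  have [x0 x0E] := hv_surj hu0.
  have e0 q : nm q (x0 - g 0) = Hnorm2 q (u0 - v0).
    by rewrite nmE hvB x0E (gE 0 (lexx 0)) hvv0.
  have small' : nm n (x0 - g 0) < rho by rewrite e0.
  have [f [f0 df]] := ex x0 small'.
  split; first exact: hu0.
  exists +oo%E, (fun t => hv (f t)); split; [|by rewrite f0|reflexivity|].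
    split; first exact: solution_of_hderiv df.
    (* A global solution is maximal since no T' exceeds +oo. *)
    by move=> [T' [u' [+ _ _]]]; rewrite ltNge leey.
  apply: (decaying_of_exp df) => p.
  (* Decay of u = (u - v) + v is shown in the norm q >= n, where both parts decay at rate mu with
     constants [D] and [C]. *)
  pose q := Num.max n p.
  have nq : n <= q by rewrite le_max lexx.
  have pq : p <= q by rewrite le_max lexx orbT.
  have [C C0 HC] := decv q.
  have small'' : nm n (f 0 - g 0) < rho by rewrite f0.
  have Hb := bnd f df small''.
  pose D := expR (G q q * J q + K q q * J (q + 1) +
      G q n * (nm n (f 0 - g 0) / rho) / (G n n * (1 - nm n (f 0 - g 0) / rho)))
    * nm q (f 0 - g 0).
  exists (D + C); first by rewrite addr_ge0 // mulr_ge0 ?expR_ge0 ?nm_ge0.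
  move=> t t0; apply: le_trans (nm_mono _ pq) _.
  rewrite -[f t](subrK (g t)) mulrDl; apply: le_trans (nmD _ _ _) _.
  apply: lerD; last exact: HC.
  by have [_ /(_ q nq)] := Hb t t0.
- move=> u0 u hu0 small hu u00 delta t t0.
  have d0 : 0 <= delta n by exact: sqrtr_ge0.
  have small' : delta n < rho.
    by apply: le_lt_trans small _; rewrite ltr_pdivrMr // ltr_pMr // ltr1n.
  have [b1 b2] := bounds u0 u hu0 small' hu u00 t t0.
  (* For x <= 1/2 the general bounds simplify through (1 - x)^-1 <= 2 and x / (1 - x) <= 1. *)
  set x := delta n / rho in b1 b2.
  have x0 : 0 <= x by rewrite divr_ge0 // ltW.
  have x1 : x <= 2^-1 by rewrite ler_pdivrMr // mulrC.
  have [y0 i2 i1] := half_bounds x0 x1.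
  have e0 := expR_ge0 (- mu * t).
  split.
    apply: (le_trans b1); apply: (ler_wpM2r e0); apply: (ler_wpM2r d0).
    by rewrite mulrC; apply: ler_wpM2r; [exact: expR_ge0|exact: i2].
  move=> p np; apply: (le_trans (b2 p np)); apply: (ler_wpM2r e0).
  apply: ler_wpM2r; first exact: sqrtr_ge0.
  rewrite ler_expR lerD2l.
  have Gp0 : 0 < G p n by apply: Gc_gt0 => //; exact: ltW.
  rewrite (_ : _ / _ = G p n / G n n * (x / (1 - x))); last first.
    by field; rewrite (gt_eqF y0) (gt_eqF Gn0).
  by apply: ler_piMr; [rewrite divr_ge0 // ltW|exact: i1].
Qed.

End Transfer.

Theorem theorem5p1 (R : realType) (d : nat) (hd : (2 <= d)%N)
    (nu eta : R) (hnu : 0 < nu) (heta : 0 < eta)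
    (K G : R -> R -> R) (hK : P_constants d K) (hG : energy_constants d G)
    (v0 : pair_field R d) (hv0 : Einf nu eta G v0)
    (v : R -> pair_field R d) (hv : global_decaying_solution nu eta G v)
    (hvv0 : v 0 = v0)
    (J : R -> R)
    (hJ : forall p, 0 <= J p /\
          (int0oo (fun t => Hnorm2 p (v t)) <= (J p)%:E)%E)
    (n : R) (hn : d%:R / 2 + 1 < n) :
  let mu := Num.min nu eta in
  let rho := mu / G n n * expR (- G n n * J n - K n n * J (n + 1)) in
  [/\ forall u0 : pair_field R d,
        Hinf2 u0 -> Hnorm2 n (u0 - v0) < rho -> Einf nu eta G u0,
      forall (u0 : pair_field R d) (u : R -> pair_field R d),
        Hinf2 u0 -> Hnorm2 n (u0 - v0) < rho ->
        global_decaying_solution nu eta G u -> u 0 = u0 ->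
        let delta q := Hnorm2 q (u0 - v0) in
        forall t, 0 <= t ->
          Hnorm2 n (u t - v t) <=
            expR (G n n * J n + K n n * J (n + 1)) / (1 - delta n / rho)
              * delta n * expR (- mu * t) /\
          forall p, n < p ->
            Hnorm2 p (u t - v t) <=
              expR (G p p * J p + K p p * J (p + 1) +
                    G p n * (delta n / rho) / (G n n * (1 - delta n / rho)))
                * delta p * expR (- mu * t)
    & forall (u0 : pair_field R d) (u : R -> pair_field R d),
        Hinf2 u0 -> Hnorm2 n (u0 - v0) <= rho / 2 ->
        global_decaying_solution nu eta G u -> u 0 = u0 ->
        let delta q := Hnorm2 q (u0 - v0) in
        forall t, 0 <= t ->
          Hnorm2 n (u t - v t) <=
            2 * expR (G n n * J n + K n n * J (n + 1))
              * delta n * expR (- mu * t) /\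
          forall p, n < p ->
            Hnorm2 p (u t - v t) <=
              expR (G p p * J p + K p p * J (p + 1) + G p n / G n n)
                * delta p * expR (- mu * t)].
Proof.
(* Dissipation rate, critical index, linearity of [hval] and the form of the vector field agree by
   computation; norms agree by [hnormE], and membership in H^infinity is exchanged for [hfield2]. *)
exact: (@stability_transfer R d nu eta (torus_space hnu heta hK hG) (@hval R d)
  erefl erefl (fun p x => hnormE p x) (fun _ _ => erefl) (fun _ _ => erefl) (fun _ => erefl)
  (fun x => iffRL (hfield2P (hval x)) (hvalP x))
  (fun u hu => ex_intro _ (HPair (iffLR (hfield2P u) hu)) erefl) v0 hv0 v hv hvv0 J hJ n hn).
Qed.
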